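(* Let $N,m>1$ be integers. Let $f:\mathbb{Z}/N\mathbb{Z}\to\mu_m\cup\{0\}$ have order $m$ and parity $a\in\{0,1\}$, with $f(1)=1$ and $f(n)=0$ if and only if $\gcd(n,N)>1$. Put $d=\gcd(m,N)$, and let $H\le(\mathbb{Z}/m\mathbb{Z})^\times$ be a subgroup such that the reduction map $\pi:H\to(\mathbb{Z}/d\mathbb{Z})^\times$ is surjective. Assume that, for each $c\in H$, the function $L(s,f^c)$ is holomorphic at $s=1$ and there exists $\varepsilon_c\in\mathbb{C}^\times$ such that $$\Lambda(s,f^c)=\varepsilon_c\,\Lambda(1-s,\overline{f^c}),\qquad s\in\mathbb{C}.$$ Then $f$ is a primitive Dirichlet character modulo $N$. Furthermore, if $\gcd(m,N)=1$, then $N$ is odd and squarefree.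
   Context: $\mu_m\subset\mathbb{C}$ is the set of $m$-th roots of unity. A function $f$ on $\mathbb{Z}/N\mathbb{Z}$ is extended periodically to $\mathbb{Z}$. ''$f$ has order $m$'' means that $m$ is the minimal positive integer such that $f(x)\in\mu_m$ for all $x\in(\mathbb{Z}/N\mathbb{Z})^\times$. ''$f$ has parity $a\in\{0,1\}$'' means $f(-x)=(-1)^a f(x)$ for all $x\in\mathbb{Z}$. For $c\in(\mathbb{Z}/m\mathbb{Z})^\times$, $f^c(x):=f(x)^c$ when $\gcd(x,N)=1$ and $f^c(x):=0$ otherwise; $\overline{f^c}$ is its complex conjugate. For a function $g:\mathbb{Z}/N\mathbb{Z}\to\mathbb{C}$ (extended periodically), $L(s,g):=\sum_{n\ge1}g(n)n^{-s}$ for $\Re(s)>1$, and $L(s,g)$ also denotes its meromorphic continuation to $\mathbb{C}$ (holomorphic on $\mathbb{C}\setminus\{1\}$). With $a\in\{0,1\}$ the parity, the completed function is $$\Lambda(s,g):=\Bigl(\frac{N}{\pi}\Bigr)^{\frac{s+a}{2}}\Gamma\Bigl(\frac{s+a}{2}\Bigr)L(s,g),$$ regarded as a meromorphic function on $\mathbb{C}$. In the claim the same $a$ (the parity of $f$) is used for all $f^c$ and $\overline{f^c}$. A Dirichlet character $\psi$ modulo $N$ is primitive if it has no induced modulus $d<N$; an induced modulus is a divisor $d$ of $N$ such that $\psi(n)=1$ whenever $\gcd(n,N)=1$ and $n\equiv1\pmod d$. *)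

(* Defs.v *)
From HB Require Import structures.
From mathcomp Require Import all_boot all_order all_algebra all_fingroup.
From mathcomp Require Import complex.
From mathcomp Require Import all_classical all_reals all_analysis.

Set Implicit Arguments.
Unset Strict Implicit.
Unset Printing Implicit Defensive.

Import Order.TTheory GRing.Theory Num.Theory numFieldNormedType.Exports.
Local Open Scope classical_set_scope.
Local Open Scope complex_scope.
Local Open Scope ring_scope.

Section ComplexFunctions.
Variable R : realType.
Local Notation C := R[i].

Definition cexp (z : C) : C :=
  (expR (complex.Re z) * cos (complex.Im z)) +i*
  (expR (complex.Re z) * sin (complex.Im z)).

(* x ^ s for real x > 0, with the principal (real) logarithm of x. *)
Definition cpow (x : R) (s : C) : C := cexp (s * (ln x)%:C).

Definition holomorphic_at (F : C -> C) (z : C) : Prop :=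
  \forall w \near (z : C^o), derivable (F : C^o -> C^o) w 1.

(* A meromorphic function is represented by a total function whose value at a
   singularity is irrelevant, so that the conditions below only look at
   punctured neighbourhoods (z^'). *)
Definition meromorphic_at (F : C -> C) (z : C) : Prop :=
  exists (k : nat) (h : C -> C), holomorphic_at h z /\
    \forall w \near (z : C^o)^', F w = h w / (w - z) ^+ k.

(* F is holomorphic at z as a meromorphic function. *)
Definition regular_at (F : C -> C) (z : C) : Prop :=
  exists h : C -> C, holomorphic_at h z /\ \forall w \near (z : C^o)^', F w = h w.

(* Equality in the field of meromorphic functions on the complex plane. *)
Definition eq_meromorphic (F G : C -> C) : Prop :=
  forall z : C, \forall w \near (z : C^o)^', F w = G w.

Definition Gamma_integral (s : C) : C :=
  let F (t : R) : C := cpow t (s - 1) * (expR (- t))%:C in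
  (\int[lebesgue_measure]_(t in `]0%R, +oo[) complex.Re (F t)) +i*
  (\int[lebesgue_measure]_(t in `]0%R, +oo[) complex.Im (F t)).

(* The continuation of Gamma_integral along Gamma (s + 1) = s * Gamma s: the
   shift k is 0 on the half-plane Re s > 0, and otherwise brings s there.
   At the poles 0, -1, -2, ... the product vanishes and the value is 0. *)
Definition Gamma (s : C) : C :=
  let k := if 0 < complex.Re s then 0%N
           else (Num.truncn (- complex.Re s)).+1 in
  Gamma_integral (s + k%:R) / \prod_(j < k) (s + j%:R).

End ComplexFunctions.

Section PeriodicFunctions.
Variables (R : realType) (N : nat).
Local Notation C := R[i].
Implicit Types (g : 'Z_N -> C) (L : C -> C).

(* L is the meromorphic continuation of the Dirichlet series of g. This
   determines L s for all s != 1; L 1 is only meaningful through regular_at. *)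
Definition is_Lfunction g L : Prop :=
  [/\ forall s : C, 1 < complex.Re s ->
        (series (fun n : nat => g n.+1%:R * cpow n.+1%:R (- s)) : nat -> C^o)
          @ \oo --> (L s : C^o),
      forall s : C, s != 1 -> holomorphic_at L s
    & meromorphic_at L 1].

Definition completed (a : nat) L (s : C) : C :=
  cpow (N%:R / pi) ((s + a%:R) / 2%:R) * Gamma ((s + a%:R) / 2%:R) * L s.

Definition has_order g (m : nat) : Prop :=
  [/\ (0 < m)%N,
      forall x : 'Z_N, coprime x N -> m.-unity_root (g x)
    & forall k : nat, (0 < k)%N ->
        (forall x : 'Z_N, coprime x N -> k.-unity_root (g x)) -> (m <= k)%N].

Definition has_parity g (a : nat) : Prop :=
  (a < 2)%N /\ forall x : int, g (- x)%:~R = (-1) ^+ a * g x%:~R.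

(* g ^ c; the exponent is the representative of c in {0, ..., m - 1}, which is
   harmless for g with values in the m-th roots of unity. *)
Definition twist (m : nat) g (c : {unit 'Z_m}) (x : 'Z_N) : C :=
  if coprime x N then g x ^+ (val c : 'Z_m) else 0.

Definition conj_fun g (x : 'Z_N) : C := (g x)^*.

Definition dirichlet_character g : Prop :=
  [/\ g 1 = 1,
      forall x y : 'Z_N, g (x * y) = g x * g y
    & forall x : 'Z_N, g x = 0 <-> ~~ coprime x N].

Definition induced_modulus g (d : nat) : Prop :=
  (d %| N)%N /\
  forall n : nat, coprime n N -> n = 1 %[mod d] -> g n%:R = 1.

Definition primitive_character g : Prop :=
  dirichlet_character g /\
  forall d : nat, induced_modulus g d -> ~~ (d < N)%N.

End PeriodicFunctions.

(* Surjectivity of the reduction H -> (Z/d)^x for a divisor d of m. Elements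
   of (Z/d)^x are given by representatives, as 'Z_d is not Z/d for d = 1. *)
Definition reduction_surjective (m d : nat) (H : {set {unit 'Z_m}}) : Prop :=
  forall u : nat, coprime u d ->
    exists2 c : {unit 'Z_m}, c \in H & (val c : 'Z_m) = u %[mod d].

Definition squarefree (n : nat) : Prop :=
  forall k : nat, (k ^ 2 %| n)%N -> k = 1%N.

(* Main.v *)
Require Import Defs.
From HB Require Import structures.
From mathcomp Require Import all_boot all_order all_algebra all_fingroup.
From mathcomp Require Import algC cyclotomic.
From mathcomp Require Import complex.
From mathcomp Require Import all_classical all_reals all_analysis.
From mathcomp Require Import measurable_realfun.
From mathcomp Require Import ring lra zify.

Set Implicit Arguments.
Unset Strict Implicit.
Unset Printing Implicit Defensive.

Import Order.TTheory GRing.Theory Num.Theory numFieldNormedType.Exports.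
Import Normc.
Local Open Scope classical_set_scope.
Local Open Scope complex_scope.
Local Open Scope ring_scope.

(** Let [g] be one of the functions [f ^ c], [e(x) = exp (2 pi i x)] and
    [ghat j = sum_x g(x) e(j x / N)]. The point of the proof is that a
    functional equation turns into the finite identity
    [ghat j = ghat 1 * conj (g j)] for all [j], called [self_dual] below; the
    rest is Galois theory of roots of unity and elementary number theory.

    From the functional equation to self-duality. For every periodic [g] of
    sum zero and every [k > 1] of the parity of [g], the value [L(1 - k, g)]
    is an explicit constant times the sum of [ghat j / j ^ k] over [j >= 1]
    (the unconditional functional equation). The assumed functional equation
    at [s = 1 - k] gives another expression for [L(1 - k, g)], as a constant
    times the sum of [conj (g j) / j ^ k]. The quotient of the two constants
    does not depend on [k], so that two Dirichlet series are proportional at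
    infinitely many integers [k], hence have proportional coefficients
    ([dirichlet_lead], [fourier_conj]).

    The values [L(1 - k, g)] are computed as follows. Expanding
    [(n + N) ^ (- s)] in powers of [N / n] in the Dirichlet series relates
    [L(s)] to [L(s + 1)], [L(s + 2)] and so on; the relation holds where the
    series converge, and passes to the left because locally uniform
    estimates and the maximum principle propagate a limit ([continuation]).
    At [s = - j] it becomes a linear recurrence for the values at
    non-positive integers ([dirichlet_recurrence]). On the other side, the sums
    of [ghat j / (1 - e(j / n)) ^ k] over [0 < j < n], for [n] a multiple of
    [N], satisfy a recurrence coming from [z ^ n = 1], which after division
    by a power of [n] has the same limit ([tends_fourier_sum]), while the sums
    themselves tend to the lattice sums of [ghat j / j ^ k]
    ([lattice_formula]).

    The Gamma factors are compared at [s = 1 - k + 2 eta] for two values of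
    [k] of the same parity, with [eta] a small positive number: by the
    recursion of Gamma, the factors differ from those for the other [k] by
    finite products only, so the values of the Gamma integral cancel and
    [eta] can tend to 0 ([functional_cross]).

    From self-duality to a character. Self-duality of [f] is a polynomial
    relation with rational coefficients in a primitive root of unity [om] of
    order [N * m]. It persists when [om] is replaced by [om ^ t], with [t]
    prime to [N * m], because cyclotomic polynomials are irreducible. Given
    [r] prime to [N], the surjectivity hypothesis provides [c] in [H]
    congruent to [r] modulo [gcd m N], hence [t] congruent to [c] modulo [m]
    and to [r] modulo [N]; the conjugate relation, compared with the
    self-duality of [f ^ c], says [f ^ c (r n) = f ^ c (r) * f ^ c (n)]
    ([twist_shift], [self_dual_mul]), and [c] is prime to [m].

    Primitivity. If [d < N] were an induced modulus, the sum of [f] over the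
    residues congruent to 1 modulo [d] would be the positive number of units
    among them; but by orthogonality it is a combination of values of [ghat] at
    multiples of [N / d], all zero by self-duality. Finally, if [m] is prime
    to [N] and [k ^ 2] divides [N], then [n] congruent to 1 modulo [N / k]
    implies [n ^ k] congruent to 1 modulo [N], so that [f n] has order
    dividing both [k] and [m], and [N / k] is an induced modulus; and if [N]
    is twice an odd number, then [N / 2] is one. *)

(** * Complex numbers and complex derivatives *)

Section ComplexBasics.
Variable R : realType.
Local Notation C := R[i].
Implicit Types (z w : C) (F G : C -> C).

Lemma normrE z : `|z| = (normc z)%:C.
Proof. by rewrite normc_def; case: z. Qed.

Lemma normc_ge0 z : 0 <= normc z.
Proof. by case: z => a b; exact: sqrtr_ge0. Qed.

Lemma normcBC z w : normc (z - w) = normc (w - z).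
Proof. by rewrite -normcN opprB. Qed.

Lemma normc_real (x : R) : normc x%:C = `|x|.
Proof. by rewrite /= expr0n addr0 sqrtr_sqr. Qed.

Lemma normc_nat n : normc n%:R = n%:R :> R.
Proof. by rewrite -(rmorph_nat (real_complex R)) normc_real ger0_norm. Qed.

Lemma normc_gt0 z : (0 < normc z) = (z != 0).
Proof.
apply/idP/idP => [|z0]; first by apply: contraTneq => ->; rewrite normc0 ltxx.
rewrite lt_neqAle normc_ge0 andbT eq_sym.
by apply: contra z0 => /eqP/eq0_normc ->.
Qed.

Lemma normcX z n : normc (z ^+ n) = normc z ^+ n.
Proof. by elim: n => [|n IH]; rewrite ?expr0 ?normc1// !exprS normcM IH. Qed.

Lemma normc_conj z : normc (z^*) = normc z.
Proof. by case: z => a b /=; rewrite sqrrN. Qed.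

Lemma ge_Re_normc z : `|complex.Re z| <= normc z.
Proof. by have := normc_ge_Re z; rewrite normrE lecR. Qed.

Lemma ge_Im_normc z : `|complex.Im z| <= normc z.
Proof.
case: z => a b /=; rewrite -sqrtr_sqr; apply: ler_wsqrtr.
by rewrite lerDr sqr_ge0.
Qed.

Lemma le_normc_ReIm z : normc z <= `|complex.Re z| + `|complex.Im z|.
Proof.
rewrite [in leLHS](complexE z); apply: le_trans (le_normcD _ _) _.
rewrite normcM !normc_real lerD//= ?expr0n ?expr1n add0r sqrtr1 mul1r //.
Qed.

Lemma le_normcB z w : normc (z - w) <= normc z + normc w.
Proof. by rewrite -(normcN w) le_normcD. Qed.

Lemma le_normc_sum (I : Type) (r : seq I) (P : pred I) (f : I -> C) :
  normc (\sum_(i <- r | P i) f i) <= \sum_(i <- r | P i) normc (f i).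
Proof.
elim/big_rec2: _ => [|i y x _ yx]; first by rewrite normc0.
by apply: le_trans (le_normcD _ _) _; rewrite lerD2l.
Qed.

Lemma ReD z w : complex.Re (z + w) = complex.Re z + complex.Re w.
Proof. by case: z; case: w. Qed.
Lemma ImD z w : complex.Im (z + w) = complex.Im z + complex.Im w.
Proof. by case: z; case: w. Qed.
Lemma ReN z : complex.Re (- z) = - complex.Re z.
Proof. by case: z. Qed.
Lemma ImN z : complex.Im (- z) = - complex.Im z.
Proof. by case: z. Qed.
Lemma Re_nat n : complex.Re (n%:R : C) = n%:R.
Proof. by rewrite -(rmorph_nat (real_complex R)). Qed.

Lemma nearC z (P : C -> Prop) :
  (\forall w \near (z : C^o), P w) ->
  exists2 d : R, 0 < d & forall w, normc (w - z) < d -> P w.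
Proof.
move=> /nbhs_ballP[[d d'] /= d0 dP].
have dd : d' = 0 by move: d0; rewrite ltcE /= => /andP[/eqP ->].
exists d; first by move: d0; rewrite dd ltcR.
move=> w wd; apply: dP; rewrite /ball /= normrE dd normcBC.
by rewrite -[d +i* 0]/(d%:C) ltcR.
Qed.

Lemma nearC_punctured z (P : C -> Prop) :
  (\forall w \near (z : C^o)^', P w) ->
  exists2 d : R, 0 < d & forall w, w != z -> normc (w - z) < d -> P w.
Proof.
move=> /(@nearC z)[d d0 dP]; exists d => // w wz wd; exact: dP.
Qed.

Lemma nearCP z (P : C -> Prop) (d : R) : 0 < d ->
  (forall w, normc (w - z) < d -> P w) -> \forall w \near (z : C^o), P w.
Proof.
move=> d0 dP; apply/nbhs_ballP; exists d%:C => /=; first by rewrite ltcR.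
by move=> w; rewrite /ball /= normrE normcBC ltcR => /dP.
Qed.

Lemma cvgC (T : Type) (A : set_system T) {FA : Filter A} (u : T -> C) (l : C) :
  (u : T -> C^o) @ A --> (l : C^o) <->
  forall e : R, 0 < e -> \forall t \near A, normc (u t - l) < e.
Proof.
split=> [/cvgrPdist_lt h e e0|h].
  have /h : 0 < e%:C by rewrite ltcR.
  by apply: filterS => t; rewrite normrE ltcR normcBC.
apply/cvgrPdist_lt => -[e e'] e0.
have dd : e' = 0 by move: e0; rewrite ltcE /= => /andP[/eqP ->].
have /h : 0 < e by move: e0; rewrite dd ltcR.
by apply: filterS => t; rewrite dd normrE -[e +i* 0]/(e%:C) ltcR normcBC.
Qed.

Lemma cvgCn (u : nat -> C) (l : C) :
  (u : nat -> C^o) @ \oo --> (l : C^o) <->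
  forall e : R, 0 < e -> exists n0, forall n, (n0 <= n)%N -> normc (u n - l) < e.
Proof.
rewrite cvgC; split=> h e /h; first by move=> [n0 _ hn]; exists n0.
by move=> [n0 hn]; exists n0.
Qed.

Lemma is_derive_epsP F z (l : C) :
  is_derive (z : C^o) 1 (F : C^o -> C^o) (l : C^o) <->
  forall e : R, 0 < e -> exists2 d : R, 0 < d &
    forall h, normc h < d -> normc (F (z + h) - F z - l * h) <= e * normc h.
Proof.
have hd : hausdorff_space (C^o) by exact: norm_hausdorff.
split=> [[/cvg_ex[/= l' cl] fl] e e0|hl].
- have ll : l = l'.
    have := @cvg_lim (C^o) hd _ _ _ _ _ cl.
    by rewrite -[lim _]/('D_1 (F : C^o -> C^o) (z : C^o)) fl; exact.
  rewrite -ll in cl; move/cvgC : cl => /(_ _ e0)/nearC_punctured[d d0 dP].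
  exists d => // h hd'; have [->|h0] := eqVneq h 0.
    by rewrite normc0 mulr0 addr0 subrr mulr0 subr0 normc0.
  have := dP h h0; rewrite subr0 => /(_ hd'); rewrite scaler1 => /ltW.
  rewrite -(ler_pM2r (_ : 0 < normc h)) ?normc_gt0// -normcM.
  by rewrite /GRing.scale /= mulrBl mulrAC mulVf// mul1r [h + z]addrC.
- have cl : (fun h : C^o => h^-1 *: (F (h *: (1 : C^o) + z) - F z)) @ 0^' --> (l : C^o).
    apply/cvgC => e e0.
    have [d d0 dP] := hl (e / 2) ltac:(by rewrite divr_gt0).
    apply: (nearCP (d := d)) => // h; rewrite subr0 => hd' h0.
    have := dP h hd'; rewrite scaler1.
    have hp : 0 < normc h by rewrite normc_gt0.
    rewrite -ler_pdivrMr// -normcV -normcM.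
    rewrite mulrBl mulfK // mulrC [h + z]addrC => le.
    by apply: le_lt_trans le _; rewrite ltr_pdivrMr// ltr_pMr// ltr1n.
  apply: DeriveDef; first by apply/cvg_ex; exists l; exact: cl.
  by have := @cvg_lim (C^o) hd _ _ _ _ _ cl; rewrite /derive; exact.
Qed.

Lemma derivable_epsP F z :
  derivable (F : C^o -> C^o) z 1 <->
  exists l : C, forall e : R, 0 < e -> exists2 d : R, 0 < d &
    forall h, normc h < d -> normc (F (z + h) - F z - l * h) <= e * normc h.
Proof.
split=> [h|[l /is_derive_epsP[]//]].
by exists ('D_1 (F : C^o -> C^o) (z : C^o)); apply/is_derive_epsP/derivableP.
Qed.

End ComplexBasics.

(** * Entire functions *)

Section Entire.
Variable R : realType.
Local Notation C := R[i].
Implicit Types (z w : C) (F G : C -> C).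

Lemma is_derive_eps (f : R -> R) (x l : R) : is_derive x 1 f l ->
  forall e : R, 0 < e -> exists2 d : R, 0 < d &
    forall h, `|h| < d -> `|f (x + h) - f x - l * h| <= e * `|h|.
Proof.
move=> [/cvg_ex[/= l' fl'] fl] e e0.
have ll' : l = l' by rewrite -fl; exact/cvg_lim.
move/cvgrPdist_lt : fl'; rewrite -ll' => /(_ _ e0).
move=> /nbhs_ballP[d /= d0 dP]; exists d => // h hd.
have [->|h0] := eqVneq h 0; first by rewrite addr0 mulr0 subrr subr0 normr0 mulr0.
have := dP h; rewrite /ball/= sub0r normrN => /(_ hd h0) /ltW.
rewrite scaler1 -ler_pdivrMr ?normr_gt0// -normfV -normrM distrC.
by rewrite /GRing.scale/= [in X in _ -> X]mulrBl mulfK// [x + h]addrC mulrC.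
Qed.

Lemma cexp0 : cexp 0 = 1 :> C.
Proof. by rewrite /cexp /= expR0 cos0 sin0 mulr1 mulr0. Qed.

Lemma cexpD z w : cexp (z + w) = cexp z * cexp w.
Proof.
case: z => a b; case: w => c d; rewrite /cexp /= expRD cosD sinD.
by apply/eqP; rewrite eq_complex /=; apply/andP; split; apply/eqP; ring.
Qed.

Lemma cexp_neq0 z : cexp z != 0.
Proof.
apply/eqP => z0; have := cexpD z (- z); rewrite subrr z0 mul0r cexp0.
by move/eqP; rewrite oner_eq0.
Qed.

Lemma cexpN z : cexp (- z) = (cexp z)^-1.
Proof.
by apply: (mulfI (cexp_neq0 z)); rewrite -cexpD subrr cexp0 divff ?cexp_neq0.
Qed.

Lemma cexpM_nat z n : cexp (n%:R * z) = cexp z ^+ n.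
Proof.
elim: n => [|n IH]; first by rewrite mul0r cexp0.
by rewrite exprS -IH -cexpD -natr1 mulrDl mul1r addrC.
Qed.

Lemma normc_cexp z : normc (cexp z) = expR (complex.Re z).
Proof.
rewrite /cexp /normc /= !exprMn -mulrDr cos2Dsin2 mulr1.
by rewrite sqrtr_sqr ger0_norm ?expR_ge0.
Qed.

Lemma cexp_real (x : R) : cexp x%:C = (expR x)%:C.
Proof. by rewrite /cexp /= cos0 sin0 mulr1 mulr0. Qed.

(** The derivative of [cexp] at 0, from those of the real exponential, sine and
    cosine; all other derivatives of [cexp] follow by [cexpD]. *)
Lemma cexp_eps (e : R) : 0 < e -> exists2 d : R, 0 < d &
  forall h : C, normc h < d -> normc (cexp h - 1 - h) <= e * normc h.
Proof.
move=> e0.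
(* the four terms below add up to at most 6 * k * normc h *)
pose k := Num.min (e / 8) 1.
have k0 : 0 < k by rewrite lt_min ltr01 andbT divr_gt0.
have [k1 ke] : k <= 1 /\ k <= e / 8 by rewrite !ge_min !lexx orbT.
have [d1 d10 P1] := is_derive_eps (is_derive_expR 0) k0.
have [d2 d20 P2] := is_derive_eps (is_derive_cos 0) k0.
have [d3 d30 P3] := is_derive_eps (is_derive_sin 0) k0.
exists (Num.min (Num.min d1 d2) (Num.min d3 (k/2))).
  by rewrite !lt_min d10 d20 d30 divr_gt0.
move=> [a b]; rewrite !lt_min => /andP[/andP[h1 h2] /andP[h3 h4]].
have ha : `|a| <= normc (a +i* b) := ge_Re_normc (a +i* b).
have hb : `|b| <= normc (a +i* b) := ge_Im_normc (a +i* b).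
set n := normc _ in ha hb h1 h2 h3 h4 *.
have n0 : 0 <= n := normc_ge0 _.
have := P1 a (le_lt_trans ha h1); rewrite add0r expR0 mul1r.
have := P2 b (le_lt_trans hb h2); rewrite add0r cos0 sin0 oppr0 mul0r subr0.
have := P3 b (le_lt_trans hb h3); rewrite add0r sin0 cos0 mul1r subr0.
move=> Hs Hc He.
have cb := cos_max b.
apply: le_trans (le_normc_ReIm _) _; rewrite /cexp /= !oppr0 !addr0.
rewrite (_ : expR a * cos b - 1 - a =
  (expR a - 1 - a) * cos b + (1 + a) * (cos b - 1)); last by ring.
rewrite (_ : expR a * sin b - b =
  (expR a - 1 - a + a) * (sin b - b + b) + (sin b - b)); last by ring.
move: He Hc Hs; move: (expR a - 1 - a) (cos b - 1) (sin b - b) => E K S.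
move=> He Hc Hs.
have kn : 0 <= k * n by rewrite mulr_ge0// ltW.
have He' : `|E| <= k * n by apply: le_trans He _; rewrite ler_pM2l.
have Hc' : `|K| <= k * n by apply: le_trans Hc _; rewrite ler_pM2l.
have Hs' : `|S| <= k * n by apply: le_trans Hs _; rewrite ler_pM2l.
have B1 : `|E * cos b| <= k * n.
  by rewrite normrM -[leRHS]mulr1; apply: ler_pM.
have B2 : `|(1 + a) * K| <= 2 * (k * n).
  rewrite normrM; apply: ler_pM => //; apply: le_trans (ler_normD _ _) _.
  rewrite normr1; lra.
have B3 : `|(E + a) * (S + b)| <= k * (2 * n).
  rewrite normrM; apply: ler_pM => //.
    apply: le_trans (ler_normD _ _) _; nra.
  apply: le_trans (ler_normD _ _) _; nra.
apply: le_trans (lerD (ler_normD _ _) (ler_normD _ _)) _.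
nra.
Qed.

(** An inductive type rather than a definition, so that a proof of [entire F]
    is not taken for a function by the tactics that apply lemmas. *)
Inductive entire F : Prop :=
  Entire of (forall z, derivable (F : C^o -> C^o) z 1).

Lemma entireP F : entire F <-> forall z, exists l : C, forall e : R, 0 < e ->
  exists2 d : R, 0 < d &
    forall h, normc h < d -> normc (F (z + h) - F z - l * h) <= e * normc h.
Proof.
split=> [[h] z|h]; first exact/derivable_epsP.
by split=> z; apply/derivable_epsP; exact: h.
Qed.

Lemma entire_cexp : entire (@cexp R).
Proof.
apply/entireP => z; exists (cexp z) => e e0.
have z0 : 0 < normc (cexp z) by rewrite normc_gt0 cexp_neq0.
have [d d0 dP] := cexp_eps (divr_gt0 e0 z0); exists d => // h /dP.
rewrite (_ : cexp (z + h) - _ - _ = cexp z * (cexp h - 1 - h)); last first.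
  by rewrite cexpD; ring.
rewrite normcM.
by rewrite -(ler_pM2l z0) mulrA [X in _ <= X * _]mulrC divfK ?gt_eqF.
Qed.

Lemma entire_cst (c : C) : entire (fun=> c).
Proof. by split=> z; exact: derivable_cst. Qed.

Lemma entire_id : entire (fun z => z).
Proof. by split=> z; exact: derivable_id. Qed.

Lemma entireD F G : entire F -> entire G -> entire (fun z => F z + G z).
Proof. by move=> [f] [g]; split=> z; exact: (derivableD (f z) (g z)). Qed.

Lemma entireN F : entire F -> entire (fun z => - F z).
Proof. by move=> [f]; split=> z; exact: (derivableN (f z)). Qed.

Lemma entireB F G : entire F -> entire G -> entire (fun z => F z - G z).
Proof. by move=> [f] [g]; split=> z; exact: (derivableB (f z) (g z)). Qed.

Lemma entireM F G : entire F -> entire G -> entire (fun z => F z * G z).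
Proof. by move=> [f] [g]; split=> z; exact: (derivableM (f z) (g z)). Qed.

Lemma entire_sum (I : Type) (r : seq I) (P : pred I) (F : I -> C -> C) :
  (forall i, entire (F i)) -> entire (fun z => \sum_(i <- r | P i) F i z).
Proof.
move=> h; elim: r => [|i r IH].
  by under eq_fun do rewrite big_nil; exact: entire_cst.
under eq_fun do rewrite big_cons.
by case: (P i); [exact: (entireD (h i) IH)|exact: IH].
Qed.

Lemma entireX F n : entire F -> entire (fun z => F z ^+ n).
Proof.
move=> h; elim: n => [|n IH].
  by under eq_fun do rewrite expr0; exact: entire_cst.
by under eq_fun do rewrite exprS; exact: entireM.
Qed.

Lemma entire_comp F G : entire F -> entire G -> entire (fun z => F (G z)).
Proof.
move=> [f] [g]; split=> z; apply/derivable1_diffP.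
apply: (@differentiable_comp _ _ _ _ (G : C^o -> C^o) (F : C^o -> C^o)).
  exact/derivable1_diffP.
exact/derivable1_diffP.
Qed.

Lemma entire_continuous F z (e : R) : entire F -> 0 < e ->
  exists2 d : R, 0 < d & forall w, normc (w - z) < d -> normc (F w - F z) < e.
Proof.
move=> [/(_ z)]/derivable1_diffP/differentiable_continuous/cvgC h e0.
by have /nearC := h _ e0.
Qed.

End Entire.

(** * Goursat's theorem and the maximum principle on circles *)

Section Goursat.
Variable R : realType.
Local Notation C := R[i].
Implicit Types (z w : C) (F G : C -> C).

Definition seg_int (f : R -> R) (a b : R) : R :=
  \int[lebesgue_measure]_(t in `[a, b]) f t.

Lemma seg_integrable (f : R -> R) a b : continuous f ->
  lebesgue_measure.-integrable `[a, b] (EFin \o f).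
Proof.
move=> cf; apply: continuous_compact_integrable; first exact: segment_compact.
by move=> x; apply: continuous_subspaceT.
Qed.

Lemma seg_int_split (f : R -> R) a b c : continuous f -> a <= b -> b <= c ->
  seg_int f a c = seg_int f a b + seg_int f b c.
Proof.
move=> cf ab bc; rewrite /seg_int.
have -> : \int[lebesgue_measure]_(t in `[b, c]) f t =
          \int[lebesgue_measure]_(t in `]b, c]) f t.
  rewrite -Rintegral_itv_obnd_cbnd//.
  apply: integrableS (seg_integrable b c cf) => //.
  by apply: subset_itvr; rewrite bnd_simp.
rewrite -(@Rintegral_itvB _ f (BLeft a) (BRight c) b) ?bnd_simp//; last exact: seg_integrable.
by rewrite addrC subrK.
Qed.

Lemma seg_int_cst (c : R) a b : a <= b -> seg_int (fun=> c) a b = c * (b - a).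
Proof.
move=> ab; rewrite /seg_int Rintegral_cst//=.
by rewrite lebesgue_measure_itv/= lte_fin; case: ltP => //= ba;
  rewrite (le_anti (_ : a <= b <= a)) ?ab// subrr.
Qed.

Lemma seg_int_le (f g : R -> R) a b : continuous f -> continuous g ->
  (forall t, a <= t <= b -> f t <= g t) -> seg_int f a b <= seg_int g a b.
Proof.
move=> cf cg fg; apply: le_Rintegral; [exact: measurable_itv|exact: seg_integrable..|].
by move=> x; rewrite /= in_itv /=; exact: fg.
Qed.

Lemma seg_intB (f g : R -> R) a b : continuous f -> continuous g ->
  seg_int (fun t => f t - g t) a b = seg_int f a b - seg_int g a b.
Proof. by move=> cf cg; apply: RintegralB => //; exact: seg_integrable. Qed.

Lemma seg_int_near (f : R -> R) c e a b : continuous f -> a <= b ->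
  (forall t, a <= t <= b -> `|f t - c| <= e) ->
  `|seg_int f a b - c * (b - a)| <= e * (b - a).
Proof.
move=> cf ab fe; rewrite ler_norml; apply/andP; split.
- rewrite -mulNr lerBrDl -mulrDl -seg_int_cst//.
  apply: seg_int_le => //; first by move=> x; exact: cvg_cst.
  by move=> t /fe; rewrite ler_norml; lra.
- rewrite lerBlDl -mulrDl -seg_int_cst//.
  apply: seg_int_le => //; first by move=> x; exact: cvg_cst.
  by move=> t /fe; rewrite ler_norml; lra.
Qed.

Lemma continuous_eps (f : R -> R) : (forall x e, 0 < e -> exists2 d, 0 < d &
    forall y, `|y - x| < d -> `|f y - f x| < e) -> continuous f.
Proof.
move=> h x; apply/cvgrPdist_lt => e /(h x)[d d0 dP].
apply/nbhs_ballP; exists d => // y; rewrite /ball/= distrC => /dP.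
by rewrite distrC.
Qed.

Section Lines.
Variable F : C -> C.
Hypothesis entF : entire F.

Lemma continuous_line (g : R -> C) (k : C -> R) :
  (forall z w, `|k z - k w| <= normc (z - w)) ->
  (forall s t, normc (g t - g s) = `|t - s|) -> continuous (fun t => k (F (g t))).
Proof.
move=> hk hg; apply: continuous_eps => x e e0.
have [d d0 dP] := entire_continuous (g x) entF e0.
exists d => // y yd; apply: le_lt_trans (hk _ _) _; apply: dP.
by rewrite hg.
Qed.

Lemma ReB_le z w : `|complex.Re z - complex.Re w| <= normc (z - w).
Proof. by rewrite -ReN -ReD; exact: ge_Re_normc. Qed.
Lemma ImB_le z w : `|complex.Im z - complex.Im w| <= normc (z - w).
Proof. by rewrite -ImN -ImD; exact: ge_Im_normc. Qed.

Lemma horiz_dist (y s t : R) : normc ((t +i* y) - (s +i* y)) = `|t - s|.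
Proof. by rewrite /= subrr expr0n addr0 sqrtr_sqr. Qed.
Lemma vert_dist (x s t : R) : normc ((x +i* t) - (x +i* s)) = `|t - s|.
Proof. by rewrite /= subrr expr0n add0r sqrtr_sqr. Qed.

Lemma continuous_horiz y : continuous (fun t => complex.Re (F (t +i* y))).
Proof. by apply: continuous_line; [exact: ReB_le|move=> s t; exact: horiz_dist]. Qed.
Lemma continuous_vert x : continuous (fun t => complex.Im (F (x +i* t))).
Proof. by apply: continuous_line; [exact: ImB_le|move=> s t; exact: vert_dist]. Qed.

Definition horiz_int y a b := seg_int (fun t => complex.Re (F (t +i* y))) a b.
Definition vert_int x a b := seg_int (fun t => complex.Im (F (x +i* t))) a b.

(** The real part of the integral of [F] along the boundary of the rectangle
    with lower left corner [x +i* y] and sides [u] and [v]. The real part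
    carries the information, since [F] can be multiplied by a constant. *)
Definition contour x y u v : R :=
  horiz_int y x (x + u) - horiz_int (y + v) x (x + u)
  - vert_int (x + u) y (y + v) + vert_int x y (y + v).

Lemma contour_split x y u v : 0 <= u -> 0 <= v ->
  contour x y (u + u) (v + v) =
  contour x y u v + contour (x + u) y u v
  + contour x (y + v) u v + contour (x + u) (y + v) u v.
Proof.
move=> u0 v0; rewrite /contour /horiz_int /vert_int !addrA.
rewrite !(@seg_int_split _ x (x + u) (x + u + u)) ?lerDl//;
  try exact: continuous_horiz.
rewrite !(@seg_int_split _ y (y + v) (y + v + v)) ?lerDl//;
  try exact: continuous_vert.
ring.
Qed.

(** The affine part of [F] contributes nothing to the integral along a
    rectangle, and the rest at most its bound times the perimeter. *)
Lemma contour_small x y u v (p l : C) (e : R) : 0 <= u -> 0 <= v -> 0 <= e ->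
  (forall a b, x <= a <= x + u -> y <= b <= y + v ->
     normc (F (a +i* b) - F p - l * ((a +i* b) - p)) <= e) ->
  `|contour x y u v| <= 2 * e * (u + v).
Proof.
move=> u0 v0 e0 H.
have xu : x <= x + u by rewrite lerDl.
have yv : y <= y + v by rewrite lerDl.
have P1 : `|seg_int (fun t => complex.Re (F (t +i* y)) - complex.Re (F (t +i* (y + v)))) x (x + u)
    - complex.Im l * v * (x + u - x)| <= (2 * e) * (x + u - x).
  apply: seg_int_near => //.
    by move=> t; apply: cvgB; apply: continuous_horiz.
  move=> t xt.
  have B1 : y <= y <= y + v by rewrite lexx.
  have B2 : y <= y + v <= y + v by rewrite yv lexx.
  have A1 := le_trans (ge_Re_normc _) (H _ _ xt B1).
  have A2 := le_trans (ge_Re_normc _) (H _ _ xt B2).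
  move: A1 A2 {H}; rewrite !ler_norml; move: (F p) (F (t +i* y)) (F (t +i* (y + v))).
  move: l p => [l1 l2] [p1 p2] [f1 f2] [g1 g2] [h1 h2] /=.
  by move=> /andP[? ?] /andP[? ?]; apply/andP; split; lra.
have P2 : `|seg_int (fun t => complex.Im (F ((x + u) +i* t)) - complex.Im (F (x +i* t))) y (y + v)
    - complex.Im l * u * (y + v - y)| <= (2 * e) * (y + v - y).
  apply: seg_int_near => //.
    by move=> t; apply: cvgB; apply: continuous_vert.
  move=> t yt.
  have B1 : x <= x <= x + u by rewrite lexx.
  have B2 : x <= x + u <= x + u by rewrite xu lexx.
  have A1 := le_trans (ge_Im_normc _) (H _ _ B1 yt).
  have A2 := le_trans (ge_Im_normc _) (H _ _ B2 yt).
  move: A1 A2 {H P1}; rewrite !ler_norml; move: (F p) (F (x +i* t)) (F ((x + u) +i* t)).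
  move: l p => [l1 l2] [p1 p2] [f1 f2] [g1 g2] [h1 h2] /=.
  by move=> /andP[? ?] /andP[? ?]; apply/andP; split; lra.
move: P1 P2; rewrite !seg_intB; try exact: continuous_vert; try exact: continuous_horiz.
rewrite !(addrAC _ _ (- x)) !(addrAC _ _ (- y)) !subrr !add0r /contour /horiz_int /vert_int.
rewrite !ler_norml => /andP[? ?] /andP[? ?]; apply/andP; split; lra.
Qed.

Section Bisection.
Variables (x0 y0 u0 v0 A : R).
Hypotheses (u_ge0 : 0 <= u0) (v_ge0 : 0 <= v0) (A_gt0 : 0 < A).
Hypothesis contour_gt : A <= `|contour x0 y0 u0 v0|.

Let un n := u0 / 2 ^+ n.
Let vn n := v0 / 2 ^+ n.

(** One of the four quarters of a rectangle carries at least a quarter of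
    its integral. *)
Let step n (p q : R * R) : Prop :=
  A / 4 ^+ n <= `|contour p.1 p.2 (un n) (vn n)| ->
  [/\ A / 4 ^+ n.+1 <= `|contour q.1 q.2 (un n.+1) (vn n.+1)|,
      p.1 <= q.1 <= p.1 + un n.+1 & p.2 <= q.2 <= p.2 + vn n.+1].

Let half (u : R) n : u / 2 ^+ n = u / 2 ^+ n.+1 + u / 2 ^+ n.+1.
Proof.
have h : 2 ^+ n != 0 :> R by rewrite expf_neq0.
by rewrite exprS; field; rewrite h.
Qed.

Let step_ex n p : exists q, step n p q.
Proof.
have [h|h] := boolP (A / 4 ^+ n <= `|contour p.1 p.2 (un n) (vn n)|); last first.
  by exists p => /(negP h).
set a := un n.+1; set b := vn n.+1.
have ab0 : 0 <= a /\ 0 <= b by split; rewrite divr_ge0 ?exprn_ge0.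
have [a0 b0] := ab0.
move: (h); rewrite /un /vn !(half _ n) -/(un n.+1) -/(vn n.+1) contour_split//.
rewrite -/a -/b.
have -> : A / 4 ^+ n = 4 * (A / 4 ^+ n.+1).
  have h4 : 4 ^+ n != 0 :> R by rewrite expf_neq0.
  by rewrite exprS; field; rewrite h4.
set B := A / 4 ^+ n.+1 => hB.
have ra (r s : R) : 0 <= s -> r <= r <= r + s by move=> s0; rewrite lexx lerDl.
have rb (r s : R) : 0 <= s -> r <= r + s <= r + s by move=> s0; rewrite lexx lerDl s0.
have [k|k1] := leP B `|contour p.1 p.2 a b|.
  by exists p => _; split=> //; apply: ra.
have [k|k2] := leP B `|contour (p.1 + a) p.2 a b|.
  by exists (p.1 + a, p.2) => _; split=> //=; [apply: rb|apply: ra].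
have [k|k3] := leP B `|contour p.1 (p.2 + b) a b|.
  by exists (p.1, p.2 + b) => _; split=> //=; [apply: ra|apply: rb].
exists (p.1 + a, p.2 + b) => _; split=> /=; [|exact: rb..].
rewrite leNgt; apply/negP; rewrite -/a -/b -/B => k4.
move: hB; apply/negP; rewrite -ltNge.
apply: le_lt_trans (ler_normD _ _) _.
apply: le_lt_trans (lerD (ler_normD _ _) (lexx _)) _.
apply: le_lt_trans (lerD (lerD (ler_normD _ _) (lexx _)) (lexx _)) _.
lra.
Qed.

Let nxt n p := projT1 (cid (step_ex n p)).
Let nxtP n p : step n p (nxt n p) := projT2 (cid (step_ex n p)).

Let Fixpoint pt n : R * R := if n is k.+1 then nxt k (pt k) else (x0, y0).

Let pt_big n : A / 4 ^+ n <= `|contour (pt n).1 (pt n).2 (un n) (vn n)|.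
Proof.
elim: n => [|n IH]; first by rewrite /un /vn !expr0 !divr1.
by have [] := nxtP IH.
Qed.

Let nested (a s : nat -> R) : (forall n, 0 <= s n) ->
  (forall n, a n <= a n.+1) -> (forall n, a n.+1 + s n.+1 <= a n + s n) ->
  exists c, forall n, a n <= c <= a n + s n.
Proof.
move=> s0 an asn.
have /nondecreasing_seqP mono := an.
have /nonincreasing_seqP anti : forall n, (fun n => a n + s n) n.+1 <= (fun n => a n + s n) n by [].
have cross n m : a n <= a m + s m.
  apply: le_trans (mono _ _ (leq_maxl n m)) _.
  by apply: le_trans (anti _ _ (leq_maxr n m)); rewrite lerDl.
have hub m : ubound [set a n | n in setT] (a m + s m) by move=> _ [n _ <-].
exists (sup [set a n | n in setT]) => n; apply/andP; split.
  by apply: ub_le_sup; [exists (a 0%N + s 0%N); exact: hub|exists n].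
by apply: ge_sup; [exists (a 0%N); exists 0%N|exact: hub].
Qed.

(** The nested rectangles shrink to a point, where differentiability makes
    the integral small compared to the square of the size. *)
Lemma contour_bisection_false : False.
Proof.
have st n := nxtP (pt_big n).
have hz (u : R) n : u / 2 ^+ n = u / 2 ^+ n.+1 + u / 2 ^+ n.+1 by exact: half.
have [X hX] : exists c, forall n, (pt n).1 <= c <= (pt n).1 + un n.
  apply: nested => n; [by rewrite divr_ge0// exprn_ge0|..];
  by have [_ /andP[h1 h2] _] := st n; rewrite //= /un ?(hz _ n) -/(un _) in h1 h2 *; lra.
have [Y hY] : exists c, forall n, (pt n).2 <= c <= (pt n).2 + vn n.
  apply: nested => n; [by rewrite divr_ge0// exprn_ge0|..];
  by have [_ _ /andP[h1 h2]] := st n; rewrite //= /vn ?(hz _ n) -/(vn _) in h1 h2 *; lra.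
have [l hl] := (entireP F).1 entF (X +i* Y).
pose S := u0 + v0.
have S0 : 0 <= S by rewrite addr_ge0.
pose e := A / (4 * (1 + S ^+ 2)).
have S1 : 0 < 1 + S ^+ 2 by rewrite ltr_wpDr ?sqr_ge0.
have e0 : 0 < e by rewrite divr_gt0// mulr_gt0.
have [d d0 dP] := hl e e0.
have [n hn] : exists n, S / 2 ^+ n < d.
  have hb := archi_boundP (divr_ge0 S0 (ltW d0)); set n := Num.bound _ in hb.
  exists n; rewrite ltr_pdivrMr ?exprn_gt0// mulrC -ltr_pdivrMr//.
  apply: lt_le_trans hb _; rewrite -natrX ler_nat; exact/ltnW/ltn_expl.
have hS : un n + vn n = S / 2 ^+ n by rewrite -mulrDl.
have uv0 : 0 <= un n /\ 0 <= vn n by split; rewrite divr_ge0 ?exprn_ge0.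
have [un0 vn0] := uv0.
have /andP[X1 X2] := hX n; have /andP[Y1 Y2] := hY n.
have small : `|contour (pt n).1 (pt n).2 (un n) (vn n)| <=
    2 * (e * (S / 2 ^+ n)) * (un n + vn n).
  apply: (@contour_small _ _ _ _ (X +i* Y) l) => //.
    by rewrite mulr_ge0 ?(ltW e0)// divr_ge0// exprn_ge0.
  move=> a b /andP[a1 a2] /andP[b1 b2].
  have hle : normc ((a +i* b) - (X +i* Y)) <= S / 2 ^+ n.
    apply: le_trans (le_normc_ReIm _) _; rewrite /= -hS.
    by apply: lerD; rewrite ler_norml; apply/andP; split; lra.
  have := dP _ (le_lt_trans hle hn); rewrite (addrC (X +i* Y)) subrK => /le_trans; apply.
  by rewrite ler_pM2l.
have := le_trans (pt_big n) small; rewrite hS.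
have -> : 4 ^+ n = 2 ^+ n * 2 ^+ n :> R by rewrite -exprMn -natrM.
rewrite ler_pdivrMr ?mulr_gt0 ?exprn_gt0//.
have p2 : 2 ^+ n != 0 :> R by rewrite expf_neq0.
have -> : 2 * (e * (S / 2 ^+ n)) * (S / 2 ^+ n) * (2 ^+ n * 2 ^+ n) = 2 * e * S ^+ 2.
  by field.
have -> : 2 * e * S ^+ 2 = A * (S ^+ 2 / (2 * (1 + S ^+ 2))).
  by rewrite /e; field; rewrite gt_eqF.
apply/negP; rewrite -ltNge gtr_pMr// ltr_pdivrMr ?mulr_gt0//.
by have := sqr_ge0 S; lra.
Qed.
End Bisection.

Lemma goursat x y u v : 0 <= u -> 0 <= v -> contour x y u v = 0.
Proof.
move=> u_ge0 v_ge0; apply/eqP/negP => /negP c0.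
by apply: (@contour_bisection_false x y u v `|contour x y u v|) => //; rewrite normr_gt0.
Qed.
End Lines.

(** The function [H u = F (w + cexp u)] has period [2 pi i], so the horizontal
    sides of the rectangle [[- b, 0] x [0, 2 pi]] cancel in Goursat's theorem:
    the mean of [Im F] over the unit circle about [w] equals that over the
    circle of radius [expR (- b)], which is close to [Im (F w)]. *)
Lemma circle_Im F w (S : R) : entire F ->
  (forall t, 0 <= t <= pi *+ 2 -> complex.Im (F (w + cexp (0 +i* t))) <= S) -> complex.Im (F w) <= S.
Proof.
move=> entF hS; apply/ler_addgt0Pr => e e0.
have [d d0 dP] := entire_continuous w entF e0.
pose H u := F (w + cexp u).
have entH : entire H.
  exact: (entire_comp entF (entireD (entire_cst w) (@entire_cexp R))).
pose b := - ln (Num.min d 1 / 2).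
have m0 : 0 < Num.min d 1 by rewrite lt_min d0 ltr01.
have b0 : 0 <= b.
  have : Num.min d 1 <= 1 by rewrite ge_min lexx orbT.
  by rewrite oppr_ge0 => h; apply: ln_le0; lra.
have bd : expR (- b) < d.
  rewrite opprK lnK; last by rewrite posrE divr_gt0.
  have h1 : Num.min d 1 <= d by rewrite ge_min lexx.
  by move: m0 h1; lra.
have p0 : 0 <= pi *+ 2 :> R by rewrite mulrn_wge0// pi_ge0.
have := goursat entH (- b) 0 b0 p0; rewrite /contour.
have -> : horiz_int H (0 + pi *+ 2) (- b) (- b + b) = horiz_int H 0 (- b) (- b + b).
  by rewrite /horiz_int; congr seg_int; apply/funext => t; rewrite /H /cexp /= add0r
     cos2pi sin2pi cos0 sin0.
rewrite subrr sub0r addNr => /eqP; rewrite addrC subr_eq0 => /eqP E.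
have pp : 0 < pi *+ 2 :> R by rewrite mulrn_wgt0// pi_gt0.
have c1 : vert_int H 0 0 (0 + pi *+ 2) <= S * (pi *+ 2).
  rewrite -[pi *+ 2 in leRHS](subr0) -seg_int_cst// add0r; apply: seg_int_le.
  - exact: continuous_vert.
  - by move=> x; exact: cvg_cst.
  - by move=> t; exact: hS.
have c2 : (complex.Im (F w) - e) * (pi *+ 2) <= vert_int H (- b) 0 (0 + pi *+ 2).
  rewrite -[pi *+ 2 in leLHS](subr0) -seg_int_cst// add0r; apply: seg_int_le.
  - by move=> x; exact: cvg_cst.
  - exact: continuous_vert.
  - move=> t _; have : normc (H (- b +i* t) - F w) < e.
      by apply: dP; rewrite [w + _]addrC addrK normc_cexp.
    move=> /ltW/(le_trans (ImB_le _ _)); rewrite ler_norml => /andP[+ _].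
    by rewrite lerBrDl.
by have := le_trans c2 _; rewrite E => /(_ _ c1); rewrite ler_pM2r// lerBlDr.
Qed.

(** Rotating [F] so that [F w] is a positive multiple of [i] reduces the
    modulus to the imaginary part. *)
Lemma circle_normc F w (S : R) : entire F ->
  (forall t, 0 <= t <= pi *+ 2 -> normc (F (w + cexp (0 +i* t))) <= S) -> normc (F w) <= S.
Proof.
move=> entF hS; have [->|F0] := eqVneq (F w) 0.
  rewrite normc0; apply: le_trans (hS 0 _); first exact: normc_ge0.
  by rewrite lexx mulrn_wge0// pi_ge0.
pose u := (0 +i* normc (F w)) / F w.
have u1 : normc u = 1.
  rewrite /u normcM normcV {1}/normc expr0n add0r sqrtr_sqr ger0_norm ?normc_ge0//.
  by rewrite divff// gt_eqF// normc_gt0.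
have := @circle_Im (fun z => u * F z) w S (entireM (entire_cst u) entF).
rewrite {2}/u divfK//=; apply=> t ht.
apply: le_trans (le_trans (ler_norm _) (ge_Im_normc _)) _.
by rewrite normcM u1 mul1r; exact: hS.
Qed.
End Goursat.

(** * Propagation of a limit to the left *)

Section Continuation.
Variable R : realType.
Local Notation C := R[i].
Implicit Types (z w : C) (F G : C -> C).

Definition null_seq (u : nat -> C) : Prop :=
  forall e : R, 0 < e -> exists n0, forall n, (n0 <= n)%N -> normc (u n) < e.

Lemma circle_bounded F w : entire F -> exists B : R,
  forall t, 0 <= t <= pi *+ 2 -> normc (F (w + cexp (0 +i* t))) <= B.
Proof.
move=> entF.
have entH : entire (fun u => F (w + cexp u)).
  exact: (entire_comp entF (entireD (entire_cst w) (@entire_cexp R))).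
have cH : continuous (fun t : R => normc (F (w + cexp (0 +i* t)))).
  apply: (@continuous_line R _ entH (fun t => 0 +i* t) (@normc R)).
    move=> z z'; rewrite ler_norml lerBlDl lerNl opprB lerBlDl.
    apply/andP; split.
      by have := le_normcD z (z' - z); rewrite (addrC z) subrK normcBC addrC.
    by have := le_normcD z' (z - z'); rewrite (addrC z') subrK addrC.
  by move=> s t; exact: vert_dist.
have p0 : 0 <= pi *+ 2 :> R by rewrite mulrn_wge0// pi_ge0.
have [c _ hc] := EVT_max p0 (continuous_subspaceT cH).
by eexists => t ht; apply: (hc t); rewrite in_itv.
Qed.

Lemma archi_large (a b : R) : 0 < b -> exists n : nat, a < b * n%:R.
Proof.
move=> b0; have [a0|a0] := ltP a 0; first by exists 0%N; rewrite mulr0.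
have h := archi_boundP (divr_ge0 a0 (ltW b0)); exists (Num.bound (a / b)).
by rewrite mulrC -ltr_pdivrMr.
Qed.

(** Bounds for the real part of [z + z ^ 2 / 2] at the point [z] of the unit
    circle with real part [c]. It is negative for [c <= 1 / 3]. *)
Lemma quad_le (c : R) : -1 <= c -> c <= 1 -> c + c ^+ 2 - 2^-1 <= 3 / 2.
Proof. by nra. Qed.

Lemma quad_le_left (c : R) : -1 <= c -> c <= 3^-1 ->
  c + c ^+ 2 - 2^-1 <= - 18^-1.
Proof. by nra. Qed.

Section Step.
Variables (D : nat -> C -> C) (K : R -> R) (s1 : R).
Hypothesis entD : forall M, entire (D M).
Hypothesis cauchyD : forall r M M' s, (M <= M')%N -> normc s <= r ->
  s1 <= complex.Re s -> normc (D M' s - D M s) <= K r / M.+1%:R.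

(** Let [M'] tend to infinity in [cauchyD]. *)
Let rate r M s : normc s <= r -> s1 <= complex.Re s -> null_seq (D ^~ s) ->
  normc (D M s) <= K r / M.+1%:R.
Proof.
move=> sr s1s h; apply/ler_addgt0Pr => e /h[n0 hn].
have := cauchyD (leq_maxl M n0) sr s1s => c1.
have := hn _ (leq_maxr M n0) => c2.
have -> : D M s = D (maxn M n0) s - (D (maxn M n0) s - D M s) by rewrite subKr.
by apply: le_trans (le_normcB _ _) _; rewrite addrC; apply: lerD c1 (ltW c2).
Qed.

(** The unit circle about [w] has a right part, where [D M] tends to 0 at the
    rate [1 / M], and a left part, where it is only bounded. The factor
    [phi s = exp (k ((s - w) + (s - w) ^ 2 / 2))] has value 1 at [w] and modulus
    at most [exp (- k / 18)] on the left part; choosing [k] first and [M]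
    second, the maximum principle makes [D M w] arbitrarily small. *)
Lemma continuation_step (t : R) :
  (forall s, t < complex.Re s -> s1 + 1 <= complex.Re s -> null_seq (D ^~ s)) ->
  forall w, t - 3^-1 < complex.Re w -> s1 + 1 <= complex.Re w -> null_seq (D ^~ w).
Proof.
move=> zero w tw s1w e e0.
have e3 : 0 < e / 3 by rewrite divr_gt0.
have [B0 hB0] := circle_bounded w (entD 0).
pose r := normc w + 1.
have pr T : normc (w + cexp (0 +i* T)) <= r.
  by apply: le_trans (le_normcD _ _) _; rewrite normc_cexp expR0.
have ps T : s1 <= complex.Re (w + cexp (0 +i* T)).
  by rewrite ReD /= expR0 mul1r; have := cos_geN1 T; lra.
have Kr : 0 <= K r.
  have := cauchyD (leqnn 0) (pr 0) (ps 0); rewrite subrr normc0 divr1; exact.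
have hB M T : 0 <= T <= pi *+ 2 -> normc (D M (w + cexp (0 +i* T))) <= B0 + K r.
  move=> hT; have -> : D M (w + cexp (0 +i* T)) = D 0 (w + cexp (0 +i* T)) +
    (D M (w + cexp (0 +i* T)) - D 0 (w + cexp (0 +i* T))) by rewrite addrCA subrr addr0.
  apply: le_trans (le_normcD _ _) _; apply: lerD; first exact: hB0.
  by have := cauchyD (leq0n M) (pr T) (ps T); rewrite divr1.
pose B := B0 + K r.
have B_ge0 : 0 <= B.
  have /(hB 0) : 0 <= (0 : R) <= pi *+ 2 by rewrite lexx mulrn_wge0// pi_ge0.
  by apply: le_trans; exact: normc_ge0.
have e18 : 0 < e / 54 by rewrite divr_gt0.
have [k hk] := archi_large B e18.
have e3k : 0 < e / 3 * expR (- (k%:R * (3/2))) by rewrite mulr_gt0 ?expR_gt0.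
have [n0 hn0] := archi_large (K r) e3k.
exists n0 => M hM.
pose phi s := cexp (k%:R * ((s - w) + (s - w) ^+ 2 / 2)).
have entphi : entire phi.
  have ent1 : entire (fun s : C => s - w) := entireB (@entire_id R) (entire_cst w).
  have ent2 := entireD ent1 (entireM (entireX 2 ent1) (entire_cst (2^-1 : C))).
  exact: (entire_comp (@entire_cexp R) (entireM (entire_cst (k%:R : C)) ent2)).
pose c1 := B * expR (- (k%:R / 18)).
pose c2 := K r / M.+1%:R * expR (k%:R * (3/2)).
have c10 : 0 <= c1 by rewrite mulr_ge0// expR_ge0.
have c20 : 0 <= c2 by rewrite mulr_ge0 ?expR_ge0 ?divr_ge0.
have c1e : c1 < e / 3.
  rewrite /c1 expRN ltr_pdivrMr ?expR_gt0//.
  have := expR_ge1Dx (k%:R / 18 : R) => h.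
  apply: lt_le_trans hk _.
  rewrite (_ : e / 54 * k%:R = e / 3 * (k%:R / 18)); last by field.
  by rewrite ler_pM2l//; apply: le_trans h; rewrite lerDr.
have c2e : c2 < e / 3.
  rewrite /c2 mulrAC ltr_pdivrMr ?ltr0n// -ltr_pdivlMr ?expR_gt0// -expRN.
  rewrite mulrAC; apply: lt_le_trans hn0 _; rewrite ler_pM2l// ler_nat.
  exact: leqW.
have key : normc (D M w * phi w) <= c1 + c2.
  apply: (circle_normc (entireM (entD M) entphi)) => T hT.
  have := hB M T hT; have := pr T; have := ps T.
  set s := w + cexp (0 +i* T) => s1s sr sB.
  have Rephi : normc (phi s) = expR (k%:R * (cos T + cos T ^+ 2 - 2^-1)).
    rewrite normc_cexp; congr expR.
    have -> : s - w = cexp (0 +i* T) by rewrite /s addrC addKr.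
    rewrite /cexp /= expR0 !mul1r.
    have -> : (2 : C)^-1 = (2^-1)%:C by rewrite -(rmorph_nat (real_complex R)) fmorphV.
    rewrite -(rmorph_nat (real_complex R)) /=.
    have := cos2Dsin2 T; move: (cos T) (sin T) => c s' cs.
    rewrite mul0r subr0 mulr0 subr0.
    have -> : s' * s' = 1 - c ^+ 2 by rewrite -cs; ring.
    by field.
  have k0 : 0 <= k%:R :> R by [].
  have cm := cos_max T; move: cm; rewrite ler_norml => /andP[cm1 cm2].
  rewrite normcM Rephi.
  have [/andP[h1 h2]|] := boolP ((t < complex.Re s) && (s1 + 1 <= complex.Re s)).
    have := rate M sr s1s (zero s h1 h2) => hr.
    have h12 : c2 <= c1 + c2 by rewrite lerDr.
    apply: le_trans h12.
    apply: ler_pM; [exact: normc_ge0|exact: expR_ge0|by []|].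
    rewrite ler_expR; apply: ler_wpM2l => //.
    exact: quad_le.
  rewrite negb_and -!leNgt -ltNge => hs.
  have cT : cos T <= 3^-1.
    have Rs : complex.Re s = complex.Re w + cos T.
      by rewrite /s ReD /= expR0 mul1r.
    by move: hs tw s1w; rewrite Rs => /orP[]; lra.
  have h12 : c1 <= c1 + c2 by rewrite lerDl.
  apply: le_trans h12.
  apply: ler_pM; [exact: normc_ge0|exact: expR_ge0|by []|].
  rewrite ler_expR -mulrN; apply: ler_wpM2l => //.
  exact: quad_le_left.
have : phi w = 1 by rewrite /phi subrr expr0n mul0r addr0 mulr0 cexp0.
by move: key => + E; rewrite E mulr1 => h; move: c1e c2e h e0; lra.
Qed.

(** A sequence of entire functions that is uniformly Cauchy on bounded parts
    of a half-plane and tends to 0 far to the right tends to 0 up to the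
    boundary; this replaces the identity theorem for the limit function. *)
Lemma continuation (t : R) :
  (forall s, t < complex.Re s -> null_seq (D ^~ s)) ->
  forall w, s1 + 1 <= complex.Re w -> null_seq (D ^~ w).
Proof.
move=> zero w s1w.
have step n : forall s, t - n%:R / 3 < complex.Re s -> s1 + 1 <= complex.Re s ->
    null_seq (D ^~ s).
  elim: n => [s|n IH s ts s1s]; first by rewrite mul0r subr0 => ts _; exact: zero.
  apply: (continuation_step IH) => //; apply: le_lt_trans ts.
  by rewrite -natr1; lra.
have [n hn] := @archi_large (t - complex.Re w) 3^-1 ltac:(by []).
by apply: (step n) => //; lra.
Qed.
End Step.
End Continuation.

(** * The binomial expansion of a power, with remainder *)

Section Remainder.
Variable R : realType.
Local Notation C := R[i].
Implicit Types (z w s : C) (F G : C -> C).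

Lemma real_is_derive_eps (f : R -> R) (x l : R) :
  (forall e : R, 0 < e -> exists2 d : R, 0 < d &
    forall h, `|h| < d -> `|f (x + h) - f x - l * h| <= e * `|h|) ->
  is_derive x 1 f l.
Proof.
move=> hl.
have cl : (fun h : R => h^-1 *: (f (h *: (1 : R) + x) - f x)) @ 0^' --> l.
  apply/cvgrPdist_lt => e e0.
  have [d d0 dP] := hl (e / 2) ltac:(by rewrite divr_gt0).
  apply/nbhs_ballP; exists d => //= h; rewrite /ball/= sub0r normrN => hd h0.
  have hp : 0 < `|h| by rewrite normr_gt0.
  have := dP h hd; rewrite scaler1 -ler_pdivrMr// -normfV -normrM.
  rewrite mulrBl mulfK // mulrC [h + x]addrC distrC => le.
  by apply: le_lt_trans le _; rewrite ltr_pdivrMr// ltr_pMr// ltr1n.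
by apply: DeriveDef; [apply/cvg_ex; exists l|exact: (cvg_lim _ cl)].
Qed.

Lemma is_derive_cexpM (c z : C) :
  is_derive (z : C^o) 1 ((fun u => cexp (c * u)) : C^o -> C^o) (c * cexp (c * z) : C^o).
Proof.
apply/is_derive_epsP => e e0.
have z0 : 0 < normc (cexp (c * z)) by rewrite normc_gt0 cexp_neq0.
have c1 : 0 < normc c + 1 by rewrite ltr_wpDl ?normc_ge0.
have [d d0 dP] := cexp_eps (divr_gt0 e0 (mulr_gt0 z0 c1)).
exists (d / (normc c + 1)); first exact: divr_gt0.
move=> h; rewrite ltr_pdivlMr// => hd.
have hc : normc (c * h) <= normc h * (normc c + 1).
  by rewrite normcM mulrC ler_wpM2l ?normc_ge0// lerDl.
have -> : cexp (c * (z + h)) - cexp (c * z) - c * cexp (c * z) * h =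
  cexp (c * z) * (cexp (c * h) - 1 - c * h) by rewrite mulrDr cexpD; ring.
rewrite normcM.
apply: le_trans (ler_wpM2l (normc_ge0 _) (dP _ (le_lt_trans hc hd))) _.
have -> : normc (cexp (c * z)) * (e / (normc (cexp (c * z)) * (normc c + 1)) * normc (c * h))
  = e * (normc (c * h) / (normc c + 1)).
  by field; rewrite !gt_eqF.
by rewrite ler_pM2l// ler_pdivrMr.
Qed.

(** The mean value theorem for the real part of [v * F], with [v] of modulus
    1 such that [v * (F b - F a)] is real and positive. *)
Lemma mean_value_le F (l : C -> C) (a b B : R) : a <= b ->
  (forall z, is_derive (z : C^o) 1 (F : C^o -> C^o) (l z : C^o)) ->
  (forall x, a <= x <= b -> normc (l x%:C) <= B) ->
  normc (F b%:C - F a%:C) <= B * (b - a).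
Proof.
move=> ab hF hB; have [->|D0] := eqVneq (F b%:C - F a%:C) 0.
  rewrite normc0 mulr_ge0 ?subr_ge0//; apply: le_trans (hB a _); first exact: normc_ge0.
  by rewrite lexx.
pose v := (normc (F b%:C - F a%:C))%:C / (F b%:C - F a%:C).
have v1 : normc v = 1.
  rewrite /v normcM normcV normc_real ger0_norm ?normc_ge0//.
  by rewrite divff// gt_eqF// normc_gt0.
pose g (x : R) := complex.Re (v * F x%:C).
have dg (x : R) : is_derive x 1 g (complex.Re (v * l x%:C)).
  apply: real_is_derive_eps => e e0; have [d d0 dP] := (is_derive_epsP _ _ _).1 (hF x%:C) _ e0.
  exists d => // h hd; have hh : normc h%:C < d by rewrite normc_real.
  have := dP _ hh; rewrite normc_real; apply: le_trans.
  rewrite -[leRHS]mul1r -v1 -normcM; apply: le_trans (ge_Re_normc _).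
  rewrite le_eqVlt; apply/orP; left; apply/eqP; congr `|_|.
  rewrite /g rmorphD; move: (v) (F _) (F _) (l _) => [v1' v2] [f1 f2] [g1 g2] [l1 l2] /=.
  by ring.
have [|c] := MVT_segment ab (fun x _ => dg x).
  apply: continuous_subspaceT => x.
  by apply/differentiable_continuous/derivable1_diffP; case: (dg x).
rewrite in_itv /= => hc.
have -> : g b - g a = normc (F b%:C - F a%:C).
  rewrite /g -ReN -ReD -mulrBr /v divfK //.
move=> ->; rewrite ler_wpM2r ?subr_ge0//.
apply: le_trans (ler_norm _) (le_trans (ge_Re_normc _) _).
by rewrite normcM v1 mul1r hB.
Qed.

(** The binomial coefficient of [- s] and [i], as a polynomial in [s]. *)
Fixpoint bin_coef (s : C) (i : nat) : C :=
  if i is j.+1 then - s / j.+1%:R * bin_coef (s + 1) j else 1.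

Lemma bin_coef_nat (j i : nat) : bin_coef (- j%:R) i = 'C(j, i)%:R.
Proof.
elim: i j => [|i IH] j /=; first by rewrite bin0.
case: j => [|j]; first by rewrite oppr0 oppr0 mul0r mul0r bin0n.
rewrite -natr1 opprD addrNK IH opprD !opprK natr1.
have hi : i.+1%:R != 0 :> C by rewrite pnatr_eq0.
apply: (mulfI hi); rewrite -natrM -mul_bin_diag natrM; field.
by rewrite nat1r.
Qed.

Lemma entire_bin_coef i : entire (bin_coef ^~ i).
Proof.
elim: i => [|i IH] /=; first exact: entire_cst.
apply: (entireM (F := fun s => - s / i.+1%:R) (G := fun s => bin_coef (s + 1) i)).
  exact: (entireM (entireN (@entire_id R)) (entire_cst (i.+1%:R^-1 : C))).
exact: (entire_comp IH (entireD (@entire_id R) (entire_cst (1 : C)))).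
Qed.

(** The remainder of the binomial expansion of [x ^ (- s)] at [x = n] to the
    order [K], as a function of [u = ln x]: in this variable it is an
    entire function, with no choice of a logarithm. *)
Definition bin_rem (n : R) (K : nat) (s u : C) : C :=
  cexp (- s * u) - \sum_(i < K)
     bin_coef s i * (cexp u - n%:C) ^+ i * cexp (- (s + i%:R) * (ln n)%:C).

(** Up to a factor, differentiation lowers the order [K] and shifts [s], which
    allows estimates by induction on [K]. *)
Lemma bin_rem_derive n K s u :
  is_derive (u : C^o) 1 ((bin_rem n K.+1 s) : C^o -> C^o)
    (- s * cexp u * bin_rem n K (s + 1) u : C^o).
Proof.
have d1 := is_derive_cexpM (- s) u.
have d2 : is_derive (u : C^o) 1 ((fun u => cexp u - n%:C) : C^o -> C^o) (cexp u : C^o).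
  apply/is_derive_epsP => e e0.
  have [d d0 dP] := (is_derive_epsP _ _ _).1 (is_derive_cexpM 1 u) _ e0.
  exists d => // h /dP; rewrite !mul1r; congr (normc _ <= _); ring.
pose c i : C := bin_coef s i * cexp (- (s + i%:R) * (ln n)%:C).
have d3 i : is_derive (u : C^o) 1 ((c i) \*: ((fun u => cexp u - n%:C) ^+ i : C^o -> C^o))
   (c i *: ((i%:R * (cexp u - n%:C) ^+ i.-1) *: cexp u) : C^o).
  by apply: is_deriveZ; exact: is_deriveX.
have d4 := is_deriveB d1 (is_derive_sum (fun i : 'I_K.+1 => d3 i)).
have -> : bin_rem n K.+1 s = (fun u : C => cexp (- s * u)) -
   (\sum_(i < K.+1) ((c i) \*: ((fun u => cexp u - n%:C) ^+ i : C^o -> C^o))).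
  apply/funext => x; rewrite /bin_rem /= fct_sumE; congr (_ - _).
  apply: eq_bigr => i _ /=; rewrite /c /GRing.scale /= -mulrA mulrCA mulrC; congr (_ * _).
  by elim: (val i) => [|k IH]; rewrite ?expr0// !exprS IH.
apply: is_derive_eq d4 _.
rewrite big_ord_recl /= mul0r scale0r scaler0 add0r /bin_rem mulrBr; congr (_ - _).
  rewrite -mulrA -cexpD; congr (_ * cexp _); ring.
rewrite mulr_sumr; apply: eq_bigr => i _; rewrite /c /GRing.scale /= /bump /= add1n.
rewrite -natr1 (addrA s) (addrAC s).
have hi : i.+1%:R != 0 :> C by rewrite pnatr_eq0.
by rewrite (addrC _ 1); field; rewrite nat1r.
Qed.
End Remainder.

(** * The values at non-positive integers *)

Section Recurrence.
Variable R : realType.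
Local Notation C := R[i].
Implicit Types (z w s : C) (F G : C -> C) (u v : nat -> C).

Lemma null_seqD u v : null_seq u -> null_seq v -> null_seq (fun n => u n + v n).
Proof.
move=> hu hv e e0; have e2 : 0 < e / 2 by rewrite divr_gt0.
have [n0 h0] := hu _ e2; have [n1 h1] := hv _ e2.
exists (maxn n0 n1) => n; rewrite geq_max => /andP[/h0 a0 /h1 a1].
apply: le_lt_trans (le_normcD _ _) _; rewrite [e]splitr; exact: ltrD.
Qed.

Lemma null_seqZ (c : C) u : null_seq u -> null_seq (fun n => c * u n).
Proof.
move=> hu e e0; have c1 : 0 < normc c + 1 by rewrite ltr_wpDl ?normc_ge0.
have [n0 h0] := hu _ (divr_gt0 e0 c1); exists n0 => n /h0.
rewrite ltr_pdivlMr// normcM mulrC; apply: le_lt_trans.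
by rewrite ler_wpM2r ?normc_ge0// lerDl.
Qed.

Lemma null_seq_sum (I : Type) (r : seq I) (f : I -> nat -> C) :
  (forall i, null_seq (f i)) -> null_seq (fun n => \sum_(i <- r) f i n).
Proof.
move=> hf; elim: r => [|i r IH].
  by move=> e e0; exists 0%N => n _; rewrite big_nil normc0.
rewrite (_ : (fun n => _) = (fun n => f i n + \sum_(k <- r) f k n)); first exact: null_seqD.
by apply/funext => n; rewrite big_cons.
Qed.

Lemma null_seq_cst (c : C) : null_seq (fun=> c) -> c = 0.
Proof.
move=> h; apply: eq0_normc; apply/eqP; rewrite eq_le normc_ge0 andbT.
by apply/ler_addgt0Pr => e /h[n0 /(_ _ (leqnn _))/ltW]; rewrite add0r.
Qed.

Lemma cexp_ln (x : R) (n : nat) : 0 < x -> cexp (n%:R * (ln x)%:C) = x%:C ^+ n.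
Proof. by move=> x0; rewrite cexpM_nat cexp_real lnK. Qed.

Lemma bin_rem_base n K s : 0 < n -> bin_rem n K.+1 s (ln n)%:C = 0.
Proof.
move=> n0; rewrite /bin_rem big_ord_recl /= expr0 !mul1r addr0 cexp_real lnK//.
rewrite big1 ?addr0 ?subrr// => i _.
by rewrite /bump /= add1n ?subrr expr0n mulr0 mul0r.
Qed.

(** The remainder vanishes at [ln n], so each order gained costs one
    integration over an interval of length at most [T / n]. *)
Lemma bin_rem_bound (n T : R) K s (x : R) : 1 <= n -> 0 <= T ->
  ln n <= x <= ln (n + T) -> 0 <= complex.Re s + K%:R ->
  normc (bin_rem n K s x%:C) <=
    (T * (1 + T) * (normc s + K%:R)) ^+ K * expR (- ((complex.Re s + K%:R) * ln n)).
Proof.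
move=> n1 T0; have n0 : 0 < n := lt_le_trans ltr01 n1.
have nT : 0 < n + T by rewrite ltr_wpDr.
have lnn : 0 <= ln n := ln_ge0 n1.
elim: K s x => [|K IH] s x /andP[nx xT].
  rewrite addr0 expr0 mul1r => s0.
  rewrite /bin_rem big_ord0 subr0 normc_cexp ler_expR.
  have -> : complex.Re (- s * x%:C) = - (complex.Re s * x).
    by case: (s) => a b /=; rewrite mulr0 subr0 mulNr.
  by rewrite lerN2 ler_wpM2l.
move=> sK.
have sK' : 0 <= complex.Re (s + 1) + K%:R.
  by rewrite ReD /=; move: sK; rewrite -natr1; lra.
pose P := (T * (1 + T) * (normc (s + 1) + K%:R)) ^+ K *
  expR (- ((complex.Re (s + 1) + K%:R) * ln n)).
have P0 : 0 <= P.
  by rewrite mulr_ge0 ?expR_ge0// exprn_ge0// !mulr_ge0 ?addr_ge0 ?normc_ge0.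
have hB y : ln n <= y <= x ->
    normc (- s * cexp y%:C * bin_rem n K (s + 1) y%:C) <= normc s * (n + T) * P.
  move=> /andP[ny yx]; rewrite !normcM normcN cexp_real normc_real ger0_norm ?expR_ge0//.
  have yT : y <= ln (n + T) := le_trans yx xT.
  apply: ler_pM; rewrite ?mulr_ge0 ?expR_ge0 ?normc_ge0//.
    apply: ler_wpM2l; first exact: normc_ge0.
    by rewrite -[leRHS](lnK (_ : n + T \in Num.pos)) ?posrE// ler_expR.
  by apply: IH => //; rewrite ny.
have := mean_value_le nx (fun z => bin_rem_derive n K s z) hB.
rewrite bin_rem_base// subr0 => /le_trans; apply.
have xln : x - ln n <= T / n.
  have : ln (n + T) = ln n + ln (1 + T / n).
    have p : 0 < 1 + T / n by rewrite ltr_wpDr// divr_ge0// ltW.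
    rewrite -lnM ?posrE//.
    by congr ln; field; rewrite gt_eqF.
  have Tn : -1 < T / n by apply: lt_le_trans (divr_ge0 T0 (ltW n0)); rewrite ltrN10.
  by have := le_ln1Dx Tn; lra.
rewrite /P ReD /= -[in leRHS]natr1.
have -> : complex.Re s + 1 + K%:R = complex.Re s + (K%:R + 1) by lra.
set E := expR _; have E0 : 0 <= E := expR_ge0 _.
set Q := (T * (1 + T) * (normc (s + 1) + K%:R)) ^+ K.
have Q0 : 0 <= Q by rewrite exprn_ge0// !mulr_ge0 ?addr_ge0 ?normc_ge0.
have QQ : Q <= (T * (1 + T) * (normc s + (K%:R + 1))) ^+ K.
  apply: lerXn2r; rewrite ?nnegrE ?mulr_ge0 ?addr_ge0 ?normc_ge0//.
  apply: ler_wpM2l; first by rewrite mulr_ge0 ?addr_ge0.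
  by have := le_normcD s 1; rewrite normc1; lra.
rewrite exprS -!mulrA mulrCA.
set W := (T * _) ^+ K in QQ *.
have key : (n + T) * (x - ln n) <= T * (1 + T).
  apply: le_trans (ler_wpM2l (ltW nT) xln) _.
  rewrite mulrCA; apply: ler_wpM2l => //.
  rewrite mulrDl divff ?gt_eqF// lerD2l ler_pdivrMr//; nra.
have -> : (n + T) * (normc s * (Q * (E * (x - ln n)))) =
   ((n + T) * (x - ln n)) * (normc s * (Q * E)) by ring.
rewrite [leRHS]mulrA; apply: ler_pM.
- by rewrite mulr_ge0 ?subr_ge0// ltW.
- by rewrite !mulr_ge0 ?normc_ge0.
- exact: key.
- apply: ler_pM; rewrite ?mulr_ge0 ?normc_ge0//.
    by rewrite lerDl addr_ge0.
  by apply: ler_wpM2r => //; rewrite /W mulrA.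
Qed.

(** For a negative exponent [- s = j] the binomial expansion is finite. *)
Lemma bin_rem_nat (n T : R) K (j : nat) : 0 < n -> 0 <= T -> (j < K)%N ->
  bin_rem n K (- j%:R) (ln (n + T))%:C = 0.
Proof.
move=> n0 T0 jK; have nT : 0 < n + T by rewrite ltr_wpDr.
rewrite /bin_rem opprK cexp_ln// cexp_real lnK// rmorphD exprDn.
rewrite (big_ord_widen_cond K xpredT
  (fun i => n%:C ^+ (j - i) * T%:C ^+ i *+ 'C(j, i)))//.
rewrite big_mkcond -sumrB big1// => i _; rewrite bin_coef_nat /=.
case: ltnP => [ij|ji]; last by rewrite bin_small// !mul0r subrr.
rewrite (addrAC n%:C) subrr add0r -mulrnAr mulrC -[_ *+ 'C(j, i)]mulr_natl.
have -> : - (- j%:R + i%:R) = (j - i)%:R :> C.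
  by rewrite opprD opprK natrB//.
by rewrite cexp_ln// subrr.
Qed.

Lemma null_seq_shift u k : null_seq u -> null_seq (fun n => u (n + k)%N).
Proof.
by move=> hu e /hu[n0 h]; exists n0 => n nn0; apply: h; apply: leq_trans (leq_addr _ _).
Qed.

Lemma null_seqN u : null_seq u -> null_seq (fun n => - u n).
Proof. by move=> hu e /hu[n0 h]; exists n0 => n /h; rewrite normcN. Qed.

Definition dirichlet_sum (g : nat -> C) (M : nat) (s : C) : C :=
  \sum_(1 <= n < M.+1) g n * cpow n%:R (- s).

Lemma dirichlet_sumS g M s :
  dirichlet_sum g M.+1 s = dirichlet_sum g M s + g M.+1 * cpow M.+1%:R (- s).
Proof. by rewrite /dirichlet_sum big_nat_recr. Qed.

Lemma entire_cpow (x : R) (F : C -> C) : entire F -> entire (fun s => cpow x (F s)).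
Proof.
by move=> hF; exact: (entire_comp (@entire_cexp R) (entireM hF (entire_cst (ln x)%:C))).
Qed.

Lemma entire_dirichlet_sum g M : entire (dirichlet_sum g M).
Proof.
apply: (entire_sum _ _ (F := fun n s => g n * cpow n%:R (- s))) => n.
exact: (entireM (entire_cst (g n)) (entire_cpow n%:R (entireN (@entire_id R)))).
Qed.

Lemma inv_sq_telescope (M : nat) :
  (M.+1%:R ^+ 2)^-1 <= 2 * (M.+1%:R^-1 - M.+2%:R^-1) :> R.
Proof.
rewrite -[M.+2%:R]natr1; have : 1 <= M.+1%:R :> R by rewrite ler1n.
move: (M.+1%:R : R) => x x1; have x0 : 0 < x by lra.
have x2 : 0 < x + 1 by lra.
have -> : 2 * (x^-1 - (x + 1)^-1) = 2 / (x * (x + 1)).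
  by field; rewrite !gt_eqF.
rewrite -[leLHS]mul1r ler_pdivrMr ?exprn_gt0// mulrAC ler_pdivlMr ?mulr_gt0//.
by rewrite mul1r; nra.
Qed.

(** Let [D M s] be the difference between the two sides of the identity
    obtained by expanding [(n + N) ^ (- s)] in the series, with sums truncated
    at [M]. Its increments are remainders of size [M ^ (- 2)], locally uniformly
    in a half-plane that contains [- j]; since it tends to 0 for [Re s > 1],
    it also does at [- j] by [continuation]. There the remainders vanish, so
    that [D 0 (- j) = 0], which is the recurrence. *)
Lemma dirichlet_recurrence (N : nat) (g : nat -> C) (B : R) (F : C -> C) (j : nat) :
  entire F -> (forall n, g (n + N)%N = g n) -> (forall n, normc (g n) <= B) ->
  (forall s, 1 < complex.Re s -> null_seq (fun M => dirichlet_sum g M s - F s)) ->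
  \sum_(1 <= x < N.+1) g x * x%:R ^+ j +
  \sum_(1 <= i < j.+1) 'C(j, i)%:R * N%:R ^+ i * F (- (j - i)%:R) = 0.
Proof.
move=> entF gN gB hF; have [K KE] : exists K, K = j.+3 by exists j.+3.
(* the order j.+3 puts - j in the half-plane 3 - K <= Re s that continuation reaches *)
pose S := dirichlet_sum g.
pose D M s := (S (M + N)%N s - F s) +
  \sum_(i < K) bin_coef s i * N%:R ^+ i * (F (s + i%:R) - S M (s + i%:R)).
have entD M : entire (D M).
  apply: (entireD (entireB (entire_dirichlet_sum g (M + N)) entF)).
  apply: (entire_sum _ _ (F := fun (i : 'I_K) s => bin_coef s i * N%:R ^+ i * (F (s + i%:R) - S M (s + i%:R)))) => i.
  have ent1 := entireD (@entire_id R) (entire_cst (i%:R : C)).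
  apply: (entireM (entireM (entire_bin_coef R (val i)) (entire_cst (N%:R ^+ (val i) : C)))).
  exact: (entireB (entire_comp entF ent1) (entire_comp (entire_dirichlet_sum g M) ent1)).
have DS M s : D M.+1 s - D M s =
    g M.+1 * bin_rem M.+1%:R K s (ln (M.+1%:R + N%:R))%:C.
  rewrite /D addSn /S !dirichlet_sumS -addSn gN /bin_rem mulrBr mulr_sumr.
  have -> : cpow (M.+1 + N)%:R (- s) = cexp (- s * (ln (M.+1%:R + N%:R : R))%:C).
    by rewrite /cpow natrD.
  set A := dirichlet_sum g (M + N) s; set X := g M.+1 * cexp _.
  rewrite (_ : A + X - F s + _ - _ = X - (\sum_(i < K) bin_coef s i * N%:R ^+ i * (F (s + i%:R) - dirichlet_sum g M (s + i%:R)) -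
   \sum_(i < K) bin_coef s i * N%:R ^+ i * (F (s + i%:R) - dirichlet_sum g M.+1 (s + i%:R)))); last by ring.
  congr (_ - _); rewrite -sumrB; apply: eq_bigr => i _.
  rewrite dirichlet_sumS cexp_real lnK ?posrE ?ltr_wpDr//.
  rewrite rmorphD addrAC !rmorph_nat subrr add0r /cpow; ring.
have B0 : 0 <= B := le_trans (normc_ge0 _) (gB 0%N).
pose Cr r : R := (N%:R * (1 + N%:R) * (r + K%:R)) ^+ K.
have incr r M s : normc s <= r -> 2 - K%:R <= complex.Re s ->
    normc (D M.+1 s - D M s) <= B * Cr r / M.+1%:R ^+ 2.
  move=> sr sK; rewrite DS normcM -mulrA.
  have n1 : 1 <= M.+1%:R :> R by rewrite ler1n.
  apply: ler_pM; rewrite ?normc_ge0//.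
  have hx : ln (M.+1%:R : R) <= ln (M.+1%:R + N%:R : R) <= ln (M.+1%:R + N%:R : R).
    by rewrite lexx andbT ler_ln ?posrE ?ltr_wpDr ?lerDl.
  have sK0 : 0 <= complex.Re s + K%:R by move: sK; lra.
  apply: le_trans (bin_rem_bound n1 (ler0n _ _) hx sK0) _.
  have r0 : 0 <= r := le_trans (normc_ge0 _) sr.
  apply: ler_pM; rewrite ?expR_ge0 ?exprn_ge0 ?mulr_ge0 ?addr_ge0 ?normc_ge0//.
    apply: lerXn2r; rewrite ?nnegrE ?mulr_ge0 ?addr_ge0 ?normc_ge0//.
    by apply: ler_wpM2l; rewrite ?mulr_ge0 ?addr_ge0// lerD2r.
  have -> : (M.+1%:R ^+ 2)^-1 = expR (- (2 * ln M.+1%:R)) :> R.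
    by rewrite expRN expRM_natl lnK// posrE.
  rewrite ler_expR lerN2; apply: ler_wpM2r; first exact: ln_ge0.
  by move: sK; lra.
have cauchyD r M M' s : (M <= M')%N -> normc s <= r -> 2 - K%:R <= complex.Re s ->
    normc (D M' s - D M s) <= (2 * (B * Cr r)) / M.+1%:R.
  move=> MM sr sK; have r0 : 0 <= r := le_trans (normc_ge0 _) sr.
  have C0 : 0 <= B * Cr r.
    by rewrite mulr_ge0 ?exprn_ge0 ?mulr_ge0 ?addr_ge0.
  suff h : normc (D M' s - D M s) <= 2 * (B * Cr r) * (M.+1%:R^-1 - M'.+1%:R^-1).
    apply: le_trans h _; rewrite mulrBr lerBlDr lerDl; apply: mulr_ge0; first exact: mulr_ge0.
    by rewrite invr_ge0.
  elim: M' MM => [|M' IH].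
    by rewrite leqn0 => /eqP ->; rewrite !subrr normc0 mulr0.
  rewrite leq_eqVlt => /orP[/eqP ->|]; first by rewrite !subrr normc0 mulr0.
  rewrite ltnS => /IH h.
  rewrite -(subrKA (D M' s)); apply: le_trans (le_normcD _ _) _.
  apply: le_trans (lerD (incr r M' s sr sK) h) _.
  have -> : M.+1%:R^-1 - M'.+2%:R^-1 = (M.+1%:R^-1 - M'.+1%:R^-1) +
     (M'.+1%:R^-1 - M'.+2%:R^-1) :> R by ring.
  rewrite [leRHS]mulrDr addrC lerD2l.
  rewrite [2 * _]mulrC -[leRHS]mulrA; apply: ler_wpM2l => //.
  exact: inv_sq_telescope.
have zero s : 1 < complex.Re s -> null_seq (D ^~ s).
  move=> s1; apply: null_seqD.
    exact: (null_seq_shift N (hF s s1)).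
  apply: null_seq_sum => i; apply: null_seqZ.
  have h : null_seq (fun M => - (S M (s + i%:R) - F (s + i%:R))).
    apply: null_seqN; apply: hF; rewrite ReD Re_nat.
    by have : 0 <= (val i)%:R :> R by []; lra.
  by move=> e /h[n0 hn]; exists n0 => n /hn; rewrite opprB.
have := @continuation R D _ _ entD cauchyD 1 zero (- j%:R).
rewrite ReN Re_nat => hD.
have {}hD : null_seq (D ^~ (- j%:R)).
  by apply: hD; rewrite KE -addn3 natrD; lra.
have Dc M : D M (- j%:R) = D 0 (- j%:R).
  elim: M => [//|M <-]; apply/eqP; rewrite -subr_eq0 DS bin_rem_nat ?mulr0//.
  by rewrite KE ltnS leqW// leqW.
have : D 0 (- j%:R) = 0.
  apply: null_seq_cst; move: hD; rewrite (_ : (D ^~ _) = fun=> D 0 (- j%:R))//.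
  by apply/funext => M; rewrite Dc.
rewrite /D add0n => D0.
rewrite -[RHS]D0; set X := \sum_(1 <= x < N.+1) _.
have -> : S N (- j%:R) = X.
  apply: eq_big_nat => x /andP[x1 _]; congr (_ * _).
  by rewrite /cpow opprK cexp_ln ?ltr0n// rmorph_nat.
rewrite -[RHS]addrA; congr (_ + _).
have -> : \sum_(i < K) bin_coef (- j%:R) i * N%:R ^+ i *
     (F (- j%:R + i%:R) - S 0 (- j%:R + i%:R)) =
   \sum_(0 <= i < K) 'C(j, i)%:R * N%:R ^+ i * F (- j%:R + i%:R).
  rewrite big_mkord; apply: eq_bigr => i _.
  by rewrite bin_coef_nat /S /dirichlet_sum big_geq// subr0.
rewrite KE [in RHS]big_ltn// bin0 expr0 !mul1r addr0 addrA addNr add0r.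
rewrite [RHS](@big_cat_nat _ _ _ j.+1)//=; last by rewrite leqW// leqW.
rewrite [X in _ = _ + X]big1_seq ?addr0; last first.
  by move=> i /andP[_]; rewrite mem_index_iota => /andP[ji _]; rewrite bin_small// !mul0r.
apply: eq_big_nat => i /andP[_ ij]; congr (_ * F _).
by rewrite natrB// opprB addrC.
Qed.
End Recurrence.

(** * Sums over roots of unity *)

Section RootSums.
Variables (K : numFieldType) (n : nat) (w : K).
Hypothesis prim_w : n.-primitive_root w.

Let n_gt0 : (0 < n)%N := prim_order_gt0 prim_w.

Definition root_sum (k b : nat) : K := \sum_(1 <= j < n) w ^+ (j * b) / (1 - w ^+ j) ^+ k.

Lemma prim_pow_neq1 j : (0 < j < n)%N -> 1 - w ^+ j != 0.
Proof.
move=> /andP[j0 jn]; rewrite subr_eq0 eq_sym -(prim_order_dvd prim_w).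
by apply/negP => /(dvdn_leq j0); rewrite leqNgt jn.
Qed.

Lemma prim_geom j : (0 < j < n)%N -> \sum_(b < n) w ^+ (j * b) = 0.
Proof.
move=> hj; have h : w ^+ j - 1 != 0 by rewrite -oppr_eq0 opprB prim_pow_neq1.
apply: (mulfI h); rewrite mulr0.
under eq_bigr => b _ do rewrite exprM.
by rewrite -subrX1 -exprM mulnC exprM (prim_expr_order prim_w) expr1n subrr.
Qed.

Lemma root_sum0 b : (0 < b < n)%N -> root_sum 0 b = -1.
Proof.
move=> hb; have := prim_geom hb; rewrite -(big_mkord xpredT (fun j => w ^+ (b * j))).
rewrite big_ltn// muln0 expr0 => /eqP; rewrite addrC addr_eq0 => /eqP <-.
by apply: eq_big_nat => j _; rewrite expr0 divr1 mulnC.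
Qed.

Lemma root_sum_diff k b : root_sum k.+1 b - root_sum k.+1 b.+1 = root_sum k b.
Proof.
rewrite -sumrB; apply: eq_big_nat => j hj.
have h := prim_pow_neq1 hj; have hk : (1 - w ^+ j) ^+ k != 0 by rewrite expf_neq0.
by rewrite mulnS exprD exprS; field; rewrite h hk.
Qed.

Lemma root_sum_total k : \sum_(b < n) root_sum k b.+1 = 0.
Proof.
rewrite exchange_big /= big_nat big1// => j hj.
under eq_bigr => b _ do rewrite mulnS exprD -mulrA mulrCA.
by rewrite -mulr_suml prim_geom// mul0r.
Qed.

Lemma sum_bin_hockey m k : \sum_(b < m) 'C(b, k)%:R = 'C(m, k.+1)%:R :> K.
Proof.
elim: m => [|m IH]; first by rewrite big_ord0 bin0n.
by rewrite big_ord_recr /= IH binS natrD addrC.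
Qed.

(** The expansion of [(1 - (1 - z)) ^ n = 1], multiplied by
    [z ^ b.+1 / (1 - z) ^ k.+1] and summed over the roots of unity [z] other
    than 1; the right-hand side comes from the terms without denominators.
    To avoid computing these, the proof checks that both sides have the same
    differences in [b], by induction on [k], and the same sum over [b]. *)
Lemma root_sum_rec k b : (b < n)%N ->
  \sum_(1 <= i < k.+1) 'C(n, i)%:R * (-1) ^+ i * root_sum (k.+1 - i) b.+1 =
  'C(n, k.+1)%:R * (-1) ^+ k.+1 + n%:R * (-1) ^+ k * 'C(b, k)%:R.
Proof.
elim: k b => [|k IH] b bn.
  by rewrite big_geq// bin1 bin0 expr1 expr0 !mulr1 mulrN1 addNr.
pose L b := \sum_(1 <= i < k.+2) 'C(n, i)%:R * (-1) ^+ i * root_sum (k.+2 - i) b.+1.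
pose Rr b : K := 'C(n, k.+2)%:R * (-1) ^+ k.+2 + n%:R * (-1) ^+ k.+1 * 'C(b, k.+1)%:R.
rewrite -/(L b) -/(Rr b).
have step c : (c.+1 < n)%N -> L c - L c.+1 = Rr c - Rr c.+1.
  move=> cn; rewrite /L -sumrB.
  under eq_big_nat => i /andP[_ ik].
    rewrite -mulrBr subSn// root_sum_diff; over.
  rewrite big_nat_recr//= IH 1?ltnW// subnn root_sum0//.
  by rewrite /Rr binS natrD !exprS; ring.
have cst c : (c < n)%N -> L c - Rr c = L 0 - Rr 0.
  elim: c => [//|c IHc] cn; rewrite -(IHc (ltnW cn)).
  by rewrite -[LHS]addr0 -(subrr (L c - L c.+1)) {2}(step c cn); ring.
have tot : \sum_(c < n) (L c - Rr c) = 0.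
  rewrite sumrB exchange_big /= big1_seq ?sub0r; last first.
    by move=> i _; rewrite -mulr_sumr root_sum_total mulr0.
  rewrite big_split /= sumr_const card_ord -mulr_sumr sum_bin_hockey.
  by rewrite -mulr_natl !exprS; ring.
have : n%:R * (L 0 - Rr 0) = 0.
  rewrite -tot mulr_natl -[in LHS](card_ord n) -sumr_const.
  by apply: eq_bigr => c _; rewrite cst.
move/eqP; rewrite mulf_eq0 pnatr_eq0 -leqn0 leqNgt n_gt0 /= => /eqP h.
by apply/eqP; rewrite -subr_eq0 cst// h.
Qed.

Section Weighted.
Variables (N r : nat) (g : nat -> K).
Hypotheses (nE : n = (N * r)%N) (sum_g : \sum_(1 <= x < N.+1) g x = 0).

Definition finite_fourier (z : K) (j : nat) : K :=
  \sum_(1 <= x < N.+1) g x * z ^+ (j * x).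

(** As the number [n] of nodes grows, this sum divided by [n ^ k] tends to a
    constant times the sum of [finite_fourier (w ^+ r) j / j ^ k] over the
    nonzero integers [j], the last terms standing for the negative [j]. *)
Definition fourier_sum (k : nat) : K :=
  \sum_(1 <= j < n) finite_fourier (w ^+ r) j / (1 - w ^+ j) ^+ k.

Lemma fourier_sumE k : fourier_sum k = \sum_(1 <= x < N.+1) g x * root_sum k (x * r).
Proof.
rewrite /root_sum; under [RHS]eq_bigr do rewrite mulr_sumr.
rewrite exchange_big /=; apply: eq_bigr => j _; rewrite /finite_fourier mulr_suml.
apply: eq_bigr => x _; rewrite mulrA; congr (_ * _ * _).
by rewrite -exprM mulnC mulnA.
Qed.

Lemma fourier_sum_rec k :
  \sum_(1 <= i < k.+1) 'C(n, i)%:R * (-1) ^+ i * fourier_sum (k.+1 - i) =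
  n%:R * (-1) ^+ k * \sum_(1 <= x < N.+1) g x * 'C((x * r).-1, k)%:R.
Proof.
have r0 : (0 < r)%N by move: n_gt0; rewrite nE muln_gt0 => /andP[].
under eq_bigr do rewrite fourier_sumE mulr_sumr.
rewrite exchange_big /=.
have -> : n%:R * (-1) ^+ k * \sum_(1 <= x < N.+1) g x * 'C((x * r).-1, k)%:R =
  \sum_(1 <= x < N.+1) g x * ('C(n, k.+1)%:R * (-1) ^+ k.+1 + n%:R * (-1) ^+ k * 'C((x * r).-1, k)%:R).
  under [RHS]eq_bigr do rewrite mulrDr.
  rewrite big_split /= -mulr_suml sum_g mul0r add0r mulr_sumr.
  by apply: eq_bigr => x _; ring.
apply: eq_big_nat => x /andP[x1 xN].
have xr : (0 < x * r)%N by rewrite muln_gt0 x1.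
rewrite -root_sum_rec; last by rewrite prednK// nE leq_mul2r orbC -ltnS xN.
rewrite prednK// mulr_sumr; apply: eq_bigr => i _; ring.
Qed.
End Weighted.
End RootSums.

(** * Limits of sequences, and Tannery's theorem *)

Section Limits.
Variable R : realType.
Local Notation C := R[i].
Implicit Types (u v : nat -> C) (l m : C).

Definition tends u l : Prop := null_seq (fun n => u n - l).

Lemma tendsP u l : tends u l <-> (u : nat -> C^o) @ \oo --> (l : C^o).
Proof. exact: iff_sym (cvgCn u l). Qed.

Lemma tends_cst l : tends (fun=> l) l.
Proof. by move=> e e0; exists 0%N => n _; rewrite subrr normc0. Qed.

Lemma tendsD u v l m : tends u l -> tends v m -> tends (fun n => u n + v n) (l + m).
Proof.
move=> hu hv; have := null_seqD hu hv; rewrite /tends.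
by congr null_seq; apply/funext => n; ring.
Qed.

Lemma tendsM u v l m : tends u l -> tends v m -> tends (fun n => u n * v n) (l * m).
Proof. by move=> /tendsP hu /tendsP hv; apply/tendsP; exact: cvgM hu hv. Qed.

Lemma tendsV u l : l != 0 -> tends u l -> tends (fun n => (u n)^-1) l^-1.
Proof. by move=> l0 /tendsP hu; apply/tendsP; exact: cvgV hu. Qed.

Lemma tendsX u l k : tends u l -> tends (fun n => u n ^+ k) (l ^+ k).
Proof.
move=> hu; elim: k => [|k IH].
  by rewrite expr0; under eq_fun do rewrite expr0; exact: tends_cst.
by rewrite exprS; under eq_fun do rewrite exprS; exact: tendsM.
Qed.

Lemma tendsN u l : tends u l -> tends (fun n => - u n) (- l).
Proof.
move=> /null_seqN; rewrite /tends; congr null_seq.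
by apply/funext => n; rewrite opprD.
Qed.

Lemma tends_sum (I : eqType) (r : seq I) (f : I -> nat -> C) (l : I -> C) :
  (forall i, i \in r -> tends (f i) (l i)) ->
  tends (fun n => \sum_(i <- r) f i n) (\sum_(i <- r) l i).
Proof.
elim: r => [|i r IH] h.
  by rewrite big_nil; under eq_fun do rewrite big_nil; exact: tends_cst.
rewrite big_cons; under eq_fun do rewrite big_cons.
apply: tendsD; first by apply: h; rewrite mem_head.
by apply: IH => k kr; apply: h; rewrite inE kr orbT.
Qed.

Lemma tends_uniq u l m : tends u l -> tends u m -> l = m.
Proof.
move=> hu hv; apply/eqP; rewrite -subr_eq0; apply/eqP/(@null_seq_cst R).
have := null_seqD hv (null_seqN hu); congr null_seq.
by apply/funext => n; ring.
Qed.

Lemma eq_tends u v l : (forall n, u n = v n) -> tends u l -> tends v l.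
Proof. by move=> /funext ->. Qed.

(** A falling factorial of [a r] is asymptotic to a power of [a r] when [a r]
    grows. *)
Lemma tends_bin (a : nat -> nat) (b : nat -> C) (c : C) k :
  tends (fun r => (a r)%:R / b r) c -> tends (fun r => (b r)^-1) 0 ->
  tends (fun r => 'C(a r, k)%:R / b r ^+ k) (c ^+ k / k`!%:R).
Proof.
move=> ha hb.
have h : tends (fun r => (a r ^_ k)%:R / b r ^+ k) (c ^+ k).
  elim: k => [|k IH].
    by rewrite expr0; apply: (eq_tends (u := fun=> 1)) (tends_cst 1) => n;
      rewrite ffactn0 expr0 divr1.
  have h1 : tends (fun r => (a r)%:R / b r - k%:R * (b r)^-1) (c - k%:R * 0).
    exact: (tendsD ha (tendsN (tendsM (tends_cst k%:R) hb))).
  rewrite mulr0 subr0 in h1; rewrite exprSr.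
  apply: eq_tends (tendsM IH h1) => n; rewrite ffactnSr natrM exprSr invfM.
  have [kn|nk] := leqP k (a n); first by rewrite natrB//; ring.
  by rewrite ffact_small// !mul0r.
apply: (eq_tends (u := fun r => (a r ^_ k)%:R / b r ^+ k * (k`!%:R)^-1)).
  move=> n; have f0 : k`!%:R != 0 :> C by rewrite pnatr_eq0 -lt0n fact_gt0.
  by rewrite -bin_ffact natrM mulrAC mulfK.
exact: tendsM h (tends_cst _).
Qed.

Definition unit_exp (x : R) : C := cexp (0 +i* (pi *+ 2 * x)).

Lemma unit_expX x k : unit_exp x ^+ k = unit_exp (k%:R * x).
Proof.
rewrite -cexpM_nat; congr cexp; rewrite -(rmorph_nat (real_complex R)) /=.
by apply/eqP; rewrite eq_complex /=; apply/andP; split; apply/eqP; ring.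
Qed.

Lemma unit_expD x y : unit_exp (x + y) = unit_exp x * unit_exp y.
Proof.
rewrite -cexpD; congr cexp.
by apply/eqP; rewrite eq_complex /=; apply/andP; split; apply/eqP; ring.
Qed.

Lemma unit_exp1 : unit_exp 1 = 1.
Proof. by rewrite /unit_exp /cexp /= mulr1 expR0 cos2pi sin2pi !mul1r. Qed.

Lemma unit_expN x : unit_exp (- x) = (unit_exp x)^*.
Proof. by rewrite /unit_exp /cexp /= mulrN cosN sinN mulrN. Qed.

Lemma cos_lt1 (t : R) : 0 < t -> t < pi *+ 2 -> cos t < 1.
Proof.
move=> t0 t2; have -> : t = (t / 2) *+ 2 by rewrite mulr2n; field.
rewrite cos_mulr2n cos2sin2.
have : 0 < sin (t / 2) by apply: sin_gt0_pi; rewrite mulr2n in t2; lra.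
by move: (sin _) => s s0; rewrite mulr2n; nra.
Qed.

Lemma unit_exp_prim n : (0 < n)%N -> n.-primitive_root (unit_exp n%:R^-1).
Proof.
move=> n0; apply/andP; split => //; apply/forallP => i; apply/eqP.
rewrite unity_rootE unit_expX.
have nn0 : 0 < n%:R :> R by rewrite ltr0n.
have [e|ne] := eqVneq i.+1 n.
  have -> : i.+1%:R / n%:R = 1 :> R by rewrite e divff// gt_eqF.
  by rewrite unit_exp1 eqxx.
have lt : (i.+1 < n)%N by rewrite ltn_neqAle ne ltn_ord.
apply/negbTE/eqP => /(congr1 (@complex.Re R)); rewrite /unit_exp /cexp /= expR0 mul1r.
apply/eqP; rewrite lt_eqF//; apply: cos_lt1.
  by apply: mulr_gt0; [rewrite mulrn_wgt0 ?pi_gt0|rewrite divr_gt0].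
have p2 : 0 < pi *+ 2 :> R by rewrite mulrn_wgt0 ?pi_gt0.
by rewrite (gtr_pMr _ p2) ltr_pdivrMr// mul1r ltr_nat.
Qed.

(** Near 0 this is the derivative of [cexp], and away from 0 the monotonicity
    of the cosine. *)
Lemma unit_exp_lower : exists2 c : R, 0 < c &
  forall x, 0 <= x <= 2^-1 -> c * x <= normc (1 - unit_exp x).
Proof.
have [d d0 dP] := @cexp_eps R 2^-1 ltac:(by []).
have p0 : 0 < pi *+ 2 :> R by rewrite mulrn_wgt0 ?pi_gt0.
have p2 : 2 <= pi *+ 2 :> R by have := @pi_ge2 R; rewrite mulr2n; lra.
pose y := Num.min (d / (pi *+ 2) / 2) 4^-1.
have y0 : 0 < y by rewrite lt_min !divr_gt0//=.
have [y1 y2] : y <= d / (pi *+ 2) / 2 /\ y <= 4^-1 by rewrite !ge_min !lexx orbT.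
pose k := 1 - cos (pi *+ 2 * y).
have k0 : 0 < k.
  rewrite subr_gt0; apply: cos_lt1; first by rewrite mulr_gt0.
  by rewrite gtr_pMr//; lra.
exists (Num.min 1 k); first by rewrite lt_min ltr01.
move=> x /andP[x0 x1]; have [xy|yx] := ltP x y.
- have nh : normc (0 +i* (pi *+ 2 * x)) = pi *+ 2 * x.
    by rewrite /normc expr0n add0r sqrtr_sqr ger0_norm// mulr_ge0// ltW.
  have hd : normc (0 +i* (pi *+ 2 * x)) < d.
    rewrite nh mulrC -ltr_pdivlMr//; apply: lt_le_trans xy (le_trans y1 _).
    by rewrite ler_pdivrMr// ler_pMr ?divr_gt0// ler1n.
  have := dP _ hd; rewrite nh -/(unit_exp x) => h.
  have tri : normc (0 +i* (pi *+ 2 * x)) <= normc (1 - unit_exp x) + normc (unit_exp x - 1 - (0 +i* (pi *+ 2 * x))).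
    rewrite -(normcN (0 +i* (pi *+ 2 * x))); apply: le_trans (le_normcD _ _).
    by rewrite (_ : 1 - _ + _ = - (0 +i* (pi *+ 2 * x)))//; ring.
  rewrite nh in tri.
  have m1 : Num.min 1 k <= 1 by rewrite ge_min lexx.
  by move: h tri m1; move: (Num.min 1 k) (normc (1 - _)) (normc _) => a b c; nra.
- have kx : k <= normc (1 - unit_exp x).
    apply: le_trans (le_trans (ler_norm _) (ge_Re_normc _)).
    rewrite /k /unit_exp /cexp /= expR0 mul1r lerD2l lerN2.
    move: yx; rewrite le_eqVlt => /orP[/eqP ->//|yx]; apply: ltW.
    have hpi (z : R) : 0 <= z -> z <= 2^-1 -> pi *+ 2 * z \in `[0, pi].
      move=> z0 z2; rewrite in_itv /= mulr2n; have := @pi_gt0 R.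
      by move: (pi : R) => q q0; apply/andP; split; nra.
    rewrite ltr_cos ?ltr_pM2l//; apply: hpi => //; first exact: ltW.
    by apply: le_trans y2 _; lra.
  have m1 : Num.min 1 k <= k by rewrite ge_min lexx orbT.
  by move: kx m1; move: (Num.min 1 k) (normc _) => a b; nra.
Qed.

(** The tails of the sums are uniformly small, as the terms are dominated by
    those of a telescoping series. *)
Lemma tannery (f : nat -> nat -> C) (t : nat -> C) (m : nat -> nat) (V : C) (A : R) :
  (forall r j, (0 < j < m r)%N -> normc (f r j) <= A / j%:R ^+ 2) ->
  (forall j, (0 < j)%N -> tends (fun r => f r j) (t j)) ->
  (forall J, exists r0, forall r, (r0 <= r)%N -> (J <= m r)%N) ->
  tends (fun r => \sum_(1 <= j < m r) f r j) V ->
  tends (fun J => \sum_(1 <= j < J.+1) t j) V.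
Proof.
move=> fA ft mJ fV.
have A0 : 0 <= A.
  have [r0 /(_ _ (leqnn _)) h] := mJ 2%N.
  by have := fA r0 1%N h; rewrite expr1n divr1; apply: le_trans; exact: normc_ge0.
have tail r J p : (J + p < m r)%N ->
    normc (\sum_(J.+1 <= j < (J + p).+1) f r j) <= 2 * A * (J.+1%:R^-1 - (J + p).+1%:R^-1).
  elim: p => [|p IH].
    by rewrite addn0 big_geq// normc0 subrr mulr0.
  rewrite addnS => h; rewrite big_nat_recr /=; last by rewrite ltnS leq_addr.
  apply: le_trans (le_normcD _ _) _.
  apply: le_trans (lerD (IH (ltnW h)) (fA _ _ _)) _; first by rewrite h.
  have := ler_wpM2l A0 (inv_sq_telescope R (J + p)) => h2.
  apply: le_trans (lerD (lexx _) h2) _; rewrite le_eqVlt; apply/orP; left; apply/eqP; ring.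
have bnd J : normc (V - \sum_(1 <= j < J.+1) t j) <= 2 * A / J.+1%:R.
  apply/ler_addgt0Pr => e e0.
  have hs : tends (fun r => \sum_(1 <= j < J.+1) f r j) (\sum_(1 <= j < J.+1) t j).
    by apply: tends_sum => j; rewrite mem_index_iota => /andP[j0 _]; exact: ft.
  have e2 : 0 < e / 2 by rewrite divr_gt0.
  have [r1 h1] := fV _ e2; have [r2 h2] := hs _ e2; have [r3 h3] := mJ J.+1.
  pose r := maxn r1 (maxn r2 r3).
  have {}h1 := h1 r (leq_maxl _ _).
  have {}h2 := h2 r (leq_trans (leq_maxl _ _) (leq_maxr _ _)).
  have {}h3 := h3 r (leq_trans (leq_maxr _ _) (leq_maxr _ _)).
  have ht := @tail r J ((m r).-1 - J)%N.
  have mr0 : (0 < m r)%N := leq_ltn_trans (leq0n J) h3.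
  have Jm : (J <= (m r).-1)%N by rewrite -ltnS prednK.
  rewrite subnKC// prednK// leqnn in ht; have {}ht := ht isT.
  rewrite (@big_cat_nat _ _ _ J.+1)//= in h1.
  move: h1 h2 ht; set a := \sum_(1 <= j < J.+1) f r j; set b := \sum_(J.+1 <= j < m r) f r j.
  set c := \sum_(1 <= j < J.+1) t j => h1 h2 ht.
  have -> : V - c = - (a + b - V) + (a - c) + b by ring.
  apply: le_trans (le_normcD _ _) _; rewrite addrC; apply: lerD.
    apply: le_trans ht _; apply: ler_wpM2l; first by rewrite mulr_ge0.
    by rewrite lerBlDr lerDl invr_ge0.
  apply: le_trans (le_normcD _ _) _; rewrite normcN [e]splitr.
  by apply: lerD; exact: ltW.
move=> e e0; have [n0 hn] := archi_large (2 * A) e0.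
exists n0 => J nJ; rewrite normcBC; apply: le_lt_trans (bnd J) _.
rewrite ltr_pdivrMr//; apply: lt_le_trans hn _; rewrite ler_pM2l// ler_nat.
exact: leqW.
Qed.
End Limits.

(** * The values at non-positive integers as lattice sums *)

Section Lattice.
Variable R : realType.
Local Notation C := R[i].
Implicit Types (u v : nat -> C) (l m : C).

Lemma sum_fold (a : nat -> C) (m : nat) : (0 < m)%N ->
  \sum_(1 <= j < m.*2) a j = \sum_(1 <= j < m) (a j + a (m.*2 - j)%N) + a m.
Proof.
move=> m0; have m2 : (m < m.*2)%N by rewrite -addnn -[X in (X < _)%N]addn0 ltn_add2l.
rewrite (@big_cat_nat _ _ _ m)//=; last exact: ltnW.
rewrite [X in _ + X]big_ltn// big_split /= -addrA; congr (_ + _).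
rewrite addrC; congr (_ + _).
rewrite big_nat_rev /= -{1}(add1n m) -[X in \sum_(_ <= _ < X) _]addnn big_addn addnK.
apply: eq_big_nat => j /andP[j0 jm]; congr a.
by rewrite -addnn; lia.
Qed.

Variables (N : nat) (g : nat -> C).
Hypotheses (N_gt0 : (0 < N)%N) (sum_g : \sum_(1 <= x < N.+1) g x = 0).

(* An even number of nodes, so that the sums over 0 < j < nodes r can be
   folded about their middle term. *)
Let steps r := (2 * r.+1)%N.
Let nodes r := (N * steps r)%N.
Let root r : C := unit_exp (nodes r)%:R^-1.

Let nodes_gt0 r : (0 < nodes r)%N.
Proof. by rewrite muln_gt0 N_gt0. Qed.

Let nodes_neq0 r : (nodes r)%:R != 0 :> C.
Proof. by rewrite pnatr_eq0 -lt0n. Qed.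

Let nodes_large J r : (J <= r)%N -> (J < nodes r)%N.
Proof.
move=> Jr; apply: (@leq_trans (steps r)); last by rewrite leq_pmull.
by rewrite /steps mul2n -addnn; apply: leq_trans (leq_addr _ _); rewrite ltnS.
Qed.

Lemma tends_inv_nodes : tends (fun r => (nodes r)%:R^-1 : C) 0.
Proof.
move=> e e0; have [n hn] := archi_large 1 e0; exists n => r nr.
rewrite subr0 normcV normc_nat -[_^-1]mul1r ltr_pdivrMr ?ltr0n//.
apply: lt_le_trans hn _; rewrite ler_pM2l// ler_nat; exact/ltnW/nodes_large.
Qed.

(** The limit of [fourier_sum_rec] divided by [n ^ k.+1] as [n] grows. *)
Definition lattice_coef (V : nat -> C) : Prop := forall k,
  \sum_(1 <= i < k.+1) (-1) ^+ i / i`!%:R * V (k.+1 - i)%N =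
  (-1) ^+ k / k`!%:R * \sum_(1 <= x < N.+1) g x * (x%:R / N%:R) ^+ k.

(** The recurrence determines each term from the preceding ones, and its
    coefficients converge. *)
Lemma tends_fourier_sum (V : nat -> C) k : lattice_coef V -> (0 < k)%N ->
  tends (fun r => fourier_sum (nodes r) (root r) N (steps r) g k / (nodes r)%:R ^+ k) (V k).
Proof.
move=> hV; elim/ltn_ind: k => -[//|k] IH _.
have prim r : (nodes r).-primitive_root (root r) := unit_exp_prim R (nodes_gt0 r).
have c1 i : tends (fun r => 'C(nodes r, i)%:R / (nodes r)%:R ^+ i : C) (1 ^+ i / i`!%:R).
  apply: tends_bin tends_inv_nodes.
  by apply: (eq_tends (u := fun=> 1)) (tends_cst 1) => r; rewrite divff.
have c2 x : (0 < x)%N -> tends (fun r => 'C((x * steps r).-1, k.+1)%:R / (nodes r)%:R ^+ k.+1 : C)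
   ((x%:R / N%:R) ^+ k.+1 / (k.+1)`!%:R).
  move=> x0; apply: tends_bin tends_inv_nodes.
  have := tendsD (tends_cst (x%:R / N%:R : C)) (tendsN tends_inv_nodes); rewrite oppr0 addr0.
  apply: eq_tends => r.
  have xs : (0 < x * steps r)%N by rewrite muln_gt0 x0.
  rewrite -subn1 natrB// mulrBl; congr (_ - _); last by rewrite mul1r.
  have s0 : (steps r)%:R != 0 :> C by rewrite pnatr_eq0.
  have N0 : N%:R != 0 :> C by rewrite pnatr_eq0 -lt0n.
  by rewrite /nodes (natrM _ x) (natrM _ N); move: (steps r)%:R s0 => y y0; field; rewrite y0 N0.
pose U r i := fourier_sum (nodes r) (root r) N (steps r) g i.
have Ueq r : U r k.+1 / (nodes r)%:R ^+ k.+1 =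
    \sum_(2 <= i < k.+2) 'C(nodes r, i)%:R / (nodes r)%:R ^+ i * (-1) ^+ i *
      (U r (k.+2 - i)%N / (nodes r)%:R ^+ (k.+2 - i)) -
    (-1) ^+ k.+1 * \sum_(1 <= x < N.+1) g x * ('C((x * steps r).-1, k.+1)%:R / (nodes r)%:R ^+ k.+1).
  have := fourier_sum_rec (prim r) (erefl (nodes r)) sum_g k.+1.
  rewrite big_ltn// subn1 /= bin1 expr1 -/(U r k.+1).
  have n0 := nodes_neq0 r; move: ((nodes r)%:R : C) n0 => n n0.
  set S := \sum_(2 <= i < k.+2) _; set T := \sum_(1 <= x < N.+1) _ => E.
  have -> : U r k.+1 / n ^+ k.+1 = S / n ^+ k.+2 - (-1) ^+ k.+1 * (T / n ^+ k.+1).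
    have nk : n ^+ k != 0 by rewrite expf_neq0.
    have {}E : S = n * U r k.+1 + n * (-1) ^+ k.+1 * T by rewrite -E; ring.
    by rewrite E !exprS; field; rewrite n0 nk.
  congr (_ - _ * _); last by rewrite mulr_suml; apply: eq_bigr => x _; rewrite mulrA.
  rewrite mulr_suml; apply: eq_big_nat => i /andP[_ ik].
  have -> : n ^+ k.+2 = n ^+ i * n ^+ (k.+2 - i) by rewrite -exprD subnKC// ltnW.
  rewrite -[fourier_sum _ _ _ _ _ _]/(U r (k.+2 - i)%N).
  by move: (n ^+ i) (n ^+ (k.+2 - i)) (expf_neq0 i n0) (expf_neq0 (k.+2 - i) n0) => x y x0 y0;
    field; rewrite x0 y0.
have -> : V k.+1 = \sum_(2 <= i < k.+2) (1 ^+ i / i`!%:R) * (-1) ^+ i * V (k.+2 - i)%N -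
    (-1) ^+ k.+1 * \sum_(1 <= x < N.+1) g x * ((x%:R / N%:R) ^+ k.+1 / (k.+1)`!%:R).
  have := hV k.+1; rewrite big_ltn// subn1 /= expr1 -[1`!]/1%N divr1 mulN1r.
  set S := \sum_(2 <= i < k.+2) _ => E.
  have -> : \sum_(2 <= i < k.+2) 1 ^+ i / i`!%:R * (-1) ^+ i * V (k.+2 - i)%N = S.
    by apply: eq_bigr => i _; rewrite expr1n mul1r [_ / _]mulrC.
  under eq_bigr do rewrite mulrA; rewrite -mulr_suml mulrCA mulrC.
  by rewrite -E; ring.
apply: (eq_tends (fun r => esym (Ueq r))).
apply: tendsD.
  apply: tends_sum => i; rewrite mem_index_iota => /andP[i2 ik].
  apply: tendsM; first exact: tendsM (c1 i) (tends_cst _).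
  apply: IH; last by rewrite subn_gt0.
  by rewrite -[X in (_ < X)%N](subn1 k.+2) ltn_sub2l// ltnS.
apply: tendsN; apply: tendsM; first exact: tends_cst.
apply: tends_sum => x; rewrite mem_index_iota => /andP[x0 _].
exact: tendsM (tends_cst _) (c2 x x0).
Qed.

Let fhat j := finite_fourier N g (unit_exp N%:R^-1) j.

Let rootX r j : root r ^+ j = unit_exp (j%:R / (nodes r)%:R).
Proof. exact: unit_expX. Qed.

Let root_steps r : root r ^+ steps r = unit_exp N%:R^-1.
Proof.
rewrite rootX /nodes natrM invfM mulrCA mulfV ?mulr1// pnatr_eq0//.
Qed.

Lemma tends_one_sub_root j :
  tends (fun r => (nodes r)%:R * (1 - root r ^+ j)) (- (0 +i* (pi *+ 2 * j%:R))).
Proof.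
move=> e e0; pose a : R := pi *+ 2 * j%:R.
have p0 : 0 <= pi *+ 2 :> R by rewrite mulrn_wge0 ?pi_ge0.
have a0 : 0 <= a by apply: mulr_ge0.
have na (x : R) : 0 <= x -> normc (0 +i* x) = x.
  by move=> x0; rewrite /normc expr0n add0r sqrtr_sqr ger0_norm.
have ea : 0 < e / (a + 1) by rewrite divr_gt0// ltr_wpDl.
have [d d0 dP] := cexp_eps ea.
have [n hn] := archi_large a d0; exists n => r nr.
have n0 : 0 < (nodes r)%:R :> R by rewrite ltr0n.
rewrite rootX; set h : C := 0 +i* (pi *+ 2 * (j%:R / (nodes r)%:R)).
have nh : normc h = a / (nodes r)%:R.
  by rewrite /h na /a ?mulrA//; apply: divr_ge0 => //; exact: ltW.
have hd : normc h < d.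
  rewrite nh ltr_pdivrMr//; apply: lt_le_trans hn _; rewrite ler_pM2l// ler_nat.
  exact/ltnW/nodes_large.
have := dP _ hd; rewrite -/(unit_exp (j%:R / (nodes r)%:R)) nh => H.
have -> : (nodes r)%:R * (1 - unit_exp (j%:R / (nodes r)%:R)) - - (0 +i* a) =
    - ((nodes r)%:R * (unit_exp (j%:R / (nodes r)%:R) - 1 - h)).
  have -> : 0 +i* a = (nodes r)%:R * h.
    rewrite -(rmorph_nat (real_complex R)) /h /=; apply/eqP; rewrite eq_complex /=.
    by apply/andP; split; apply/eqP; rewrite /a; field; rewrite gt_eqF.
  ring.
rewrite normcN normcM normc_nat.
apply: le_lt_trans (ler_wpM2l (ltW n0) H) _.
have -> : (nodes r)%:R * (e / (a + 1) * (a / (nodes r)%:R)) = e * (a / (a + 1)).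
  by field; rewrite !gt_eqF// ltr_wpDl.
rewrite gtr_pMr// ltr_pdivrMr ?mul1r ?ltrDl//; exact: ltr_wpDl.
Qed.

Lemma one_sub_root_lower : exists2 c : R, 0 < c &
  forall r j, (j.*2 <= nodes r)%N -> c * j%:R <= normc ((nodes r)%:R * (1 - root r ^+ j)).
Proof.
have [c c0 hc] := unit_exp_lower R; exists c => // r j jn.
have n0 : 0 < (nodes r)%:R :> R by rewrite ltr0n.
rewrite rootX normcM normc_nat.
have -> : c * j%:R = (nodes r)%:R * (c * (j%:R / (nodes r)%:R)).
  by field; rewrite gt_eqF.
rewrite ler_pM2l//; apply: hc; rewrite divr_ge0//= ler_pdivrMr//.
have : (j.*2%:R : R) <= (nodes r)%:R by rewrite ler_nat.
by rewrite -mul2n natrM; lra.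
Qed.

(** The terms of index [j] and [n - j] of [fourier_sum] have conjugate
    denominators, whose limits are opposite; by the parity of [g] and [k] both
    terms tend to the same limit.
    They are dominated by a multiple of [j ^ (- 2)] because [1 - e(j / n)] is
    at least of the order of [j / n] in the first half of the range. *)
Lemma lattice_formula (V : nat -> C) k : lattice_coef V -> (1 < k)%N ->
  (forall q j, (j <= N * q)%N -> fhat (N * q - j) = (-1) ^+ k * fhat j) ->
  tends (fun J => \sum_(1 <= j < J.+1) 2%:R * fhat j / (- (0 +i* (pi *+ 2 * j%:R))) ^+ k) (V k).
Proof.
move=> hV k1 sym.
pose m r := (N * r.+1)%N.
have m2 r : nodes r = (m r).*2 by rewrite /nodes /steps /m -mul2n mulnCA.
have m0 r : (0 < m r)%N by rewrite muln_gt0 N_gt0.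
pose z r j : C := (nodes r)%:R * (1 - root r ^+ j).
pose h r j : C := fhat j / z r j ^+ k.
have zJ r j : (j <= nodes r)%N -> z r (nodes r - j)%N = (z r j)^*.
  move=> jn; rewrite /z (rmorphM (@Num.conj R[i])) (rmorphB (@Num.conj R[i])) (rmorph1 (@Num.conj R[i])).
  rewrite (rmorph_nat (@Num.conj R[i])); congr (_ * (_ - _)).
  rewrite !rootX; transitivity (unit_exp (- (j%:R / (nodes r)%:R)) : C); last exact: unit_expN.
  rewrite natrB// mulrBl divff ?pnatr_eq0 -?lt0n//.
  by rewrite unit_expD unit_exp1 mul1r.
have fJ r j : (j <= nodes r)%N -> fhat (nodes r - j) = (-1) ^+ k * fhat j by exact: sym.
have [c c0 hc] := one_sub_root_lower.
pose G := \sum_(1 <= x < N.+1) normc (g x).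
have fG j : normc (fhat j) <= G.
  apply: le_trans (le_normc_sum _ _ _) _; apply: ler_sum => x _.
  rewrite normcM normcX /unit_exp normc_cexp /= expR0 expr1n mulr1 //.
have G0 : 0 <= G := le_trans (normc_ge0 _) (fG 0%N).
have hb r j : (0 < j)%N -> (j.*2 <= nodes r)%N -> normc (h r j) <= G / c ^+ k / j%:R ^+ 2.
  move=> j0 jn; rewrite /h normcM normcV normcX -mulrA.
  apply: ler_pM; rewrite ?normc_ge0 ?invr_ge0 ?exprn_ge0 ?normc_ge0//.
  have cj : 0 < c * j%:R by rewrite mulr_gt0 ?ltr0n.
  have jk : 0 < c ^+ k * j%:R ^+ 2 :> R by rewrite mulr_gt0 ?exprn_gt0 ?ltr0n.
  rewrite -invfM lef_pV2 ?posrE ?exprn_gt0//; last by apply: lt_le_trans cj (hc _ _ jn).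
  apply: le_trans (_ : c ^+ k * j%:R ^+ 2 <= (c * j%:R) ^+ k) _.
    by rewrite exprMn ler_pM2l ?exprn_gt0// ler_weXn2l// ler1n.
  apply: lerXn2r; [by rewrite nnegrE ltW|by rewrite nnegrE normc_ge0|exact: hc].
pose f r j := h r j + h r (nodes r - j)%N.
have hJ r j : (j <= nodes r)%N -> normc (h r (nodes r - j)%N) = normc (h r j).
  move=> jn; rewrite /h fJ// zJ// !normcM !normcV !normcX normc_conj normcN normc1.
  by rewrite expr1n mul1r.
apply: (@tannery R f _ m (V k) (2 * (G / c ^+ k))).
- move=> r j /andP[j0 jm]; have j2 : (j.*2 <= nodes r)%N by rewrite m2 leq_double ltnW.
  have jn : (j <= nodes r)%N by apply: leq_trans j2; rewrite -addnn leq_addr.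
  apply: le_trans (le_normcD _ _) _; rewrite hJ//.
  by have := hb r j j0 j2; move: (normc _) => x hx; rewrite -mulrA; lra.
- move=> j j0; pose y : C := - (0 +i* (pi *+ 2 * j%:R)).
  have y0 : y != 0.
    rewrite oppr_eq0 eq_complex /= eqxx /= mulf_neq0 ?pnatr_eq0 -?lt0n//.
    by rewrite gt_eqF// mulrn_wgt0 ?pi_gt0.
  have t1 : tends (fun r => h r j) (fhat j * (y ^+ k)^-1).
    apply: tendsM (tends_cst _) (tendsV _ (tendsX k (tends_one_sub_root j))).
    by rewrite expf_neq0.
  have tJ u l : tends u l -> tends (fun n => (u n)^*) (l^*).
    by move=> hu e /hu[n0 hn]; exists n0 => n /hn; rewrite -rmorphB /= normc_conj.
  have yJ : y^* = - y.
    rewrite -[LHS]/(conjc y) /y; apply/eqP; rewrite eq_complex.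
    by apply/andP; split; apply/eqP; rewrite /= ?oppr0.
  have t2 : tends (fun r => (-1) ^+ k * fhat j * ((z r j)^* ^+ k)^-1) ((-1) ^+ k * fhat j * ((- y) ^+ k)^-1).
    rewrite -yJ; apply: tendsM (tends_cst _) (tendsV _ (tendsX k (tJ _ _ (tends_one_sub_root j)))).
    by rewrite yJ expf_neq0// oppr_eq0.
  have -> : 2%:R * fhat j / y ^+ k = fhat j * (y ^+ k)^-1 + (-1) ^+ k * fhat j * ((- y) ^+ k)^-1.
    rewrite (exprNn y k) invfM invr_sign.
    rewrite [X in _ = _ + X](_ : _ = ((-1) ^+ k) ^+ 2 * (fhat j / y ^+ k)); last by ring.
    by rewrite sqrr_sign; ring.
  move=> e e0; have [n0 hn] := tendsD t1 t2 e0; exists (maxn n0 j) => r.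
  rewrite geq_max => /andP[/hn + jr]; rewrite /f {3}/h fJ ?zJ//;
    by apply/ltnW/nodes_large.
- move=> J; exists J => r Jr; rewrite /m; apply: leq_trans (leq_pmull _ N_gt0).
  exact: leqW.
- have hm : tends (fun r => h r (m r)) 0.
    move=> e e0; have [n hn] := archi_large (G / c ^+ k) e0; exists n => r nr.
    rewrite subr0; apply: le_lt_trans (hb r (m r) (m0 r) _) _; first by rewrite m2.
    have nm : (n <= m r)%N.
      by apply: leq_trans nr _; apply: leq_trans (leqnSn r) _; rewrite leq_pmull.
    rewrite ltr_pdivrMr ?exprn_gt0 ?ltr0n//; apply: lt_le_trans hn _.
    rewrite ler_pM2l// -natrX ler_nat; apply: leq_trans nm _.
    by rewrite -[X in (X <= _)%N]expn1 leq_pexp2l.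
  have := tendsD (tends_fourier_sum hV (ltnW k1)) (tendsN hm); rewrite oppr0 addr0.
  apply: eq_tends => r; rewrite /fourier_sum mulr_suml.
  rewrite [in X in X - _]m2 (_ : \sum_(1 <= j < (m r).*2) _ = \sum_(1 <= j < (m r).*2) h r j).
    by rewrite sum_fold// addrK; apply: eq_bigr => j _; rewrite /f m2.
  apply: eq_big_nat => j _; rewrite /h /z root_steps exprMn invfM mulrA mulrAC.
  by rewrite -m2.
Qed.
End Lattice.

(** * The Gamma integral on the real line *)

Section RealGamma.
Variable R : realType.
Local Notation mu := (@lebesgue_measure R).

Definition gamma_density (x t : R) : R := t `^ (x - 1) * expR (- t).

Definition ext_gamma (x : R) : \bar R :=
  (\int[mu]_(t in `[0%R, +oo[) (gamma_density x t)%:E)%E.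

Lemma continuous_expN (b : R) : continuous (fun t : R => expR (- (b * t))).
Proof.
move=> t; apply: continuous_comp; last exact: continuous_expR.
by apply: continuousN; apply: continuousM; [exact: cvg_cst|exact: cvg_id].
Qed.

Lemma integral_exp (b c : R) : 0 < b -> 0 <= c ->
  (\int[mu]_(t in `[0%R, +oo[) (c * b * expR (- (b * t)))%:E = c%:E)%E.
Proof.
move=> b0 c0.
have dF (t : R) : is_derive t 1 (fun t : R => - (c * expR (- (b * t)))) (c * b * expR (- (b * t))).
  apply: is_derive_eq.
  by rewrite /GRing.scale /=; ring.
have cont : continuous (fun t : R => c * b * expR (- (b * t))).
  by move=> t; apply: cvgM; [exact: cvg_cst|exact: continuous_expN].
rewrite (@ge0_continuous_FTC2y R _ (fun t => - (c * expR (- (b * t)))) 0 0).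
- by rewrite mulr0 oppr0 expR0 mulr1 EFinN sub0e oppeK.
- by move=> t _; rewrite mulr_ge0 ?expR_ge0// mulr_ge0// ltW.
- by apply: continuous_subspaceT; exact: cont.
- rewrite -oppr0; apply: cvgN; rewrite -(mulr0 c); apply: cvgM; first exact: cvg_cst.
  apply: (@cvg_comp _ _ _ (fun t => b * t) (fun t => expR (- t)) _ (pinfty_nbhs R)).
    exact: gt0_cvgMry.
  exact: cvgr_expR.
- by move=> t _; case: (dF t).
- apply: cvg_at_right_filter; apply: cvgN; apply: cvgM; first exact: cvg_cst.
  exact: continuous_expN.
- by move=> t _; rewrite derive1E; case: (dF t).
Qed.

Lemma powR_exp_cvg0 (x : R) : 0 <= x -> t `^ x * expR (- t) @[t --> +oo] --> 0.
Proof.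
move=> x0; pose n := Num.bound x.
have xn : x <= n%:R by rewrite ltW// archi_boundP.
apply/cvgrPdist_lt => e e0; near=> t.
have t1 : 1 <= t by near: t; exact: nbhs_pinfty_ge.
have t0 : 0 < t := lt_le_trans ltr01 t1.
rewrite sub0r normrN ger0_norm ?mulr_ge0 ?powR_ge0 ?expR_ge0//.
have h1 : t `^ x <= t ^+ n by rewrite -powR_mulrn; [apply: ler_powR|exact: ltW].
have h2 : t ^+ n.+1 / n.+1`!%:R <= expR t.
  by apply: le_trans (expR_ge1Dxn n (ltW t0)); rewrite lerDr.
have f0 : 0 < n.+1`!%:R :> R by rewrite ltr0n fact_gt0.
apply: le_lt_trans (_ : n.+1`!%:R / t < e).
  rewrite expRN ler_pdivrMr ?expR_gt0//; apply: le_trans h1 _.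
  rewrite -ler_pdivrMl ?divr_gt0//; apply: le_trans h2.
  by rewrite invf_div mulrAC exprS.
rewrite ltr_pdivrMr// mulrC -ltr_pdivrMr//.
by near: t; apply: nbhs_pinfty_gt; exact: num_real.
Unshelve. all: by end_near. Qed.

Lemma gamma_density_ge0 x t : 0 <= gamma_density x t.
Proof. by rewrite mulr_ge0 ?powR_ge0 ?expR_ge0. Qed.

Lemma measurable_expN : measurable_fun setT (fun t : R => expR (- t)).
Proof.
apply: continuous_measurable_fun => t.
by apply: continuous_comp; [exact: continuousN|exact: continuous_expR].
Qed.

Lemma measurable_gamma_density x (D : set R) : measurable_fun D (gamma_density x).
Proof.
apply: measurable_funTS; apply: measurable_funM; first exact: measurable_powR.
exact: measurable_expN.
Qed.

Lemma measurable_ext_gamma_density x (D : set R) :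
  measurable_fun D (fun t => (gamma_density x t)%:E).
Proof. by apply/measurable_EFinP; exact: measurable_gamma_density. Qed.

Lemma powR_right0 (x : R) : 0 < x -> (fun t : R => t `^ x) @ 0^'+ --> 0 `^ x.
Proof. by move=> x0; rewrite powR0 ?gt_eqF//; exact: powR_cvg0. Qed.

Lemma powR_continuous (x t : R) : 0 < t -> {for t, continuous (fun t : R => t `^ x)}.
Proof.
move=> t0; apply: differentiable_continuous; apply/derivable1_diffP.
by have [] := is_derive1_powR x t0.
Qed.

(** The fundamental theorem of calculus on a half-line is used for a function
    of constant sign. The derivative of [- t ^ x * exp (- t)] changes sign at
    [x]; adding [c * exp (- t)] with [c = x ^ x] makes it non-negative. The
    values are extended reals, which spares the integrability until
    [ext_gamma_fin]. *)
Lemma ext_gamma_rec x : 1 < x -> (ext_gamma (x + 1) = x%:E * ext_gamma x)%E.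
Proof.
move=> x1; have x0 : 0 < x := lt_trans ltr01 x1.
pose c := x `^ x; have c0 : 0 <= c := powR_ge0 _ _.
pose f (t : R) := (t `^ x + c - x * t `^ (x - 1)) * expR (- t).
have f0 t : 0 <= t -> 0 <= f t.
  move=> t0; rewrite mulr_ge0 ?expR_ge0// subr_ge0.
  have [xt|tx] := leP x t.
    apply: le_trans (_ : t `^ x <= _); last by rewrite lerDl.
    by rewrite -(mulr_powRB1 t0 x0); apply: ler_wpM2r; rewrite ?powR_ge0.
  apply: le_trans (_ : c <= _); last by rewrite lerDr powR_ge0.
  rewrite /c -(mulr_powRB1 (ltW x0) x0); apply: ler_wpM2l; first exact: ltW.
  by apply: ge0_ler_powR; rewrite ?nnegrE ?subr_ge0 ?(ltW x0) ?(ltW x1) ?(ltW tx).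
pose F (t : R) := - ((t `^ x + c) * expR (- t)).
have cE (t : R) : {for t, continuous (fun t : R => expR (- t))}.
  by apply: continuous_comp; [exact: continuousN|exact: continuous_expR].
have dF (t : R) : 0 < t -> is_derive t 1 F (f t).
  move=> t0; have d1 := is_derive1_powR x t0.
  apply: is_derive_eq.
  by rewrite /f /GRing.scale /=; ring.
have If : (\int[mu]_(t in `[0%R, +oo[) (f t)%:E = c%:E)%E.
  rewrite (@ge0_continuous_FTC2y R f F 0 0).
  - by rewrite -EFinB sub0r /F opprK powR0 ?gt_eqF// add0r oppr0 expR0 mulr1.
  - exact: f0.
  - apply/continuous_within_itvcyP; split.
      move=> t; rewrite in_itv /= andbT => t0; apply: cvgM; last exact: cE.
      apply: cvgB; first apply: cvgD.
      + exact: powR_continuous.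
      + exact: cvg_cst.
      + by apply: cvgM; [exact: cvg_cst|exact: powR_continuous].
    apply: cvgM; last by apply: cvg_at_right_filter; exact: cE.
    apply: cvgB; first apply: cvgD.
    + exact: powR_right0.
    + exact: cvg_cst.
    + by apply: cvgM; [exact: cvg_cst|apply: powR_right0; rewrite subr_gt0].
  - rewrite -oppr0; apply: cvgN.
    under eq_fun do rewrite mulrDl; rewrite -(addr0 0); apply: cvgD.
      exact: powR_exp_cvg0 (ltW x0).
    by rewrite -(mulr0 c); apply: cvgM; [exact: cvg_cst|exact: cvgr_expR].
  - by move=> t t0; case: (dF t t0).
  - apply: cvgN; apply: cvgM; last by apply: cvg_at_right_filter; exact: cE.
    by apply: cvgD; [exact: powR_right0|exact: cvg_cst].
  - by move=> t; rewrite in_itv /= andbT => t0; rewrite derive1E; case: (dF t t0).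
have mf : measurable_fun (`[0, +oo[ : set R) f.
  apply: measurable_funTS; apply: measurable_funM.
    apply: measurable_funB; first by apply: measurable_funD; [exact: measurable_powR|exact: measurable_cst].
    by apply: measurable_funM; [exact: measurable_cst|exact: measurable_powR].
  exact: measurable_expN.
have mexp : measurable_fun (`[0, +oo[ : set R) (fun t : R => c * 1 * expR (- (1 * t))).
  apply: measurable_funTS; apply: measurable_funM; first exact: measurable_cst.
  by apply: continuous_measurable_fun; exact: continuous_expN.
have E : (c%:E + x%:E * ext_gamma x = c%:E + ext_gamma (x + 1))%E.
  rewrite -{1}If -{1}(@integral_exp 1 c)// /ext_gamma -ge0_integralZl_EFin ?ltW//=.
  - rewrite -ge0_integralD//=.
    + rewrite -[RHS]ge0_integralD//=.
      * apply: eq_integral => t; rewrite inE/= in_itv /= andbT => t0.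
        rewrite -!EFinM -!EFinD; congr EFin; rewrite /f /gamma_density addrK mul1r.
        by ring.
      * by move=> t _; rewrite lee_fin !mulr_ge0 ?expR_ge0.
      * exact/measurable_EFinP.
      * by move=> t _; rewrite lee_fin gamma_density_ge0.
      * exact: measurable_ext_gamma_density.
    + by move=> t; rewrite in_itv /= andbT => t0; rewrite lee_fin f0.
    + exact/measurable_EFinP.
    + by move=> t _; rewrite -EFinM lee_fin mulr_ge0 ?gamma_density_ge0// ltW.
    + by apply: measurable_funeM; exact: measurable_ext_gamma_density.
  - by move=> t _; rewrite lee_fin gamma_density_ge0.
  - exact: measurable_ext_gamma_density.
by move/(congr1 (fun z => z - c%:E)%E) : E; rewrite !(addeC c%:E) !addeK.
Qed.

Lemma ext_gamma_pos x : 1 < x -> (0 < ext_gamma x)%E.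
Proof.
move=> x1; apply: lt_le_trans (_ : (\int[mu]_(t in `[1%R, 2%R]) (cst (expR (- 2))%:E t) <= _)%E).
  rewrite integral_cst//= lebesgue_measure_itv/= lte_fin ltr1n /= -EFinD.
  by rewrite mule_gt0 ?lte_fin ?expR_gt0//; lra.
apply: le_trans (_ : (_ <= \int[mu]_(t in `[1%R, 2%R]) (gamma_density x t)%:E)%E) _.
  apply: ge0_le_integral => //=.
    - exact: measurable_ext_gamma_density.
  - move=> t; rewrite in_itv /= => /andP[t1 t2]; rewrite lee_fin.
    rewrite -[leLHS]mul1r; apply: ler_pM; rewrite ?expR_ge0//.
      have := @ler_powR R t t1 0 (x - 1); rewrite powRr0; apply.
      by rewrite subr_ge0 ltW.
    by rewrite ler_expR lerN2.
apply: ge0_subset_integral => //=.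
- exact: measurable_ext_gamma_density.
- by move=> t _; rewrite lee_fin gamma_density_ge0.
- move=> t; rewrite /= !in_itv /= andbT => /andP[t1 _]; exact: le_trans t1.
Qed.

(** For [1 < x <= 2] the power is at most [1 + t], hence at most twice
    [exp (t / 2)]. *)
Lemma ext_gamma_fin_small x : 1 < x -> x <= 2 -> (ext_gamma x < +oo)%E.
Proof.
move=> x1 x2; apply: le_lt_trans (ltry 4).
rewrite -(@integral_exp 2^-1 4)//; apply: ge0_le_integral => //=.
- by move=> t _; rewrite lee_fin gamma_density_ge0.
- exact: measurable_ext_gamma_density.
- apply/measurable_EFinP/measurable_funTS; apply: measurable_funM; first exact: measurable_cst.
  by apply: continuous_measurable_fun; exact: continuous_expN.
- move=> t; rewrite in_itv /= andbT => t0; rewrite lee_fin /gamma_density.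
  have e1 : expR (- t) = expR (- (2^-1 * t)) * expR (- (2^-1 * t)).
    by rewrite -expRD; congr expR; field.
  rewrite e1 mulrA; apply: ler_wpM2r; first exact: expR_ge0.
  rewrite expRN ler_pdivrMr ?expR_gt0//.
  have h : t `^ (x - 1) <= 1 + t.
    have [t1|t1] := leP 1 t.
      apply: le_trans (ler1_powR t1 _) _; first by lra.
      by rewrite lerDr.
    have [->|tn0] := eqVneq t 0; first by rewrite powR0 ?addr0// gt_eqF// subr_gt0.
    have tp : 0 < t by rewrite lt_neqAle eq_sym tn0.
    apply: le_trans (_ : 1 <= _); last by rewrite lerDl.
    have t01 : 0 < t <= 1 by rewrite tp ltW.
    by have := @ger_powR R t t01 0 (x - 1); rewrite powRr0; apply; rewrite subr_ge0 ltW.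
  by have := expR_ge1Dx (2^-1 * t); move: h; lra.
Qed.

Lemma ext_gamma_fin x : 1 < x -> (ext_gamma x < +oo)%E.
Proof.
move=> x1; have [n hn] : exists n : nat, x <= n.+2%:R.
  by exists (Num.bound x); apply: ltW; apply: lt_le_trans (archi_boundP _) _; rewrite ?ler_nat; lra || lia.
elim: n x x1 hn => [|n IH] x x1 xn; first exact: ext_gamma_fin_small.
have [x2|x2] := leP x 2; first exact: ext_gamma_fin_small.
have x3 : 1 < x - 1 by lra.
have := ext_gamma_rec x3; rewrite subrK => ->.
rewrite lte_mul_pinfty ?lee_fin//; first lra.
by apply: IH => //; move: xn; rewrite -natr1; lra.
Qed.

Definition real_gamma x := fine (ext_gamma x).

Lemma real_gamma_gt0 x : 1 < x -> 0 < real_gamma x.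
Proof. by move=> x1; apply: fine_gt0; rewrite ext_gamma_pos// ext_gamma_fin. Qed.

Lemma real_gamma_rec x : 1 < x -> real_gamma (x + 1) = x * real_gamma x.
Proof.
move=> x1; rewrite /real_gamma ext_gamma_rec// fineM//.
by rewrite ge0_fin_numE ?ext_gamma_fin// ltW// ext_gamma_pos.
Qed.

Lemma Gamma_integral_real x : 1 < x -> Gamma_integral x%:C = (real_gamma x)%:C.
Proof.
move=> x1; rewrite /Gamma_integral.
have E (t : R) : cpow t (x%:C - 1) * (expR (- t))%:C = (expR ((x - 1) * ln t) * expR (- t))%:C.
  by rewrite /cpow -(rmorph1 (real_complex R)) -rmorphB -rmorphM cexp_real -rmorphM.
have -> : \int[mu]_(t in `]0, +oo[) complex.Re (cpow t (x%:C - 1) * (expR (- t))%:C) = real_gamma x.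
  rewrite /real_gamma /ext_gamma -integral_itv_obnd_cbnd; last first.
    exact: measurable_ext_gamma_density.
  apply: eq_Rintegral => t; rewrite E inE /= in_itv /= andbT => t0.
  by rewrite /gamma_density /powR gt_eqF.
have -> : \int[mu]_(t in `]0, +oo[) complex.Im (cpow t (x%:C - 1) * (expR (- t))%:C) = 0.
  rewrite (@eq_Rintegral _ _ _ _ _ (cst 0)); last by move=> t _; rewrite E.
  by rewrite Rintegral_cst//= mul0r.
by [].
Qed.

Lemma Gamma_real x : 1 < x -> Gamma x%:C = (real_gamma x)%:C.
Proof.
move=> x1; rewrite /Gamma /= (lt_trans ltr01 x1) /= addr0 big_ord0 divr1.
exact: Gamma_integral_real.
Qed.
End RealGamma.

(** * Dirichlet series and their coefficients *)

Section Analytic.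
Variable R : realType.
Local Notation C := R[i].

Lemma derivable_local_eq (F G : C -> C) z (d : R) : 0 < d ->
  (forall w, normc (w - z) < d -> F w = G w) ->
  derivable (G : C^o -> C^o) z 1 -> derivable (F : C^o -> C^o) z 1.
Proof.
move=> d0 FG /derivable_epsP[l hl]; apply/derivable_epsP; exists l => e e0.
have [d1 d10 dP] := hl _ e0; exists (Num.min d d1); first by rewrite lt_min d0.
move=> h; rewrite lt_min => /andP[hd hd1]; rewrite !FG ?subrr ?normc0//; first exact: dP.
by rewrite addrC addKr.
Qed.

Lemma holomorphic_derivable (F : C -> C) z : holomorphic_at F z ->
  derivable (F : C^o -> C^o) z 1.
Proof. by move=> /nbhs_singleton. Qed.

(** The value of a continuation at the removable singularity 1 is arbitrary,
    so it has to be corrected. *)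
Lemma entire_extension (L : C -> C) : (forall s, s != 1 -> holomorphic_at L s) ->
  regular_at L 1 -> exists2 F : C -> C, entire F & forall s, s != 1 -> F s = L s.
Proof.
move=> hL [h [hol hh]]; exists (fun s => if s == 1 then h 1 else L s); last first.
  by move=> s /negPf ->.
split=> z; have [->|z1] := eqVneq z 1.
- have [d d0 dP] := nearC_punctured hh.
  apply: (derivable_local_eq d0 (G := h)); last exact: holomorphic_derivable.
  by move=> w wd; case: eqP => [->//|/eqP w1]; rewrite dP.
- have d0 : 0 < normc (z - 1) by rewrite normc_gt0 subr_eq0.
  apply: (derivable_local_eq d0 (G := L)); last exact/holomorphic_derivable/hL.
  move=> w wd; case: eqP => // w1; move: wd.
  by rewrite w1 normcBC ltxx.
Qed.

Lemma tends_derivable (F : C -> C) z (u : nat -> C) :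
  derivable (F : C^o -> C^o) z 1 -> tends u z -> tends (fun n => F (u n)) (F z).
Proof.
move=> /derivable1_diffP/differentiable_continuous/cvgC h hu e e0.
have /nearC[d d0 dP] := h _ e0; have [n0 hn] := hu _ d0.
by exists n0 => n /hn; exact: dP.
Qed.

Lemma tends_prod (I : Type) (r : seq I) (f : I -> nat -> C) (l : I -> C) :
  (forall i, tends (f i) (l i)) ->
  tends (fun n => \prod_(i <- r) f i n) (\prod_(i <- r) l i).
Proof.
move=> h; elim: r => [|i r IH].
  by rewrite big_nil; under eq_fun do rewrite big_nil; exact: tends_cst.
rewrite big_cons; under eq_fun do rewrite big_cons.
exact: tendsM.
Qed.

(** In a Dirichlet series with bounded coefficients that starts at index [n],
    the first term dominates the others at large arguments: their sum,
    multiplied by [n ^ k], is bounded by a multiple of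
    [(n / (n + 1)) ^ k]. *)
Lemma dirichlet_lead (b : nat -> C) (B : R) (n : nat) (e : nat -> nat) (T : nat -> C) :
  (forall j, normc (b j) <= B) -> (0 < n)%N -> (forall j, (0 < j < n)%N -> b j = 0) ->
  (forall q, (q <= e q)%N) ->
  (forall q, tends (fun J => \sum_(1 <= j < J.+1) b j / j%:R ^+ (e q).+2) (T q)) ->
  tends (fun q => n%:R ^+ (e q).+2 * T q) (b n).
Proof.
move=> bB n0 bz eq hT.
have B0 : 0 <= B := le_trans (normc_ge0 _) (bB 0%N).
have nR : 0 < n%:R :> R by rewrite ltr0n.
pose A := 2 * B * n%:R ^+ 2 : R.
have A0 : 0 <= A by rewrite !mulr_ge0 ?exprn_ge0 ?ler0n.
have main q : normc (n%:R ^+ (e q).+2 * T q - b n) <= A * (n%:R / n.+1%:R) ^+ e q.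
  set k := (e q).+2.
  have tail p : normc (\sum_(n.+1 <= j < n.+1 + p) n%:R ^+ k * (b j / j%:R ^+ k)) <=
      A * (n%:R / n.+1%:R) ^+ e q * (n.+1%:R^-1 - (n.+1 + p)%:R^-1).
    elim: p => [|p IH]; first by rewrite addn0 big_geq// normc0 subrr mulr0.
    rewrite addnS big_nat_recr /=; last by rewrite leq_addr.
    apply: le_trans (le_normcD _ _) _.
    have jR : 0 < (n.+1 + p)%:R :> R by rewrite ltr0n addSn.
    have t1 : normc (n%:R ^+ k * (b (n.+1 + p)%N / (n.+1 + p)%:R ^+ k)) <=
       (n%:R / n.+1%:R) ^+ e q * (B * n%:R ^+ 2) * ((n.+1 + p)%:R ^+ 2)^-1.
      rewrite normcM normcX (normcM (b _)) normcV normcX !normc_nat.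
      have -> : n%:R ^+ k * (normc (b (n.+1 + p)%N) / (n.+1 + p)%:R ^+ k) =
        (n%:R / (n.+1 + p)%:R) ^+ e q * (normc (b (n.+1 + p)%N) * n%:R ^+ 2) / (n.+1 + p)%:R ^+ 2.
        rewrite /k !exprS exprMn exprVn expr0.
        have h2 : (n.+1 + p)%:R ^+ e q != 0 :> R by rewrite expf_neq0// gt_eqF.
        by field; rewrite h2 gt_eqF.
      apply: ler_wpM2r; first by rewrite invr_ge0 exprn_ge0 ?ler0n.
      apply: ler_pM; rewrite ?exprn_ge0 ?mulr_ge0 ?divr_ge0 ?normc_ge0 ?exprn_ge0 ?ler0n//.
        apply: lerXn2r; rewrite ?nnegrE ?divr_ge0 ?ler0n//.
        rewrite ler_pM2l// lef_pV2 ?posrE ?ltr0n ?addSn// ler_nat.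
        by rewrite ltnS leq_addr.
      by apply: ler_wpM2r; rewrite ?exprn_ge0 ?ler0n.
    apply: le_trans (lerD IH t1) _.
    have := inv_sq_telescope R (n + p); rewrite -!addSn => t2.
    have c0 : 0 <= (n%:R / n.+1%:R) ^+ e q * (B * n%:R ^+ 2) :> R.
      by rewrite mulr_ge0 ?exprn_ge0 ?divr_ge0 ?mulr_ge0 ?exprn_ge0 ?ler0n.
    apply: le_trans (lerD (lexx _) (ler_wpM2l c0 t2)) _.
    by rewrite le_eqVlt; apply/orP; left; apply/eqP; rewrite /A; ring.
  apply/ler_addgt0Pr => d d0.
  have d1 : 0 < d / n%:R ^+ k by rewrite divr_gt0 ?exprn_gt0.
  have [J0 hJ] := hT q _ d1; have {hJ} := hJ (n + J0)%N (leq_addl _ _).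
  rewrite ltr_pdivlMr ?exprn_gt0// => hJ.
  have split : n%:R ^+ k * \sum_(1 <= j < (n + J0).+1) b j / j%:R ^+ k =
     b n + \sum_(n.+1 <= j < n.+1 + J0) n%:R ^+ k * (b j / j%:R ^+ k).
    rewrite (@big_cat_nat _ _ _ n)//=; last by rewrite leqW// leq_addr.
    rewrite big1_seq ?add0r; last first.
      by move=> j /andP[_]; rewrite mem_index_iota => /bz ->; rewrite mul0r.
    rewrite big_ltn ?ltnS ?leq_addr// mulrDr addSn; congr (_ + _); last by rewrite mulr_sumr.
    by rewrite mulrCA mulfV ?mulr1// expf_neq0// pnatr_eq0 -lt0n.
  have -> : n%:R ^+ k * T q - b n = - (n%:R ^+ k * (\sum_(1 <= j < (n + J0).+1) b j / j%:R ^+ k - T q)) +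
     \sum_(n.+1 <= j < n.+1 + J0) n%:R ^+ k * (b j / j%:R ^+ k).
    by rewrite mulrBr split; ring.
  apply: le_trans (le_normcD _ _) _; rewrite addrC; apply: lerD; last first.
    by rewrite normcN normcM normcX normc_nat mulrC ltW.
  apply: le_trans (tail J0) _.
  have c0 : 0 <= A * (n%:R / n.+1%:R) ^+ e q.
    by rewrite mulr_ge0 ?exprn_ge0 ?divr_ge0 ?ler0n.
  rewrite -[leRHS]mulr1; apply: ler_wpM2l => //.
  rewrite lerBlDr; apply: le_trans (_ : 1 <= _); first by rewrite invf_le1 ?ltr0n// ler1n.
  by rewrite lerDl invr_ge0 ler0n.
move=> d d0; have [q0 hq] := archi_large (A * n%:R) d0.
exists q0 => q qq; apply: le_lt_trans (main q) _.
have geo m : (n%:R / n.+1%:R) ^+ m <= n%:R / (n + m)%:R :> R.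
  elim: m => [|m IH]; first by rewrite addn0 divff// gt_eqF.
  rewrite exprS; apply: le_trans (ler_wpM2l _ IH) _; first by rewrite divr_ge0 ?ler0n.
  have nm : 0 < (n + m)%:R :> R by rewrite ltr0n addn_gt0 n0.
  have pos : 0 < n.+1%:R * (n + m)%:R :> R by apply: mulr_gt0.
  have pos2 : 0 < (n + m.+1)%:R :> R by rewrite addnS.
  rewrite mulf_div (ler_pdivrMr _ _ pos) mulrAC (ler_pdivlMr _ _ pos2).
  by rewrite -!natrM ler_nat; nia.
apply: le_lt_trans (ler_wpM2l A0 (geo (e q))) _.
rewrite mulrA ltr_pdivrMr; last by rewrite ltr0n addn_gt0 n0.
apply: lt_le_trans hq _; rewrite ler_pM2l// ler_nat.
exact: leq_trans qq (leq_trans (eq q) (leq_addl _ _)).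
Qed.
End Analytic.

(** * Comparing the functional equation at two points *)

Section GammaRatio.
Variable R : realType.
Local Notation C := R[i].

Lemma complex_nat (n : nat) : n%:R = (n%:R : R)%:C :> C.
Proof. by rewrite (rmorph_nat (real_complex R)). Qed.

Lemma complex_half : 2^-1 = (2^-1 : R)%:C :> C.
Proof. by rewrite fmorphV (complex_nat 2). Qed.

Lemma cpowD (x : R) (s t : C) : cpow x (s + t) = cpow x s * cpow x t.
Proof. by rewrite /cpow mulrDl cexpD. Qed.

Lemma cpow1 (x : R) : 0 < x -> cpow x 1 = x%:C.
Proof. by move=> x0; rewrite /cpow mul1r cexp_real lnK. Qed.

Lemma cpow_neq0 (x : R) s : cpow x s != 0.
Proof. exact: cexp_neq0. Qed.

(** To the left of the imaginary axis [Gamma] is defined by its recursion, so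
    this is a computation of the shift in the definition. *)
Lemma Gamma_left_half (q : nat) (eta : R) : 0 < eta < 2^-1 -> (0 < q)%N ->
  Gamma (2^-1 - q%:R + eta%:C) =
  Gamma_integral (2^-1 + eta)%:C / \prod_(j < q) (2^-1 - q%:R + eta%:C + j%:R).
Proof.
move=> /andP[e0 e2] q0; have q1 : 1 <= q%:R :> R by rewrite ler1n.
have -> : 2^-1 - q%:R + eta%:C = (2^-1 - q%:R + eta)%:C :> C.
  by rewrite complex_half complex_nat -rmorphB -rmorphD.
pose x : R := 2^-1 - q%:R + eta; rewrite -/x.
have kE : (if 0 < complex.Re x%:C then 0%N else (Num.truncn (- complex.Re x%:C)).+1) = q.
  rewrite /= ltNge (_ : x <= 0) /=; last by rewrite /x; lra.
  rewrite (@truncn_def _ _ q.-1) ?prednK//.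
  by rewrite -subn1 natrB// /x; apply/andP; split; lra.
rewrite /Gamma kE; congr (Gamma_integral _ / _).
by rewrite complex_nat -rmorphD; congr (_%:C); rewrite /x; ring.
Qed.

Lemma real_gamma_prod (n : nat) (x : R) : 1 < x ->
  real_gamma (x + n%:R) = \prod_(i < n) (x + i%:R) * real_gamma x.
Proof.
move=> x1; elim: n => [|n IH]; first by rewrite addr0 big_ord0 mul1r.
rewrite big_ord_recr /= -natr1 addrA real_gamma_rec; last by apply: ltr_wpDr.
by rewrite IH mulrA; congr (_ * _); rewrite mulrC.
Qed.

Lemma Gamma_right (n : nat) (eta : R) : 0 < eta < 2^-1 ->
  Gamma (n.+2%:R - eta%:C) =
  \prod_(i < n) (2%:R - eta%:C + i%:R) * (real_gamma (2 - eta))%:C.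
Proof.
move=> /andP[e0 e2].
have -> : n.+2%:R - eta%:C = ((2 - eta) + n%:R)%:C :> C.
  by rewrite complex_nat -rmorphB; congr (_%:C); rewrite -addn2 natrD; ring.
have e1 : 1 < 2 - eta by lra.
rewrite Gamma_real; last by apply: ltr_wpDr.
rewrite real_gamma_prod// rmorphM rmorph_prod; congr (_ * _).
by apply: eq_bigr => i _; rewrite rmorphD rmorphB /= -!complex_nat.
Qed.

(** The algebra of [const_step] below, with letters for its factors. *)
Lemma const_identity (K : numFieldType) (a : nat) (u v w x y z t n c q : K) : (a < 2)%N ->
  y != 0 -> n != 0 -> c != 0 -> q != 0 -> 2%:R * q + 1 != 0 -> x != 0 ->
  z / (n / c * (2^-1 - (q + 1))) *
  (-1 * (-1 * (-1 * v)) * ((2%:R * q + a%:R - 1 + 2%:R) * ((2%:R * q + a%:R - 1 + 1) * w)) *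
   (n * (n * u)) / (- (4%:R * c ^+ 2) * (y * x))) * t =
  z * (-1 * v * w * u / (y * x)) * (t * (n / c * (q + a%:R))).
Proof.
case: a => [|[|//]] _ y0 n0 c0 q0 q1 x0; field.
all: rewrite ?y0 ?n0 ?c0 ?q0 ?x0 ?pnatr_eq0 ?andbT //=.
all: apply: contraNneq q1 => h.
all: by rewrite -oppr_eq0 -h; apply/eqP; ring.
Qed.

Section FunctionalEquation.
Variables (N : nat) (a : nat) (L1 L2 : C -> C) (eps : C).
Hypotheses (N_gt0 : (0 < N)%N) (a2 : (a < 2)%N).
Hypothesis eps_neq0 : eps != 0.
Hypothesis L1_der : forall s, s != 1 -> derivable (L1 : C^o -> C^o) s 1.
Hypothesis L2_der : forall s, s != 1 -> derivable (L2 : C^o -> C^o) s 1.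
Hypothesis func_eq : eq_meromorphic (completed N a L1) (fun s => eps * completed N a L2 (1 - s)).

Let M : R := N%:R / pi.

Let M_gt0 : 0 < M.
Proof. by rewrite divr_gt0 ?ltr0n ?pi_gt0. Qed.

(* The functional equation is used at 1 - k + 2 * eta n, away from the poles
   of Gamma. *)
Let eta n : R := n.+3%:R^-1.

Let eta_bound n : 0 < eta n < 2^-1.
Proof. by rewrite invr_gt0 ltr0n /= ltf_pV2 ?posrE ?ltr0n// ltr_nat. Qed.

Let tends_eta : tends (fun n => (eta n)%:C) 0.
Proof.
move=> e e0; have [n0 hn] := archi_large 1 e0; exists n0 => n nn.
have /andP[t0 _] := eta_bound n.
rewrite subr0 normc_real ger0_norm ?ltW// /eta -[_^-1]mul1r ltr_pdivrMr//.
apply: lt_le_trans hn _; rewrite ler_pM2l// ler_nat.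
by apply: leq_trans nn _; rewrite -addn3 leq_addr.
Qed.

(** The integers [k] at which the functional equation is compared, of the parity
    [a], numbered by [p]: [weight p = 2 * q + a] with [q = p + 2]. From
    this size on, the value of Gamma on the right is obtained by the
    recursion from that at [2 - eta > 1]. *)
Definition weight p := (2 * p.+1 + a).+2.

Let weightE p : (weight p)%:R = 2%:R * p.+2%:R + a%:R :> C.
Proof. by rewrite /weight -natrM -natrD; congr (_%:R); lia. Qed.

(** The factor of [L1 s] in the completed function at [s = 1 - weight p + 2 * h],
    divided by the Gamma integral at [1 / 2 + h]. *)
Definition left_factor p (h : C) : C :=
  cpow M (2^-1 - p.+2%:R + h) / \prod_(j < p.+2) (2^-1 - p.+2%:R + h + j%:R).

(** The factor of [L2 (1 - s)] at the same [s], divided by the value of Gamma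
    at [2 - h]. *)
Definition right_factor p (h : C) : C :=
  cpow M (p.+2%:R + a%:R - h) * \prod_(i < p + a) (2%:R - h + i%:R).

Let near_eq p : exists n0, forall n, (n0 <= n)%N ->
  left_factor p (eta n)%:C * L1 (1 - (weight p)%:R + 2%:R * (eta n)%:C) * Gamma_integral (2^-1 + eta n)%:C =
  eps * right_factor p (eta n)%:C * L2 ((weight p)%:R - 2%:R * (eta n)%:C) * (real_gamma (2 - eta n))%:C.
Proof.
have [d d0 dP] := nearC_punctured (func_eq (1 - (weight p)%:R)).
have [n0 hn] := tends_eta (divr_gt0 d0 (ltr0Sn _ 1)).
exists n0 => n /hn; rewrite subr0 ltr_pdivlMr// => hd.
have /andP[t0 t2] := eta_bound n.
have et0 : (eta n)%:C != 0 by rewrite -normc_gt0 normc_real ger0_norm ?ltW.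
have := dP (1 - (weight p)%:R + 2%:R * (eta n)%:C).
rewrite -subr_eq0 addrC addKr mulf_neq0 ?pnatr_eq0// => /(_ isT).
rewrite normcM normc_nat mulrC => /(_ hd).
rewrite /completed.
have -> : (1 - (weight p)%:R + 2%:R * (eta n)%:C + a%:R) / 2%:R = 2^-1 - p.+2%:R + (eta n)%:C :> C.
  by rewrite weightE; field.
have -> : (1 - (1 - (weight p)%:R + 2%:R * (eta n)%:C) + a%:R) / 2%:R = p.+2%:R + a%:R - (eta n)%:C :> C.
  by rewrite weightE; field.
rewrite Gamma_left_half//.
have -> : 1 - (1 - (weight p)%:R + 2%:R * (eta n)%:C) = (weight p)%:R - 2%:R * (eta n)%:C by ring.
have hE : p.+2%:R + a%:R - (eta n)%:C = (p + a).+2%:R - (eta n)%:C :> C.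
  by rewrite -natrD addSn addSn.
rewrite {2}hE Gamma_right// /left_factor /right_factor -/M => E.
transitivity (eps * (cpow M (p.+2%:R + a%:R - (eta n)%:C) *
  (\prod_(i < p + a) (2 - (eta n)%:C + i%:R) * (real_gamma (2 - eta n))%:C) *
  L2 ((weight p)%:R - 2 * (eta n)%:C))); last by ring.
by rewrite -E; ring.
Qed.

Let cross_near p p' : exists n0, forall n, (n0 <= n)%N ->
  left_factor p (eta n)%:C * L1 (1 - (weight p)%:R + 2%:R * (eta n)%:C) *
  (right_factor p' (eta n)%:C * L2 ((weight p')%:R - 2%:R * (eta n)%:C)) =
  left_factor p' (eta n)%:C * L1 (1 - (weight p')%:R + 2%:R * (eta n)%:C) *
  (right_factor p (eta n)%:C * L2 ((weight p)%:R - 2%:R * (eta n)%:C)).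
Proof.
have [n1 h1] := near_eq p; have [n2 h2] := near_eq p'.
exists (maxn n1 n2) => n; rewrite geq_max => /andP[/h1 E1 /h2 E2].
have /andP[t0 t2] := eta_bound n.
have G0 : (real_gamma (2 - eta n))%:C != 0.
  by rewrite -normc_gt0 normc_real normr_gt0 gt_eqF// real_gamma_gt0//; lra.
apply: (mulfI (mulf_neq0 eps_neq0 G0)).
move: E1 E2; move: (left_factor _ _ * L1 _) (left_factor _ _ * L1 _) => A A'.
move: (real_gamma _)%:C (right_factor p _) (right_factor p' _) (Gamma_integral _) (L2 _) (L2 _).
move=> G b b' I l l' E1 E2.
transitivity (A' * (eps * b' * l * G)); first by ring.
by rewrite -E2 mulrCA E1; ring.
Qed.

Let tends_arg (x c : C) : tends (fun n => x + c * (eta n)%:C) x.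
Proof.
by have := tendsD (tends_cst x) (tendsM (tends_cst c) tends_eta); rewrite mulr0 addr0.
Qed.

Let tends_comp (F : C -> C) : entire F -> tends (fun n => F (eta n)%:C) (F 0).
Proof. by case=> hF; exact: tends_derivable tends_eta. Qed.

Let left_factor_pole p j : 2^-1 - p%:R + 0 + j%:R != 0 :> C.
Proof.
rewrite addr0; apply/eqP => /(congr1 (fun z => 2%:R * z)).
have -> : 2%:R * (2^-1 - p%:R + j%:R) = (1 + 2 * j)%N%:R - (2 * p)%N%:R :> C.
  by rewrite natrD !natrM; field.
by move/eqP; rewrite mulr0 subr_eq0 eqr_nat; lia.
Qed.

Let tends_left p : tends (fun n => left_factor p (eta n)%:C) (left_factor p 0).
Proof.
apply: tendsM.
  exact: (tends_comp (entire_cpow M (entireD (entire_cst _) (@entire_id R)))).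
apply: tendsV; first by apply/prodf_neq0 => j _; exact: left_factor_pole.
apply: (@tends_prod _ _ _ (fun (j : 'I_p.+2) n => 2^-1 - p.+2%:R + (eta n)%:C + j%:R) (fun j => 2^-1 - p.+2%:R + 0 + j%:R)) => j.
exact: tendsD (tendsD (tends_cst _) tends_eta) (tends_cst _).
Qed.

Let tends_right p : tends (fun n => right_factor p (eta n)%:C) (right_factor p 0).
Proof.
apply: tendsM.
  exact: (tends_comp (entire_cpow M (entireB (entire_cst _) (@entire_id R)))).
apply: (@tends_prod _ _ _ (fun (j : 'I_(p + a)) n => 2%:R - (eta n)%:C + j%:R) (fun j => 2%:R - 0 + j%:R)) => j.
exact: tendsD (tendsD (tends_cst _) (tendsN tends_eta)) (tends_cst _).
Qed.

Let weight_neq1 p : (weight p)%:R != 1 :> C.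
Proof. by rewrite -[1]/(1%:R) eqr_nat. Qed.

Let tends_L1 p : tends (fun n => L1 (1 - (weight p)%:R + 2%:R * (eta n)%:C)) (L1 (1 - (weight p)%:R)).
Proof.
apply: tends_derivable (tends_arg _ _); apply: L1_der.
by rewrite -subr_eq0 addrAC subrr sub0r oppr_eq0 pnatr_eq0.
Qed.

Let tends_L2 p : tends (fun n => L2 ((weight p)%:R - 2%:R * (eta n)%:C)) (L2 (weight p)%:R).
Proof.
apply: tends_derivable; first exact: L2_der.
by under eq_fun do rewrite -mulNr; exact: tends_arg.
Qed.

(** The functional equation for [p] multiplied crosswise with that for [p']: the
    values of Gamma at [1 / 2 + eta] and [2 - eta] cancel, the first one
    because it occurs on both sides, the second one because it is nonzero,
    and what remains is continuous at [eta = 0]. *)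
Lemma functional_cross p p' :
  left_factor p 0 * L1 (1 - (weight p)%:R) * (right_factor p' 0 * L2 (weight p')%:R) =
  left_factor p' 0 * L1 (1 - (weight p')%:R) * (right_factor p 0 * L2 (weight p)%:R).
Proof.
have h q q' := tendsM (tendsM (tends_left q) (tends_L1 q)) (tendsM (tends_right q') (tends_L2 q')).
apply: tends_uniq (h p p') _ => e /(h p' p)[n1 hn1].
have [n2 hn2] := cross_near p p'.
exists (maxn n1 n2) => n; rewrite geq_max => /andP[/hn1 + /hn2 E].
by rewrite E.
Qed.

Let P : C := - (0 +i* (pi *+ 2)).

(** The factor of the lattice sum when [L1 (1 - weight p)] is replaced by its
    expression from [lattice_formula], up to the constant 2. *)
Definition left_const p : C := left_factor p 0 *
  ((-1) ^+ weight p * (weight p).-1`!%:R * N%:R ^+ (weight p).-1 / P ^+ weight p).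

Let Psq : P ^+ 2 = - (4%:R * (pi : R)%:C ^+ 2).
Proof.
rewrite /P sqrrN expr2; apply/eqP; rewrite eq_complex /=.
by apply/andP; split; apply/eqP; ring.
Qed.

Let piC_neq0 : (pi : R)%:C != 0.
Proof. by rewrite -normc_gt0 normc_real normr_gt0 gt_eqF// pi_gt0. Qed.

Let P_neq0 : P != 0.
Proof.
have : P ^+ 2 != 0 by rewrite Psq oppr_eq0 mulf_neq0 ?pnatr_eq0 ?expf_neq0.
by apply: contraNneq => ->; rewrite expr0n.
Qed.

Let M_C : M%:C = N%:R / (pi : R)%:C :> C.
Proof. by rewrite /M rmorphM fmorphV complex_nat. Qed.

Let N_C : N%:R != 0 :> C.
Proof. by rewrite pnatr_eq0 -lt0n. Qed.

Let right_ratio p : right_factor p.+1 0 = right_factor p 0 * (M%:C * (p.+2%:R + a%:R)).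
Proof.
rewrite /right_factor !subr0 addSn big_ord_recr /=.
have -> : p.+3%:R + a%:R = (p.+2%:R + a%:R) + 1 :> C by rewrite -[p.+3]addn1 natrD; ring.
rewrite cpowD cpow1//.
have -> : 2%:R + (p + a)%:R = p.+2%:R + a%:R :> C by rewrite -!natrD.
ring.
Qed.

Let left_ratio p : left_factor p.+1 0 = left_factor p 0 / (M%:C * (2^-1 - p.+3%:R)).
Proof.
rewrite /left_factor !addr0 big_ord_recl /= addr0.
have -> : 2^-1 - p.+3%:R = (2^-1 - p.+2%:R) - 1 :> C by rewrite -[p.+3]addn1 natrD; ring.
rewrite cpowD /cpow mulN1r cexpN -(mul1r (ln M)%:C) -/(cpow M _) -/(cpow M 1) cpow1//.
have -> : \prod_(i < p.+2) (2^-1 - p.+2%:R - 1 + (bump 0 i)%:R) = \prod_(i < p.+2) (2^-1 - p.+2%:R + i%:R) :> C.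
  by apply: eq_bigr => i _; rewrite /bump /= natrD; ring.
by rewrite !invfM; ring.
Qed.

Let weightS p : weight p.+1 = (weight p).+2.
Proof. by rewrite /weight; lia. Qed.

Let const_step p : left_const p.+1 * right_factor p 0 = left_const p * right_factor p.+1 0.
Proof.
rewrite /left_const right_ratio left_ratio weightS M_C.
have [k kE] : exists k, weight p = k.+1 by exists (weight p).-1.
have kR : k%:R = 2%:R * p.+2%:R + a%:R - 1 :> C by rewrite -weightE kE -natr1 addrK.
rewrite kE /= !factS !natrM !exprS.
have PP : P * P = - (4%:R * (pi : R)%:C ^+ 2) by rewrite -expr2 Psq.
have -> : P * (P * (P * P ^+ k)) = (P * P) * (P * P ^+ k) by ring.
rewrite PP -[k.+2]addn2 -[k.+1]addn1 -[p.+3]addn1 !natrD kR.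
have q0 : p.+2%:R != 0 :> C by rewrite pnatr_eq0.
have q1 : 2%:R * p.+2%:R + 1 != 0 :> C by rewrite -natrM natr1 pnatr_eq0.
have Pk : P ^+ k != 0 by rewrite expf_neq0.
exact: const_identity.
Qed.

Let right_factor_neq0 p : right_factor p 0 != 0.
Proof.
rewrite mulf_neq0 ?cpow_neq0//; apply/prodf_neq0 => j _.
by rewrite subr0 -natrD pnatr_eq0.
Qed.

Let left_const_neq0 p : left_const p != 0.
Proof.
have l0 : left_factor p 0 != 0.
  rewrite mulf_neq0 ?cpow_neq0// invr_eq0.
  by apply/prodf_neq0 => j _; exact: left_factor_pole.
have [k kE] : exists k, k = weight p by exists (weight p).
rewrite /left_const -kE mulf_neq0// mulf_neq0 ?invr_eq0 ?expf_neq0//.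
by rewrite mulf_neq0 ?expf_neq0// mulf_neq0 ?signr_eq0// pnatr_eq0 -lt0n fact_gt0.
Qed.

(** That the quotient [left_const p / right_factor p 0] does not depend on [p]
    reflects the compatibility of the unconditional functional equation
    with the assumed one. *)
Let const_ratio p p' : left_const p * right_factor p' 0 = left_const p' * right_factor p 0.
Proof.
have h q : left_const q / right_factor q 0 = left_const 0 / right_factor 0 0.
  elim: q => [//|q <-]; apply/eqP; rewrite eqr_div//; apply/eqP.
  exact: const_step.
by apply/eqP; rewrite -eqr_div// !h.
Qed.

(** [X p] is to be the sum of [ghat j / j ^ weight p]. *)
Lemma functional_moments (X : nat -> C) :
  (forall p, L1 (1 - (weight p)%:R) =
    (-1) ^+ weight p * (weight p).-1`!%:R * N%:R ^+ (weight p).-1 *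
    (2%:R * (P ^+ weight p)^-1 * X p)) ->
  forall p p', X p * L2 (weight p')%:R = X p' * L2 (weight p)%:R.
Proof.
move=> hX p p'; have := functional_cross p p'; rewrite !hX => E.
have c0 : 2%:R * (left_const p * right_factor p' 0) != 0.
  by rewrite mulf_neq0 ?pnatr_eq0// mulf_neq0.
apply: (mulfI c0); rewrite {2}const_ratio.
transitivity (left_factor p 0 *
  ((-1) ^+ weight p * (weight p).-1`!%:R * N%:R ^+ (weight p).-1 *
   (2%:R * (P ^+ weight p)^-1 * X p)) * (right_factor p' 0 * L2 (weight p')%:R)).
  by rewrite /left_const; ring.
by rewrite E /left_const; ring.
Qed.

End FunctionalEquation.
End GammaRatio.

(** * The Fourier transform forced by a functional equation *)

Section FunctionalFourier.
Variable R : realType.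
Local Notation C := R[i].

Lemma cpow_nat (n k : nat) : (0 < n)%N -> cpow n%:R (- k%:R) = (n%:R ^+ k)^-1 :> C.
Proof.
move=> n0; have n0R : 0 < n%:R :> R by rewrite ltr0n.
rewrite /cpow mulNr cexpN; congr (_^-1).
by rewrite cexpM_nat -/(cpow _ _) -(mul1r (ln _)%:C) -/(cpow _ 1) cpow1// -complex_nat.
Qed.

Variables (N : nat) (N_gt1 : (1 < N)%N).

Lemma Zp_nat_eq (i j : nat) : (i%:R == j%:R :> 'Z_N) = (i == j %[mod N]).
Proof. by rewrite -val_eqE /= !val_Zp_nat. Qed.

Lemma sum_residues (V : zmodType) (h : nat -> V) : h N = h 0%N ->
  \sum_(1 <= x < N.+1) h x = \sum_(x : 'Z_N) h x.
Proof.
move=> hN; rewrite big_nat_recr ?(ltnW N_gt1)//= hN addrC -big_ltn ?(ltnW N_gt1)//.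
rewrite big_mkord; move: N_gt1; case: N => [|[|n]]//.
Qed.

Local Notation w := (unit_exp (N%:R^-1 : R)).

Let w_prim : N.-primitive_root w.
Proof. exact: unit_exp_prim (ltnW N_gt1). Qed.

Definition fourier (g : 'Z_N -> C) (j : nat) : C := \sum_(x : 'Z_N) g x * w ^+ (j * x).

Lemma finite_fourierE g j : finite_fourier N (fun n => g n%:R) w j = fourier g j.
Proof.
rewrite /finite_fourier sum_residues.
  by apply: eq_bigr => x _; rewrite natr_Zp.
rewrite muln0 mulnC exprM (prim_expr_order w_prim) expr1n expr0.
by rewrite -[X in g X](natr_Zp) val_Zp_nat// modnn.
Qed.

Lemma fourier_opp g a q j : (forall x, g (- x) = (-1) ^+ a * g x) -> (j <= N * q)%N ->
  fourier g (N * q - j) = (-1) ^+ a * fourier g j.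
Proof.
move=> ga jq; rewrite /fourier mulr_sumr (reindex_inj (@oppr_inj _)) /=.
apply: eq_bigr => x _; rewrite ga mulrA; congr (_ * _).
apply: (mulIf (x := w ^+ (j * (- x : 'Z_N)%R))).
  exact: expf_neq0 _ (cexp_neq0 _).
rewrite -!exprD -mulnDl -mulnDr subnK// -mulnA exprM (prim_expr_order w_prim) expr1n.
symmetry; apply/eqP; rewrite -(prim_order_dvd w_prim) dvdn_mull//.
by rewrite /dvdn -[0%N](mod0n N) -Zp_nat_eq natrD !natr_Zp subrr.
Qed.

Section Series.
Variables (g : 'Z_N -> C) (L : C -> C).
Hypothesis hL : is_Lfunction g L.

Lemma is_Lfunction_sum s : 1 < complex.Re s ->
  tends (fun J => dirichlet_sum (fun n => g n%:R) J s) (L s).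
Proof.
case: hL => h _ _ /h /tendsP; apply: eq_tends => J.
by rewrite /dirichlet_sum big_add1 /= seriesEnat.
Qed.

Lemma is_Lfunction_nat k : tends (fun J => \sum_(1 <= j < J.+1) g j%:R / j%:R ^+ k.+2) (L k.+2%:R).
Proof.
have k1 : 1 < complex.Re (k.+2%:R : C) by rewrite Re_nat ltr1n.
apply: eq_tends (is_Lfunction_sum k1) => J.
by apply: eq_big_nat => j /andP[j0 _]; rewrite cpow_nat.
Qed.

Lemma is_Lfunction_derivable s : s != 1 -> derivable (L : C^o -> C^o) s 1.
Proof. by case: hL => _ h _ /h; exact: holomorphic_derivable. Qed.

End Series.

(** The sequence for which the recurrence of [dirichlet_recurrence] takes the
    form [lattice_coef]. *)
Definition lattice_value (F : C -> C) (k : nat) : C :=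
  - ((-1) ^+ k.-1 * F (- k.-1%:R) / (N%:R ^+ k.-1 * k.-1`!%:R)).

Let N_C : N%:R != 0 :> C.
Proof. by rewrite pnatr_eq0 -lt0n ltnW. Qed.

Lemma lattice_valueP (h : nat -> C) F :
  (forall j, \sum_(1 <= x < N.+1) h x * x%:R ^+ j +
     \sum_(1 <= i < j.+1) 'C(j, i)%:R * N%:R ^+ i * F (- (j - i)%:R) = 0) ->
  lattice_coef N h (lattice_value F).
Proof.
move=> rec k; move/eqP: (rec k); rewrite addr_eq0 => /eqP E.
have -> : \sum_(1 <= x < N.+1) h x * (x%:R / N%:R) ^+ k = (\sum_(1 <= x < N.+1) h x * x%:R ^+ k) / N%:R ^+ k.
  by rewrite mulr_suml; apply: eq_bigr => x _; rewrite expr_div_n mulrA.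
rewrite E mulNr mulrN !mulr_suml mulr_sumr -sumrN; apply: eq_big_nat => i /andP[i1 ik].
rewrite ltnS in ik; rewrite /lattice_value subSn//= -(bin_fact ik) !natrM.
have -> : (-1) ^+ k = (-1) ^+ i * (-1) ^+ (k - i) :> C by rewrite -exprD subnKC.
have -> : N%:R ^+ k = N%:R ^+ i * N%:R ^+ (k - i) :> C by rewrite -exprD subnKC.
have f0 n : n`!%:R != 0 :> C by rewrite pnatr_eq0 -lt0n fact_gt0.
have b0 : 'C(k, i)%:R != 0 :> C by rewrite pnatr_eq0 -lt0n bin_gt0.
by field; rewrite !expf_neq0// !f0 b0.
Qed.

Variables (g : 'Z_N -> C) (a : nat) (L1 L2 : C -> C) (eps : C).
Hypotheses (a2 : (a < 2)%N) (g_opp : forall x, g (- x) = (-1) ^+ a * g x).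
Hypotheses (g_le : forall x, normc (g x) <= 1) (g1 : g 1 = 1).
Hypotheses (hL1 : is_Lfunction g L1) (hL2 : is_Lfunction (conj_fun g) L2).
Hypotheses (L1_regular : regular_at L1 1) (eps_neq0 : eps != 0).
Hypothesis func_eq : eq_meromorphic (completed N a L1) (fun s => eps * completed N a L2 (1 - s)).

Let gn n := g n%:R.

Let fourier_le j : normc (fourier g j) <= N%:R.
Proof.
have NE := Zp_cast N_gt1.
have -> : N%:R = \sum_(x : 'Z_N) 1 :> R by rewrite sumr_const card_ord NE.
apply: le_trans (le_normc_sum _ _ _) _; apply: ler_sum => x _.
by rewrite normcM normcX normc_cexp /= expR0 expr1n mulr1.
Qed.

Let Pi : C := - (0 +i* (pi *+ 2)).

Let Pi_neq0 : Pi != 0.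
Proof.
rewrite oppr_eq0 eq_complex /= eqxx /= mulrn_eq0 /= gt_eqF ?pi_gt0//.
Qed.

(** The sums [X p] come from [lattice_formula], their relation with [L2] from the
    assumed functional equation. *)
Let moments : exists X : nat -> C,
  (forall p, tends (fun J => \sum_(1 <= j < J.+1) fourier g j / j%:R ^+ weight a p) (X p)) /\
  forall p p', X p * L2 (weight a p')%:R = X p' * L2 (weight a p)%:R.
Proof.
have [F entF FL] : exists2 F : C -> C, entire F & forall s, s != 1 -> F s = L1 s.
  by apply: entire_extension => //; case: hL1.
have gN n : gn (n + N)%N = gn n.
  by rewrite /gn natrD pchar_Zp ?addr0.
have hF s : 1 < complex.Re s -> null_seq (fun M => dirichlet_sum gn M s - F s).
  move=> s1; rewrite FL; first exact: is_Lfunction_sum.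
  by apply: contraTneq s1 => ->; rewrite /= ltxx.
have rec j := dirichlet_recurrence j entF gN (fun n => g_le n%:R) hF.
have sum_g : \sum_(1 <= x < N.+1) gn x = 0.
  rewrite -[RHS](rec 0%N) [X in _ + X]big_geq// addr0.
  by apply: eq_bigr => x _; rewrite expr0 mulr1.
have latV := lattice_valueP rec; set V := lattice_value F in latV.
exists (fun p => V (weight a p) * Pi ^+ weight a p / 2%:R); split.
- move=> p; have [k kE] : exists k, weight a p = k.+2 by exists (2 * p.+1 + a)%N.
  have sgn : (-1) ^+ k.+2 = (-1) ^+ a :> C.
    rewrite -signr_odd -[RHS]signr_odd; congr (_ ^+ nat_of_bool _).
    by move: kE; rewrite /weight => -[<-]; lia.
  have sym q j : (j <= N * q)%N -> finite_fourier N gn w (N * q - j) = (-1) ^+ k.+2 * finite_fourier N gn w j.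
    by move=> jq; rewrite !finite_fourierE sgn; exact: fourier_opp.
  have := tendsM (tends_cst (Pi ^+ k.+2 / 2%:R)) (lattice_formula (ltnW N_gt1) sum_g latV (ltn0Sn k : (1 < k.+2)%N) sym).
  rewrite kE (_ : V k.+2 * _ / _ = Pi ^+ k.+2 / 2%:R * V k.+2); last by ring.
  apply: eq_tends => J; rewrite mulr_sumr.
  apply: eq_big_nat => j /andP[j0 _]; rewrite finite_fourierE.
  have -> : - (0 +i* (pi *+ 2 * j%:R)) = Pi * j%:R :> C.
    by rewrite /Pi complex_nat; apply/eqP; rewrite eq_complex /=; apply/andP; split; apply/eqP; ring.
  have jC : j%:R != 0 :> C by rewrite pnatr_eq0 -lt0n.
  rewrite exprMn; field; rewrite !expf_neq0//; exact: Pi_neq0.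
- apply: (functional_moments (ltnW N_gt1) a2 eps_neq0 _ _ func_eq).
  + exact: is_Lfunction_derivable hL1.
  + exact: is_Lfunction_derivable hL2.
  move=> p; have [k kE] : exists k, weight a p = k.+2 by exists (2 * p.+1 + a)%N.
  have kn1 : 1 - k.+2%:R != 1 :> C.
    by rewrite -subr_eq0 addrAC subrr sub0r oppr_eq0 pnatr_eq0.
  rewrite kE -(FL _ kn1) /V /lattice_value /=.
  have -> : 1 - k.+2%:R = - k.+1%:R :> C by rewrite -[k.+2]addn1 natrD; ring.
  have f0 : (k.+1)`!%:R != 0 :> C by rewrite pnatr_eq0 -lt0n fact_gt0.
  rewrite -/Pi; move: (F _) => Fk.
  have sg : (-1) ^+ k.+2 * (-1) ^+ k.+1 = -1 :> C.
    by rewrite exprS -mulrA -expr2 sqrr_sign mulr1.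
  have Pk : Pi ^+ k.+2 != 0 by rewrite expf_neq0// Pi_neq0.
  transitivity (- ((-1) ^+ k.+2 * (-1) ^+ k.+1) * Fk); first by rewrite sg opprK mul1r.
  by field; rewrite f0 Pk expf_neq0.
Qed.

Let weight_neq0 p : (p <= 2 * p.+1 + a)%N.
Proof. by lia. Qed.

(** The Dirichlet series with coefficients [fourier g j] and [conj (g j)] are
    proportional at the points [weight a p]. Letting [p] tend to infinity
    identifies the factor as [fourier g 1], since [g 1 = 1]; the difference
    is then a Dirichlet series vanishing at these points, whose coefficients
    vanish one after the other. *)
Lemma fourier_conj n : (0 < n)%N -> fourier g n = fourier g 1 * (g n%:R)^*.
Proof.
have [X [hX XY]] := moments.
have hY p : tends (fun J => \sum_(1 <= j < J.+1) (gn j)^* / j%:R ^+ weight a p) (L2 (weight a p)%:R).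
  exact: is_Lfunction_nat hL2 _.
have gJ_le j : normc (gn j)^* <= 1 by rewrite normc_conj; exact: g_le.
have leadX : tends X (fourier g 1).
  apply: eq_tends (dirichlet_lead fourier_le (ltn0Sn 0) _ weight_neq0 hX) => [p|j].
    by rewrite expr1n mul1r.
  by rewrite andbC; case: j.
have leadY : tends (fun p => L2 (weight a p)%:R) 1.
  have gn1 : (gn 1)^* = 1 by rewrite /gn g1 rmorph1.
  rewrite -[X in tends _ X]gn1.
  apply: eq_tends (dirichlet_lead gJ_le (ltn0Sn 0) _ weight_neq0 hY) => [p|j].
    by rewrite expr1n mul1r.
  by rewrite andbC; case: j.
have XE p : X p = fourier g 1 * L2 (weight a p)%:R.
  rewrite -[LHS]mulr1; apply: tends_uniq (tendsM (tends_cst (X p)) leadY) _.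
  by apply: eq_tends (tendsM leadX (tends_cst _)) => q; rewrite XY.
pose b j := fourier g j - fourier g 1 * (gn j)^*.
have hb p : tends (fun J => \sum_(1 <= j < J.+1) b j / j%:R ^+ weight a p) 0.
  rewrite [X in tends _ X](_ : 0 = X p + - (fourier g 1 * L2 (weight a p)%:R)); last by rewrite -XE subrr.
  apply: eq_tends (tendsD (hX p) (tendsN (tendsM (tends_cst (fourier g 1)) (hY p)))) => J.
  by rewrite mulr_sumr -sumrB; apply: eq_bigr => j _; rewrite mulrBl mulrA.
have b_le j : normc (b j) <= N%:R + N%:R.
  apply: le_trans (le_normcB _ _) _; apply: lerD => //.
  rewrite normcM -[leRHS]mulr1; apply: ler_pM; rewrite ?normc_ge0//.
move=> n0; apply/eqP; rewrite -subr_eq0; apply/eqP; rewrite -/(b n).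
elim/ltn_ind: n n0 => n IH n0.
have := dirichlet_lead b_le n0 (fun j hj => IH j (proj2 (andP hj)) (proj1 (andP hj))) weight_neq0 hb.
move=> h; apply: tends_uniq h _.
by apply: eq_tends (tends_cst 0) => q; rewrite mulr0.
Qed.

End FunctionalFourier.

(** * Conjugate roots of unity *)

Section CyclotomicConjugation.
Variable K : numFieldType.
Local Notation pQ := (map_poly (ratr : rat -> K)).
Local Notation ZQ := (map_poly (intr : int -> rat)).

Lemma ZQK (p : {poly int}) : pQ (ZQ p) = map_poly intr p.
Proof. by rewrite -map_poly_comp; apply: eq_map_poly => z /=; rewrite ratr_int. Qed.

(** The factors ['Phi_d] of [X ^ n - 1] with [d < n] divide [X ^ d - 1], which
    is nonzero at [z]. *)
Lemma root_Cyclotomic n (z : K) : n.-primitive_root z -> root (pQ (ZQ 'Phi_n)) z.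
Proof.
move=> prim_z; have n0 := prim_order_gt0 prim_z.
have : root (pQ (ZQ (\prod_(d <- divisors n) 'Phi_d))) z.
  rewrite prod_Cyclotomic// ZQK rmorphB rmorph1 /= map_polyXn /root !hornerE.
  by rewrite (prim_expr_order prim_z) subrr.
rewrite !rmorph_prod -big_filter => /=.
rewrite /root horner_prod prodf_seq_eq0 => /hasP[d]; rewrite filter_predT -dvdn_divisors// => dn /=.
move=> rd; have d0 : (0 < d)%N by apply: dvdn_gt0 dn.
suff : n == d by move/eqP => ->.
rewrite eqn_dvd dn andbT (prim_order_dvd prim_z) -subr_eq0.
have -> : z ^+ d - 1 = (pQ (ZQ ('X^d - 1))).[z].
  by rewrite ZQK rmorphB rmorph1 /= map_polyXn !hornerE.
rewrite -prod_Cyclotomic// (bigD1_seq d) ?divisors_uniq -?dvdn_divisors//=.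
by rewrite !rmorphM hornerM (eqP rd) mul0r.
Qed.

(** The cyclotomic polynomial is irreducible over the rationals, being a minimal
    polynomial in [algC]; so it divides every rational polynomial that has a
    root in common with it in any field. *)
Lemma ratr_root_conj n (z z' : K) (p : {poly rat}) :
  n.-primitive_root z -> n.-primitive_root z' -> root (pQ p) z -> root (pQ p) z'.
Proof.
move=> hz hz' pz; have n0 := prim_order_gt0 hz.
have [y hy] := C_prim_root_exists n0.
have [q [qE qmon] qP] := minCpolyP y.
have qPhi : q = ZQ 'Phi_n.
  apply: (map_poly_inj (ratr : {rmorphism rat -> algC})); rewrite -qE (minCpoly_cyclotomic hy).
  rewrite -(Cintr_Cyclotomic hy) -map_poly_comp.
  by apply: eq_map_poly => t /=; rewrite ratr_int.
have [qz qz'] := (root_Cyclotomic hz, root_Cyclotomic hz'); rewrite -qPhi in qz qz'.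
pose g := gcdp p q.
have gz : root (pQ g) z by rewrite /g gcdp_map root_gcd pz qz.
have q0 : q != 0 := monic_neq0 qmon.
have g0 : g != 0 by rewrite gcdp_eq0 negb_and q0 orbT.
suff qg : q %| g.
  have := dvdp_trans qg (dvdp_gcdl p q).
  rewrite -(dvdp_map (ratr : {rmorphism rat -> K})) => /dvdpP[u ->].
  by rewrite rootM qz' orbT.
have qgE := divpK (dvdp_gcdr p q); rewrite -/g in qgE.
have : root (map_poly ratr q) y by rewrite qP.
rewrite -{1}qgE rmorphM rootM !qP => /orP[qh|//].
have h0 : q %/ g != 0 by apply: contraNneq q0 => h; rewrite -qgE h mul0r.
have := dvdp_leq h0 qh; rewrite -{1}qgE size_mul// => hs.
have /size_poly1P[c c0 gE] : size g == 1%N.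
  have := size_poly_gt0 g; rewrite g0; case: (size g) hs => [//|[//|s]] + _.
  by rewrite !addnS /= ltnNge leq_addr.
by move: gz; rewrite gE map_polyC /= rootC fmorph_eq0 (negPf c0).
Qed.
End CyclotomicConjugation.

(** * Self-dual functions on Z/N and primitive characters *)

(** The Chinese remainder theorem for moduli that need not be coprime, by the
    Bezout identity for [m] and [n]. *)
Lemma crt_compatible (m n c r : nat) : (0 < m)%N -> c = r %[mod gcdn m n] ->
  exists2 t, t = c %[mod m] & t = r %[mod n].
Proof.
move=> m0 cr; have [n0|n0] := posnP n.
  by move: cr; rewrite n0 gcdn0 => cr; exists r.
have cr' : (c <= r + n * c)%N by apply: leq_trans (leq_addl _ _); rewrite leq_pmull.
have /dvdnP[s hs] : (gcdn m n %| r + n * c - c)%N.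
  rewrite -eqn_mod_dvd// -modnDmr -modnMml.
  by move/eqP: (dvdn_gcdr m n) => ->; rewrite mul0n mod0n addn0 cr.
case: (egcdnP n m0) => km kn E _.
exists (km * s * m + c)%N; first by rewrite modnMDl.
have -> : (km * s * m + c = (kn * s + c) * n + r)%N.
  move: E hs cr'; nia.
by rewrite modnMDl.
Qed.

Section Twists.
Variable R : realType.
Local Notation C := R[i].

Lemma unity_conj (k : nat) (z : C) : (0 < k)%N -> z ^+ k = 1 -> z * z^* = 1.
Proof.
move=> k0 zk; rewrite -normCK (_ : `|z| = 1) ?expr1n//.
by apply/eqP; rewrite -(@pexpr_eq1 _ _ k)// -normrX zk normr1.
Qed.

Lemma unity_gcd (k l : nat) (z : C) : (0 < k)%N -> z ^+ k = 1 -> z ^+ l = 1 -> z ^+ gcdn k l = 1.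
Proof.
move=> k0 zk zl; case: (egcdnP l k0) => a b E _.
have : z ^+ (a * k) = z ^+ (b * l + gcdn k l) by rewrite E.
by rewrite exprD mulnC exprM zk expr1n mulnC exprM zl expr1n mul1r.
Qed.

Variables (N m : nat) (N_gt1 : (1 < N)%N) (m_gt1 : (1 < m)%N).
Local Notation w := (unit_exp (N%:R^-1 : R)).

Lemma coprime_nat_Zp (n : nat) : coprime (n%:R : 'Z_N) N = coprime n N.
Proof. by rewrite val_Zp_nat// coprime_modl. Qed.

Lemma coprime_unit (c : {unit 'Z_m}) : coprime (val c : 'Z_m) m.
Proof.
by have := valP c; rewrite -[X in X \is a _](natr_Zp (val c)) unitZpE// coprime_sym.
Qed.

(** Orthogonality of the characters [b -> w ^ (e b)] of [Z/d]. *)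
Lemma fourier_progression (g : 'Z_N -> C) (d e : nat) : (d * e)%N = N ->
  \sum_(b < d) fourier g (e * b) * w ^+ (e * b * d.-1) =
  d%:R * \sum_(x : 'Z_N | x == 1 %[mod d]) g x.
Proof.
move=> dE; have d0 : (0 < d)%N by move: (ltnW N_gt1); rewrite -dE muln_gt0 => /andP[].
have e0 : (0 < e)%N by move: (ltnW N_gt1); rewrite -dE muln_gt0 => /andP[].
have w_prim : N.-primitive_root w := unit_exp_prim R (ltnW N_gt1).
have v_prim : d.-primitive_root (w ^+ e).
  have := dvdn_prim_root w_prim (_ : d %| N)%N.
  by rewrite -[X in (X %/ _)%N]dE mulKn// => -> //; rewrite -dE dvdn_mulr.
rewrite /fourier; under eq_bigr do rewrite mulr_suml.
rewrite exchange_big /= mulr_sumr [RHS]big_mkcond; apply: eq_bigr => x _.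
transitivity (g x * \sum_(b < d) (w ^+ e) ^+ ((x + d.-1) %% d * b)).
  rewrite mulr_sumr; apply: eq_bigr => b _; rewrite -mulrA -exprD -mulnDr; congr (_ * _).
  rewrite -mulnA exprM [X in _ ^+ X]mulnC [LHS]exprM [RHS]exprM; congr (_ ^+ b).
  by rewrite (prim_expr_mod v_prim).
have -> : (x == 1 %[mod d]) = ((x + d.-1) %% d == 0)%N.
  by rewrite -(eqn_modDr d.-1) add1n prednK// modnn.
case: eqP => [->|/eqP x1].
  under eq_bigr do rewrite mul0n expr0.
  by rewrite sumr_const card_ord mulrC.
by rewrite (prim_geom v_prim) ?mulr0// lt0n x1 ltn_mod.
Qed.

Lemma fourier_modn (g : 'Z_N -> C) n : fourier g (n %% N) = fourier g n.
Proof.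
have w_prim : N.-primitive_root w := unit_exp_prim R (ltnW N_gt1).
by apply: eq_bigr => x _; rewrite -(prim_expr_mod w_prim) modnMml (prim_expr_mod w_prim).
Qed.

Definition self_dual (g : 'Z_N -> C) : Prop :=
  forall n : nat, fourier g n = fourier g 1 * (g n%:R)^*.

(** If the factor were 0, the Fourier transform would vanish, and [g 1] with it
    by inversion. *)
Lemma self_dual_neq0 g : g 1 = 1 -> self_dual g -> fourier g 1 != 0.
Proof.
move=> g1 gd; apply/eqP => g0.
have := fourier_progression g (muln1 N); rewrite big1; last first.
  by move=> b _; rewrite gd g0 !mul0r.
move/esym/eqP; rewrite (big_pred1 (1 : 'Z_N)); last by move=> x /=; rewrite -Zp_nat_eq// natr_Zp.
by rewrite g1 mulr1 pnatr_eq0 -leqn0 leqNgt ltnW.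
Qed.

Section Character.
Variable f : 'Z_N -> C.
Hypotheses (f_val : forall x, f x = 0 \/ m.-unity_root (f x)) (f1 : f 1 = 1).
Hypothesis f_eq0 : forall n : 'Z_N, f n = 0 <-> (1 < gcdn n N)%N.

Lemma f_nonunit (x : 'Z_N) : ~~ coprime x N -> f x = 0.
Proof.
move=> xN; apply/f_eq0; rewrite ltn_neqAle eq_sym xN.
by rewrite gcdn_gt0 (ltnW N_gt1) orbT.
Qed.

Lemma f_unity (x : 'Z_N) : coprime x N -> f x ^+ m = 1.
Proof.
move=> xN; case: (f_val x) => [/f_eq0|/unity_rootP//].
by rewrite (eqP xN).
Qed.

Lemma twist_unity (c : {unit 'Z_m}) (x : 'Z_N) : coprime x N -> twist f c x ^+ m = 1.
Proof. by move=> xN; rewrite /twist xN exprAC f_unity// expr1n. Qed.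

Lemma twist1 (c : {unit 'Z_m}) : twist f c 1 = 1.
Proof. by rewrite /twist coprime1n f1 expr1n. Qed.

Lemma twist_id : twist f (1%g : {unit 'Z_m}) = f.
Proof.
apply/funext => x; rewrite /twist; case: ifP => [_|/negbT/f_nonunit->//].
have -> : (val (1%g : {unit 'Z_m}) : 'Z_m) = 1%N :> nat by [].
by rewrite expr1.
Qed.

Lemma twist_le (c : {unit 'Z_m}) x : normc (twist f c x) <= 1.
Proof.
have [xN|xN] := boolP (coprime x N); last by rewrite /twist (negPf xN) normc0.
have h : normc (twist f c x) ^+ m = 1.
  by rewrite -normcX twist_unity// -[1]/(1%:R) normc_nat.
by move/eqP: h; rewrite pexpr_eq1 ?normc_ge0 1?ltnW// => /eqP ->.
Qed.

(** For [a = 1] the order [m] is even, as [f] takes opposite values, so the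
    exponent [c] is odd. *)
Lemma twist_opp a (c : {unit 'Z_m}) x : (a < 2)%N -> (forall y, f (- y) = (-1) ^+ a * f y) ->
  twist f c (- x) = (-1) ^+ a * twist f c x.
Proof.
move=> a2 fa.
have cN : coprime (- x : 'Z_N)%R N = coprime x N.
  apply/idP/idP; apply: contraTT => /f_nonunit h.
    have h' : f (- x) = 0 by rewrite fa h mulr0.
    by move/f_eq0: h'; rewrite ltn_neqAle eq_sym => /andP[].
  have h' : f x = 0 by rewrite -[x]opprK fa h mulr0.
  by move/f_eq0: h'; rewrite ltn_neqAle eq_sym => /andP[].
rewrite /twist cN; case: ifP => xN; last by rewrite mulr0.
rewrite fa exprMn; congr (_ * _).
case: a a2 fa => [|[|//]] _ fa; first by rewrite expr0 expr1n.
have m2 : ~~ odd m.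
  have : f (- x) ^+ m = 1 by rewrite f_unity// cN.
  rewrite fa expr1 mulN1r exprNn f_unity// mulr1 -signr_odd.
  by case: (odd m) => //= /eqP; rewrite eqNr oner_eq0.
rewrite !expr1 -signr_odd; suff -> : odd (val c : 'Z_m) by rewrite expr1.
have := coprime_unit c; apply: contraTT => c2.
rewrite /coprime; apply/eqP => h.
have : (2 %| gcdn (val c : 'Z_m) m)%N by rewrite dvdn_gcd !dvdn2 c2 m2.
by rewrite h.
Qed.

Local Notation l := (N * m)%N.
Local Notation om := (unit_exp (l%:R^-1 : R)).

(** Self-duality of [f] says that [fourier f n * f n] does not depend on the unit
    [n]. With the values of [f] written as powers of [om ^ N], this is the
    vanishing at [om] of a rational polynomial; the lemma is its vanishing at
    [om ^ t], for [t] congruent to [c] modulo [m] and to [r] modulo [N]. *)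
Lemma twist_shift (c : {unit 'Z_m}) (r n : nat) : self_dual f ->
  coprime r N -> coprime n N -> (val c : 'Z_m) = r %[mod gcdn m N] ->
  fourier (twist f c) (r * n) * twist f c n%:R = fourier (twist f c) r.
Proof.
move=> fd rN nN cr.
have [N0 m0] := (ltnW N_gt1, ltnW m_gt1).
have om_prim : l.-primitive_root om by apply: unit_exp_prim; rewrite muln_gt0 N0.
have zE : N.-primitive_root (om ^+ m).
  by have := dvdn_prim_root om_prim (dvdn_mulr m (dvdnn N)); rewrite mulKn.
have zm : m.-primitive_root (om ^+ N).
  by have := dvdn_prim_root om_prim (dvdn_mull N (dvdnn m)); rewrite mulnK.
have wE : om ^+ m = w.
  rewrite unit_expX natrM; congr unit_exp.
  by field; rewrite !pnatr_eq0 -!lt0n N0 m0.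
have /(@choice _ _ (fun (x : 'Z_N) i => coprime x N -> f x = (om ^+ N) ^+ i))[e he] :
    forall x : 'Z_N, exists i, coprime x N -> f x = (om ^+ N) ^+ i.
  move=> x; have [xN|_] := boolP (coprime x N); last by exists 0%N.
  by have [i ->] := prim_rootP zm (f_unity xN); exists i.
have [t tm tN] := crt_compatible m0 cr.
have tl : coprime t l.
  rewrite coprimeMr -(coprime_modl t m) -(coprime_modl t N) tm tN !coprime_modl rN.
  exact: coprime_unit.
have omt : l.-primitive_root (om ^+ t) by rewrite (prim_root_exp_coprime _ om_prim).
pose en := e n%:R.
pose p : {poly rat} := \sum_(x : 'Z_N | coprime x N)
  ('X^(N * (e x + en) + m * (n * x)) - 'X^(N * e x + m * x)).
have pE z : (map_poly (ratr : rat -> C) p).[z] = \sum_(x : 'Z_N | coprime x N)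
    ((z ^+ N) ^+ (e x + en) * (z ^+ m) ^+ (n * x) - (z ^+ N) ^+ e x * (z ^+ m) ^+ x).
  rewrite rmorph_sum horner_sum; apply: eq_bigr => x _.
  by rewrite rmorphB /= !map_polyXn !hornerE !(exprD z) !(exprM z) exprM.
have sumE g k : (forall x : 'Z_N, ~~ coprime x N -> g x = 0) ->
    fourier g k = \sum_(x : 'Z_N | coprime x N) g x * w ^+ (k * x).
  move=> g0; rewrite /fourier (bigID (fun x : 'Z_N => coprime x N)) /=.
  by rewrite [X in _ + X]big1 ?addr0// => y /g0 ->; rewrite mul0r.
have nZ : coprime (n%:R : 'Z_N) N by rewrite coprime_nat_Zp.
have fen : f n%:R = (om ^+ N) ^+ en by rewrite he.
have rp : root (map_poly ratr p) om.
  rewrite /root pE sumrB subr_eq0.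
  have f0 := f_nonunit; apply/eqP.
  transitivity (fourier f n * f n%:R).
    rewrite sumE// mulr_suml; apply: eq_bigr => x xN.
    by rewrite wE exprD -he// -fen; ring.
  rewrite fd -mulrA [_^* * _]mulrC (unity_conj m0) ?f_unity// mulr1 sumE//.
  by apply: eq_bigr => x xN; rewrite wE -he// mul1n.
have := ratr_root_conj om_prim omt rp; rewrite /root pE sumrB subr_eq0 => /eqP E.
have zc k : ((om ^+ t) ^+ N) ^+ k = ((om ^+ N) ^+ k) ^+ (val c : 'Z_m).
  by rewrite [in RHS]exprAC; congr (_ ^+ k); rewrite exprAC -(prim_expr_mod zm) tm (prim_expr_mod zm).
have wr k : ((om ^+ t) ^+ m) ^+ k = w ^+ (r * k).
  by rewrite exprM; congr (_ ^+ k); rewrite exprAC -(prim_expr_mod zE) tN (prim_expr_mod zE) wE.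
have tw0 (x : 'Z_N) : ~~ coprime x N -> twist f c x = 0 by rewrite /twist => /negPf ->.
have twE (x : 'Z_N) : coprime x N -> twist f c x = ((om ^+ N) ^+ e x) ^+ (val c : 'Z_m).
  by rewrite /twist => xN; rewrite xN he.
transitivity (\sum_(x : 'Z_N | coprime x N) ((om ^+ t) ^+ N) ^+ (e x + en) * ((om ^+ t) ^+ m) ^+ (n * x)).
  rewrite sumE// mulr_suml; apply: eq_bigr => x xN.
  by rewrite exprD !zc wr !twE// mulnA mulrAC.
rewrite E sumE//; apply: eq_bigr => x xN.
by rewrite zc wr twE.
Qed.

(** Self-duality of [f ^ c] turns [twist_shift] into
    [f ^ c (x y) = f ^ c (x) * f ^ c (y)], and the exponent [c] can be removed
    because it is prime to [m]. *)
Lemma self_dual_mul : self_dual f ->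
  (forall r, coprime r N -> exists c : {unit 'Z_m},
     self_dual (twist f c) /\ (val c : 'Z_m) = r %[mod gcdn m N]) ->
  forall x y : 'Z_N, f (x * y) = f x * f y.
Proof.
move=> fd hc x y; have m0 := ltnW m_gt1.
have xyN : coprime (x * y : 'Z_N)%R N = coprime x N && coprime y N.
  by rewrite -[x in LHS]natr_Zp -[y in LHS]natr_Zp -natrM coprime_nat_Zp coprimeMl.
have [xN|xN] := boolP (coprime x N); last first.
  by rewrite (f_nonunit xN) mul0r f_nonunit// xyN (negPf xN).
have [yN|yN] := boolP (coprime y N); last first.
  by rewrite (f_nonunit yN) mulr0 f_nonunit// xyN andbC (negPf yN).
have [c [cd cx]] := hc x xN.
have := twist_shift fd xN yN cx; rewrite cd [in RHS]cd -mulrA.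
move/(mulfI (self_dual_neq0 (twist1 c) cd)); rewrite natrM !natr_Zp => E.
have xyN' : coprime (x * y : 'Z_N)%R N by rewrite xyN xN.
have ux := unity_conj m0 (twist_unity c xN).
have uxy := unity_conj m0 (twist_unity c xyN').
have Ec : twist f c (x * y) = twist f c x * twist f c y.
  rewrite -[RHS]mul1r -uxy -[LHS]mulr1 -ux.
  transitivity (twist f c (x * y) * twist f c x * ((twist f c (x * y))^* * twist f c y)); last by ring.
  by rewrite E; ring.
move: Ec; rewrite /twist xyN' xN yN -exprMn => Ec.
have nz (z : 'Z_N) : coprime z N -> f z != 0.
  move=> zN; apply/negP => /eqP /f_eq0; by rewrite (eqP zN).
have cm : (0 < (val c : 'Z_m))%N.
  by have := coprime_unit c; case: (nat_of_ord _) => //; rewrite /coprime gcd0n (gtn_eqF m_gt1).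
have : (f (x * y) / (f x * f y)) ^+ gcdn (val c : 'Z_m) m = 1.
  apply: unity_gcd => //.
    by rewrite expr_div_n Ec divff// expf_neq0// mulf_neq0 ?nz.
  by rewrite expr_div_n exprMn !f_unity// !mulr1 divr1.
rewrite (eqP (coprime_unit c)) expr1 => /(congr1 (fun z => z * (f x * f y))).
by rewrite mul1r divfK// mulf_neq0 ?nz.
Qed.

Section Primitive.
Hypotheses (fd : self_dual f) (fM : forall x y : 'Z_N, f (x * y) = f x * f y).

(** An induced modulus [d < N], with [N = d * e], would make the sum of [f] over
    the residues congruent to 1 modulo [d] a positive integer, whereas
    [fourier f] vanishes at the multiples of [e]. *)
Lemma self_dual_primitive : primitive_character f.
Proof.
split; first by split=> // x; rewrite f_eq0; split=> [h|/f_nonunit/f_eq0//];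
  by rewrite /coprime eq_sym ltn_eqF.
move=> d [/dvdnP[e eN] fi]; apply/negP => dN.
have d0 : (0 < d)%N by move: (ltnW N_gt1); rewrite eN muln_gt0 => /andP[].
have e1 : (1 < e)%N.
  by move: dN (ltnW N_gt1); rewrite eN muln_gt0; case: (e) => [|[|//]]; rewrite ?mul1n ?ltnn.
have := fourier_progression f (etrans (mulnC d e) (esym eN)).
rewrite big1; last first.
  move=> b _; rewrite fd f_nonunit ?rmorph0 ?mulr0 ?mul0r//.
  rewrite coprime_nat_Zp coprimeMl eN coprimeMr [coprime e e]/coprime gcdnn.
  by rewrite (gtn_eqF e1).
have -> : \sum_(x : 'Z_N | x == 1 %[mod d]) f x =
    (\sum_(x : 'Z_N | x == 1 %[mod d]) coprime x N)%N%:R.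
  rewrite natr_sum; apply: eq_bigr => x /eqP x1.
  have [xN|/f_nonunit->//] := boolP (coprime x N).
  by rewrite -[x in f x]natr_Zp fi.
move/esym/eqP; rewrite -natrM pnatr_eq0 muln_eq0 -leqn0 leqNgt d0 /=.
by rewrite sum_nat_eq0 => /forallP/(_ 1); rewrite eqxx coprime1n.
Qed.

Hypothesis fprim : forall d : nat, induced_modulus f d -> ~~ (d < N)%N.

Lemma f_expn (x : 'Z_N) k : f (x ^+ k) = f x ^+ k.
Proof. by elim: k => [|k IH]; rewrite ?expr0 ?f1// !exprS fM IH. Qed.

(** If [N = j * k ^ 2] and [n] is congruent to 1 modulo [j * k], then [n ^ k] is
    congruent to 1 modulo [N]: both [k] and [m] kill [f n], and they are
    coprime. Hence [j * k] is an induced modulus. *)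
Lemma coprime_order_squarefree : coprime m N -> squarefree N.
Proof.
move=> mN k; rewrite -mulnn => /dvdnP[j jN]; apply/eqP/negPn/negP => k1.
have N0 := ltnW N_gt1.
have [j0 k0] : (0 < j)%N /\ (0 < k)%N by move: N0; rewrite jN !muln_gt0 => /and3P[].
have k2 : (1 < k)%N by move: k1 k0; case: (k) => [|[]].
suff ind : induced_modulus f (j * k) by have := fprim ind; rewrite jN mulnA ltn_Pmulr// muln_gt0 j0.
split=> [|n nN n1]; first by rewrite jN mulnA dvdn_mulr.
have n0 : (0 < n)%N by case: (n) nN => //; rewrite /coprime gcd0n gtn_eqF.
have nk : n ^ k = 1 %[mod N].
  apply/eqP; rewrite eqn_mod_dvd ?expn_gt0 ?n0// subn1 predn_exp jN mulnA.
  apply: dvdn_mul; first by rewrite -subn1 -eqn_mod_dvd//; apply/eqP.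
  have nk1 : n = 1 %[mod k].
    by rewrite -(modn_dvdm _ (dvdn_mull j (dvdnn k))) n1 modn_dvdm ?dvdn_mull.
  rewrite /dvdn -modn_summ; under eq_bigr do rewrite -modnXm nk1 modnXm exp1n.
  by rewrite modn_summ sum_nat_const card_ord muln1 modnn.
have nZ : coprime (n%:R : 'Z_N) N by rewrite coprime_nat_Zp.
have fk : f n%:R ^+ k = 1.
  by rewrite -f_expn -natrX -[RHS]f1; congr f; apply/eqP; rewrite -[1]/(1%:R) Zp_nat_eq//; apply/eqP.
have km : coprime k m.
  by rewrite coprime_sym; apply: coprime_dvdr mN; rewrite jN mulnA dvdn_mull.
by have := unity_gcd k0 fk (f_unity nZ); rewrite (eqP km) expr1.
Qed.

(** If [N = 2 * j] with [j] odd, every unit is congruent to 1 modulo 2, so that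
    [j] is an induced modulus. *)
Lemma primitive_odd : squarefree N -> odd N.
Proof.
move=> sq; apply/negPn/negP => ev; have N0 := ltnW N_gt1.
have [j jN] : exists j, N = (j * 2)%N by apply/dvdnP; rewrite dvdn2.
have jodd : odd j.
  apply/negPn/negP; rewrite -dvdn2 => /dvdnP[i ij].
  by have := sq 2%N; rewrite jN ij -mulnA dvdn_mull// => /(_ isT).
have j0 : (0 < j)%N by case: (j) jodd.
suff ind : induced_modulus f j by have := fprim ind; rewrite jN ltn_Pmulr.
split=> [|n nN n1]; first by rewrite jN dvdn_mulr.
suff -> : n%:R = 1 :> 'Z_N by [].
apply/eqP; rewrite -[1]/(1%:R) Zp_nat_eq// jN chinese_remainder ?coprimen2//.
rewrite n1 eqxx /= !modn2; move: nN; rewrite jN coprimeMr => /andP[_].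
by rewrite coprimen2 => ->.
Qed.
End Primitive.

End Character.

End Twists.

(** * The converse theorem *)

Theorem theorem1p1 (R : realType) (N m : nat) (N_gt1 : (1 < N)%N)
  (m_gt1 : (1 < m)%N)
  (L : ('Z_N -> R[i]) -> R[i] -> R[i])
  (L_cont : forall g : 'Z_N -> R[i], is_Lfunction g (L g))
  (f : 'Z_N -> R[i]) (a : nat)
  (f_val : forall x : 'Z_N, f x = 0 \/ m.-unity_root (f x))
  (f_order : has_order f m) (f_parity : has_parity f a)
  (f1 : f 1 = 1)
  (f_eq0 : forall n : 'Z_N, f n = 0 <-> (1 < gcdn n N)%N)
  (H : {group {unit 'Z_m}})
  (H_surj : reduction_surjective (gcdn m N) H)
  (L_regular : forall c : {unit 'Z_m}, c \in H ->
     regular_at (L (twist f c)) 1)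
  (func_eq : forall c : {unit 'Z_m}, c \in H ->
     exists2 eps : R[i], eps != 0 &
       eq_meromorphic
         (completed N a (L (twist f c)))
         (fun s => eps * completed N a (L (conj_fun (twist f c))) (1 - s))) :
  primitive_character f /\ (coprime m N -> odd N /\ squarefree N).
Proof.
have [a2 fa] := f_parity.
have f_opp x : f (- x) = (-1) ^+ a * f x.
  have := fa (val x)%:Z; rewrite mulrNz -!pmulrn natr_Zp; exact.
have dual c : c \in H -> self_dual (twist f c).
  move=> cH; have [eps eps0 fe] := func_eq c cH.
  have main n : (0 < n)%N -> fourier (twist f c) n = fourier (twist f c) 1 * (twist f c n%:R)^*.
    apply: (fourier_conj N_gt1 a2 _ _ _ (L_cont _) (L_cont _) (L_regular c cH) eps0 fe).
    - by move=> x; apply: (twist_opp N_gt1 m_gt1).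
    - by move=> x; apply: twist_le.
    - exact: twist1.
  (* both sides depend on the index modulo N only, and N is positive *)
  move=> [|n]; last exact: main.
  have N0 := ltnW N_gt1.
  by rewrite -(modnn N) fourier_modn// main// modnn pchar_Zp.
have fd : self_dual f.
  by rewrite -(twist_id m N_gt1 f_eq0); apply: dual; exact: group1.
have fM : forall x y : 'Z_N, f (x * y) = f x * f y.
  apply: (self_dual_mul N_gt1 m_gt1 f_val f1 f_eq0 fd) => r rN.
  have rd : coprime r (gcdn m N) by apply: coprime_dvdr rN; exact: dvdn_gcdr.
  by have [c cH cr] := H_surj r rd; exists c; split; first exact: dual.
have [fchar fprim] : primitive_character f by exact: self_dual_primitive.
split=> // mN.
have sq : squarefree N by apply: (coprime_order_squarefree N_gt1 f_val f1 f_eq0 fM).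
by split=> //; exact: (primitive_odd N_gt1 f1).
Qed.
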